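(* Let $(a,b,c)\in\mathbb{R}^3$ and let $(\Sigma,ds^2)$ be a generalized Ricci torus of type $(a,b,c)$, i.e. a generalized Ricci surface of type $(a,b,c)$ with $\Sigma$ diffeomorphic to the $2$-torus; let $K$ be its curvature. (1) If $c=0$, then $\Sigma$ is flat. (2) If $c>0$, then $b\leqslant0$ and $K\leqslant c$; if moreover $b=0$ and $\Sigma$ is not flat, then $a>0$ and $K<c$. (3) If $c<0$, then $b\leqslant0$ and $K\geqslant c$; if moreover $b=0$ and $\Sigma$ is not flat, then $a<0$ and $K>c$.
   Context: Smooth means of class $C^\infty$; surfaces are connected and without boundary. For $(a,b,c)\in\mathbb{R}^3$, a smooth Riemannian surface $(\Sigma,ds^2)$ with Gaussian curvature $K$ is a generalized Ricci surface of type $(a,b,c)$ if $(c-K)\Delta K+\|\nabla K\|^2+(aK+b)(K-c)^2=0$ on $\Sigma$, where $\Delta=\operatorname{div}\nabla$. Flat means $K\equiv0$. *)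

(* Defs.v *)
From HB Require Import structures.
From mathcomp Require Import all_boot all_order all_algebra.
From mathcomp Require Import all_classical all_reals all_analysis.

Set Implicit Arguments.
Unset Strict Implicit.
Unset Printing Implicit Defensive.

Import Order.TTheory GRing.Theory Num.Theory.
Import numFieldNormedType.Exports.

Local Open Scope classical_set_scope.
Local Open Scope ring_scope.

Definition partial (R : realType) (i : 'I_2) (f : 'rV[R]_2 -> R)
  (p : 'rV[R]_2) : R := 'D_(delta_mx 0 i) f p.

(* Only used for open U, so that neither the values of f nor those of its
   partial derivatives outside U matter. *)
Fixpoint class_C (R : realType) (U : set 'rV[R]_2) (k : nat)
    (f : 'rV[R]_2 -> R) : Prop :=
  (forall p, U p -> {for p, continuous f}) /\
  if k is k'.+1 then
    forall i : 'I_2, (forall p, U p -> derivable f p (delta_mx 0 i)) /\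
                     class_C U k' (partial i f)
  else True.

Definition smooth_on (R : realType) (U : set 'rV[R]_2) (f : 'rV[R]_2 -> R) :=
  forall k, class_C U k f.

Definition smooth_map_on (R : realType) (U : set 'rV[R]_2)
  (F : 'rV[R]_2 -> 'rV[R]_2) := forall j : 'I_2, smooth_on U (fun p => F p 0 j).

(* [chart_fun] is only meaningful on [chart_dom], [chart_inv] on [chart_img]. *)
Record chart (R : realType) (M : Type) := Chart {
  chart_dom : set M;
  chart_img : set 'rV[R]_2;
  chart_fun : M -> 'rV[R]_2;
  chart_inv : 'rV[R]_2 -> M }.

Definition is_chart (R : realType) (M : topologicalType) (phi : chart R M) :=
  [/\ open (chart_dom phi) /\ open (chart_img phi),
      forall x, chart_dom phi x ->
        chart_img phi (chart_fun phi x) /\ chart_inv phi (chart_fun phi x) = x,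
      forall p, chart_img phi p ->
        chart_dom phi (chart_inv phi p) /\ chart_fun phi (chart_inv phi p) = p,
      forall x, chart_dom phi x -> {for x, continuous (chart_fun phi)} &
      forall p, chart_img phi p -> {for p, continuous (chart_inv phi)}].

Definition transition (R : realType) (M : Type) (phi psi : chart R M) :
  'rV[R]_2 -> 'rV[R]_2 := chart_fun psi \o chart_inv phi.

Definition overlap (R : realType) (M : Type) (phi psi : chart R M) :
  set 'rV[R]_2 := chart_img phi `&` chart_inv phi @^-1` chart_dom psi.

Record charted_space (R : realType) := ChartedSpace {
  carrier :> topologicalType;
  atlas : set (chart R carrier) }.

Arguments atlas {R} _.

Definition smooth_surface (R : realType) (S : charted_space R) : Prop :=
  [/\ hausdorff_space S, @second_countable S, connected [set: S] &
      [/\ forall phi, atlas S phi -> is_chart phi,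
          forall x : S, exists2 phi, atlas S phi & chart_dom phi x &
          forall phi psi, atlas S phi -> atlas S psi ->
            smooth_map_on (overlap phi psi) (transition phi psi)]].

Definition smooth_map (R : realType) (S S' : charted_space R) (f : S -> S') :=
  continuous f /\
  forall phi psi, atlas S phi -> atlas S' psi ->
    smooth_map_on (chart_img phi `&` (f \o chart_inv phi) @^-1` chart_dom psi)
                  (chart_fun psi \o f \o chart_inv phi).

Definition diffeomorphic (R : realType) (S S' : charted_space R) : Prop :=
  exists (f : S -> S') (h : S' -> S),
    [/\ cancel f h, cancel h f, smooth_map f & smooth_map h].

Section torus.
Variable R : realType.

Definition int_congr : rel 'rV[R]_2 := fun p q => p - q \is a mxOver Num.int.

Lemma int_congr_equiv : equiv_class_of int_congr.
Proof.
have symm (p q : 'rV[R]_2) :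
    p - q \is a mxOver Num.int -> q - p \is a mxOver Num.int.
  move=> /mxOverP pq; apply/mxOverP => i j; move: (pq i j).
  by rewrite -opprB [X in X \in _]mxE rpredN.
split=> [p|p q|q p r]; rewrite /int_congr.
- by apply/mxOverP => i j; rewrite subrr [X in X \in _]mxE rpred0.
- by apply/idP/idP; exact: symm.
- move=> /mxOverP pq /mxOverP qr; apply/mxOverP => i j.
  rewrite -[p](subrK q) -addrA [X in X \in _]mxE.
  by apply: rpredD; [exact: pq|exact: qr].
Qed.

Canonical int_congr_equivRel := EquivRelPack int_congr_equiv.

Definition torus_space : topologicalType :=
  quotient_topology {eq_quot int_congr_equivRel}%qT.

Definition torus_proj (p : 'rV[R]_2) : torus_space :=
  (\pi_(quotient_topology {eq_quot int_congr_equivRel}) p)%qT.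

(* The norm of 'rV[R]_2 is the sup norm: the ball of radius 1/2 is an open unit
   square, on which the projection is injective. *)
Definition torus_chart (p0 : 'rV[R]_2) : chart R torus_space :=
  Chart (torus_proj @` ball p0 (2^-1)) (ball p0 (2^-1))
    (fun x => xget p0 [set q | ball p0 (2^-1) q /\ torus_proj q = x])
    torus_proj.

Definition torus : charted_space R := ChartedSpace (range torus_chart).

End torus.

(* The metric tensor of a surface, given by its matrix in each chart. *)
Definition metric_tensor (R : realType) (S : charted_space R) :=
  chart R S -> 'rV[R]_2 -> 'M[R]_2.

(* Row i of this matrix is the derivative of F in the direction i, so the
   pullback of a bilinear form of matrix A is J *m A *m J^T. *)
Definition jacobian_mx (R : realType) (F : 'rV[R]_2 -> 'rV[R]_2)
  (p : 'rV[R]_2) : 'M[R]_2 := \matrix_(i, j) partial i (fun q => F q 0 j) p.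

Definition riemannian_metric (R : realType) (S : charted_space R)
    (g : metric_tensor S) : Prop :=
  (forall phi, atlas S phi ->
    [/\ forall i j, smooth_on (chart_img phi) (fun p => g phi p i j),
        forall p, chart_img phi p -> (g phi p)^T = g phi p &
        forall p, chart_img phi p -> forall v : 'rV[R]_2, v != 0 ->
          0 < (v *m g phi p *m v^T) 0 0]) /\
  (forall phi psi, atlas S phi -> atlas S psi ->
    forall p, overlap phi psi p ->
      g phi p = jacobian_mx (transition phi psi) p
                *m g psi (transition phi psi p)
                *m (jacobian_mx (transition phi psi) p)^T).

Section coordinates.
Variables (R : realType) (g : 'rV[R]_2 -> 'M[R]_2).
Implicit Types (f : 'rV[R]_2 -> R) (X : 'I_2 -> 'rV[R]_2 -> R) (p : 'rV[R]_2).

(* christoffel k i j = Gamma^k_ij *)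
Definition christoffel (k i j : 'I_2) p : R :=
  2^-1 * \sum_(l < 2) invmx (g p) k l *
    (partial i (fun q => g q j l) p + partial j (fun q => g q i l) p
     - partial l (fun q => g q i j) p).

(* R(d_i, d_j) d_k = \sum_l (riemann l i j k) d_l,
   with R(X, Y) = [nabla_X, nabla_Y] - nabla_[X, Y] *)
Definition riemann (l i j k : 'I_2) p : R :=
  partial i (christoffel l j k) p - partial j (christoffel l i k) p
  + \sum_(m < 2) (christoffel l i m p * christoffel m j k p
                  - christoffel l j m p * christoffel m i k p).

(* <R(d_0, d_1) d_1, d_0> / (|d_0|^2 |d_1|^2 - <d_0, d_1>^2) *)
Definition chart_curvature p : R :=
  (\sum_(l < 2) riemann l 0 1 1 p * g p l 0) / \det (g p).

Definition chart_grad f (i : 'I_2) p : R :=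
  \sum_(j < 2) invmx (g p) i j * partial j f p.

Definition chart_div X p : R :=
  (Num.sqrt (\det (g p)))^-1 *
  \sum_(i < 2) partial i (fun q => Num.sqrt (\det (g q)) * X i q) p.

Definition chart_laplacian f p : R := chart_div (chart_grad f) p.

Definition chart_grad_norm2 f p : R :=
  \sum_(i < 2) \sum_(j < 2) g p i j * chart_grad f i p * chart_grad f j p.

End coordinates.

(* The value at x of a quantity computed in any chart around x; it is only used
   for quantities which do not depend on the chart. *)
Definition from_charts (R : realType) (S : charted_space R)
    (F : chart R S -> 'rV[R]_2 -> R) (x : S) : R :=
  xget 0 [set F phi (chart_fun phi x) |
           phi in [set phi | atlas S phi /\ chart_dom phi x]].

Section riemannian.
Variables (R : realType) (S : charted_space R) (g : metric_tensor S).

Definition gaussian_curvature : S -> R :=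
  from_charts (fun phi => chart_curvature (g phi)).

Definition laplacian (f : S -> R) : S -> R :=
  from_charts (fun phi => chart_laplacian (g phi) (f \o chart_inv phi)).

Definition grad_norm2 (f : S -> R) : S -> R :=
  from_charts (fun phi => chart_grad_norm2 (g phi) (f \o chart_inv phi)).

Definition generalized_Ricci_surface (a b c : R) : Prop :=
  [/\ smooth_surface S, riemannian_metric g &
      let K := gaussian_curvature in
      forall x, (c - K x) * laplacian K x + grad_norm2 K x
                + (a * K x + b) * (K x - c) ^+ 2 = 0].

Definition flat : Prop := forall x, gaussian_curvature x = 0.

End riemannian.

(* Main.v *)
Require Import Defs.
From HB Require Import structures.
From mathcomp Require Import all_boot all_order all_algebra.
From mathcomp Require Import all_classical all_reals all_analysis.
From mathcomp Require Import ring lra.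

(** Through a diffeomorphism with the torus, the surface becomes the plane with
a metric g that is invariant under integer translations.  Put u = K - c, let rho
be the area density of g and A^ij = rho g^ij, a symmetric matrix field of
determinant one.  The Ricci equation then reads

  u div(A grad u) = A(grad u, grad u) + rho (a K + b) u^2,

and Liouville's formula writes rho K as the divergence of a periodic field, so
that the integral of rho K over the unit square vanishes: this is the only form
of the Gauss-Bonnet theorem that is used ([int2_rhoK]).  These data form a
[ricci_system]; [ricci_core] proves the proposition for them.

The equation degenerates where u vanishes.  Multiplying it by a function h(u)
and integrating by parts gives ([energy_identity])

  int ((h(u) u)' + h(u)) A(grad u, grad u) + int rho (a K + b) h(u) u^2 = 0.

Take h(u) = (1 + ln(1 + u^2/d)) / (u^2 + d).  The first integrand then dominates
the square of the gradient of ln(1 + u^2/d), while h(u) u^2 stays within 1 of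
ln(1 + u^2/d).  Choose d such that this logarithm has maximum at most T, and
divide it by T: the resulting function L_T ([test]) lies between 0 and 1,
vanishes exactly where u does, tends to 1 elsewhere as T grows, and the integral
of its squared gradient is O(1/T).  If u took both signs, every broken path
made of one horizontal and one vertical segment, joining a small segment where
u > 0 to one where u <= 0, would meet a zero of u, so that L_T would vary by
about 1 along each of these paths; integrating over the paths contradicts the
small energy ([no_sign_change]).  The same paths show that the integral of
1 - L_T tends to 0 ([small_deficit]).

As u has one sign and rho K has integral 0, c = 0 forces K = 0 and c > 0 forces
K <= c.  If u is not identically zero, the energy identity now bounds the
integral of rho (a K + b), which is b times the area, by a quantity tending
to 0, so b <= 0 ([b_le0]).  If b = 0 and a <= 0 < c, the constant h = 1 gives a
sum of two nonnegative terms, because the integral of rho K u^2 is that of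
rho K^2 (K - 2c) <= 0; hence K is constant, thus zero ([a_gt0]).

Strictness when b = 0 ([no_zero]): if u(p) = 0, then p is a maximum, u vanishes
there to second order, and L_T <= 1/2 on a square of side r = exp(-T/4) at p.
But the energy of L_T is now o(1/T), below the logarithmic capacity of such a
square.  This is made quantitative by testing L_T against the Laplacian of the
periodic version of ln(|x - p|^2 + r^2), which is large on the square and
bounded below everywhere.

For c < 0, replace (K, a, c) by (-K, -a, -c) ([ricci_system_opp]).

It remains to compare the metric on the plane with the charts of the surface.
The transformation rule of the Christoffel symbols ([christoffel_pull]) follows
from the fact that they are determined by the first derivatives of the metric;
differentiating it once more gives that of the curvature tensor, hence
[curvature_pull]; it also makes the Hessian, and so the Laplacian, invariant
([laplacian_pull]). *)

Set Implicit Arguments.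
Unset Strict Implicit.
Unset Printing Implicit Defensive.

Import Order.TTheory GRing.Theory Num.Theory.
Import numFieldNormedType.Exports.

Local Open Scope classical_set_scope.
Local Open Scope ring_scope.

(** * Partial derivatives in the plane *)

Section plane.
Variable R : realType.
Local Notation plane := 'rV[R]_2.

Definition pt (x y : R) : plane := \row_j (if j == 0 then x else y).

Lemma ord2P (i : 'I_2) : i = 0 \/ i = 1.
Proof.
by case: i => -[|[|//]] H; [left|right]; apply: val_inj.
Qed.

Lemma sum2 (V : nmodType) (F : 'I_2 -> V) : \sum_(i < 2) F i = F 0 + F 1.
Proof.
by rewrite big_ord_recl big_ord1; congr (F _ + F _); apply: val_inj.
Qed.

Lemma pt0 x y : pt x y 0 0 = x. Proof. by rewrite mxE. Qed.
Lemma pt1 x y : pt x y 0 1 = y. Proof. by rewrite mxE. Qed.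

Lemma row2P (p q : plane) : p 0 0 = q 0 0 -> p 0 1 = q 0 1 -> p = q.
Proof. by move=> e0 e1; apply/rowP => j; case: (ord2P j) => ->. Qed.

Lemma pt_eta (p : plane) : pt (p 0 0) (p 0 1) = p.
Proof. by apply: row2P; rewrite ?pt0 ?pt1. Qed.

Lemma pt_shift0 h x y : h *: delta_mx 0 0 + pt x y = pt (h + x) y.
Proof. by apply: row2P; rewrite !mxE /= ?mulr1 ?mulr0 ?add0r. Qed.

Lemma pt_shift1 h x y : h *: delta_mx 0 1 + pt x y = pt x (h + y).
Proof. by apply: row2P; rewrite !mxE /= ?mulr1 ?mulr0 ?add0r. Qed.

Lemma norm2 (p : plane) : `|p| = Num.max `|p 0 0| `|p 0 1|.
Proof.
apply/eqP; rewrite eq_le; apply/andP; split.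
  rewrite [leLHS]mx_normrE; apply: bigmax_le.
    by rewrite le_max normr_ge0.
  move=> [i j] _ /=; rewrite (ord1 i).
  by case: (ord2P j) => ->; rewrite le_max lexx ?orbT.
by rewrite ge_max; apply/andP; split; rewrite [leRHS]mx_normrE;
  [exact: (le_bigmax _ (fun ij : 'I_1 * 'I_2 => `|p ij.1 ij.2|) (0, 0))
  |exact: (le_bigmax _ (fun ij : 'I_1 * 'I_2 => `|p ij.1 ij.2|) (0, 1))].
Qed.

Lemma derivable0E (f : plane -> R) x y :
  derivable f (pt x y) (delta_mx 0 0) <-> derivable (fun t => f (pt t y)) x 1.
Proof.
rewrite /derivable; set a := (X in cvg (X @ _)); set b := (X in _ <-> cvg (X @ _)).
suff -> : a = b by [].
by apply/funext => h; rewrite /a /b /= pt_shift0 [h%:A]mulr1.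
Qed.

Lemma derivable1E (f : plane -> R) x y :
  derivable f (pt x y) (delta_mx 0 1) <-> derivable (fun t => f (pt x t)) y 1.
Proof.
rewrite /derivable; set a := (X in cvg (X @ _)); set b := (X in _ <-> cvg (X @ _)).
suff -> : a = b by [].
by apply/funext => h; rewrite /a /b /= pt_shift1 [h%:A]mulr1.
Qed.

Lemma partial0E (f : plane -> R) x y :
  partial 0 f (pt x y) = 'D_1 (fun t => f (pt t y)) x.
Proof.
rewrite /partial /derive; set a := (X in lim (X @ _)).
set b := (X in _ = lim (X @ _)); suff -> : a = b by [].
by apply/funext => h; rewrite /a /b /= pt_shift0 [h%:A]mulr1.
Qed.

Lemma partial1E (f : plane -> R) x y :
  partial 1 f (pt x y) = 'D_1 (fun t => f (pt x t)) y.
Proof.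
rewrite /partial /derive; set a := (X in lim (X @ _)).
set b := (X in _ = lim (X @ _)); suff -> : a = b by [].
by apply/funext => h; rewrite /a /b /= pt_shift1 [h%:A]mulr1.
Qed.

(** The mean value inequality, applied to x |-> f x - d x; this form serves both
for C1 functions and for the symmetry of second derivatives. *)
Lemma increment_bound (f : R -> R) (a b d e : R) :
  (forall x, `|x - a| <= `|b - a| ->
     derivable f x 1 /\ `|'D_1 f x - d| <= e) ->
  `|f b - f a - d * (b - a)| <= e * `|b - a|.
Proof.
have main u v : u <= v -> (forall x, x \in `[u, v] ->
     derivable f x 1 /\ `|'D_1 f x - d| <= e) ->
  `|f v - f u - d * (v - u)| <= e * `|v - u|.
  move=> uv H.
  have [x xuv] : exists2 x, x \in `[u, v] & f v - f u = 'D_1 f x * (v - u).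
    apply: MVT_segment => // [x xuv|].
      have xuv' : x \in `[u, v] by exact: subset_itv_oo_cc.
      by apply: derivableP; exact: (H _ xuv').1.
    by apply: derivable_within_continuous => x /H [].
  move=> ->; rewrite -mulrBl normrM ler_wpM2r//; exact: (H _ xuv).2.
move=> H; have [ab|/ltW ba] := leP a b.
  apply: main => // x; rewrite in_itv /= => /andP[ax xb]; apply: H.
  by rewrite !ger0_norm ?subr_ge0//; lra.
rewrite -normrN [X in `|X|](_ : _ = f a - f b - d * (a - b)); last by ring.
rewrite [`|b - a|]distrC.
apply: main => // x; rewrite in_itv /= => /andP[bx xa]; apply: H.
by rewrite !ler0_norm ?subr_le0//; lra.
Qed.


(** Along the broken path that moves the second coordinate last, the increment of f
is controlled by [increment_bound] on each side. *)
Lemma C1_differentiable (U : set plane) (f : plane -> R) p :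
  open U -> U p -> class_C U 1 f -> differentiable f p.
Proof.
move=> oU Up [_ /= H].
pose df (h : plane) := h 0 0 * partial 0 f p + h 0 1 * partial 1 f p.
have lin : linear df.
  move=> k u v; rewrite /df !mxE /GRing.scale /=.
  by move: (partial 0 f p) (partial 1 f p) => a b; ring.
pose dfm := GRing.isLinear.Build _ _ _ _ _ lin.
pose dfl : {linear plane -> R} := HB.pack df dfm.
have cdf : continuous dfl.
  move=> q; rewrite /dfl /= /df.
  apply: (@continuousD _ _ _ (fun h : plane => h 0 0 * partial 0 f p)
    (fun h : plane => h 0 1 * partial 1 f p)).
    apply: (@continuousM _ _ (fun h : plane => h 0 0) (cst (partial 0 f p))).
      exact: coord_continuous.
    exact: cst_continuous.
  apply: (@continuousM _ _ (fun h : plane => h 0 1) (cst (partial 1 f p))).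
    exact: coord_continuous.
  exact: cst_continuous.
suff : 'd f p = dfl :> (plane -> R) /\ differentiable f p by case.
have key : forall e : R, 0 < e -> \forall h \near (0 : plane),
   `|f (h + p) - f p - df h| <= e * `|h|.
  move=> e e0.
  have e20 : 0 < e / 2 by rewrite divr_gt0.
  have near_p (i : 'I_2) : \forall q \near p, U q /\ `|partial i f q - partial i f p| <= e / 2.
    near=> q; split; first by near: q; exact: open_nbhs_nbhs.
    rewrite distrC; near: q.
    have := (H i).2.1 p Up => /cvgrPdist_le; exact.
  have [d /= d0 Hd] := (nbhs_ballP _ _).1 (filterI (near_p 0) (near_p 1)).
  near=> h.
  have hd : `|h| < d.
    by near: h; apply: (@nbhs0_lt _ plane).
  have [h0d h1d] : `|h 0 0| < d /\ `|h 0 1| < d.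
    by move: hd; rewrite norm2 gt_max => /andP[].
  have inb x y : `|x - p 0 0| < d -> `|y - p 0 1| < d -> ball p d (pt x y).
    move=> hx hy; rewrite -ball_normE /= norm2 !mxE /= gt_max.
    by rewrite distrC hx distrC hy.
  set x := p 0 0; set y := p 0 1.
  have B1 : `|f (pt (h 0 0 + x) (h 0 1 + y)) - f (pt (h 0 0 + x) y)
     - partial 1 f p * (h 0 1 + y - y)| <= e / 2 * `|h 0 1 + y - y|.
    apply: (@increment_bound (fun t => f (pt (h 0 0 + x) t))) => t; rewrite addrK => ht.
    have /Hd [[Ut _] [_ b]] : ball p d (pt (h 0 0 + x) t).
      by apply: inb; rewrite ?addrK//; exact: le_lt_trans ht _.
    split; first by apply/derivable1E; exact: (H 1).1.
    by rewrite -partial1E.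
  have B0 : `|f (pt (h 0 0 + x) y) - f (pt x y)
     - partial 0 f p * (h 0 0 + x - x)| <= e / 2 * `|h 0 0 + x - x|.
    apply: (@increment_bound (fun t => f (pt t y))) => t; rewrite addrK => ht.
    have /Hd [[Ut b] _] : ball p d (pt t y).
      by apply: inb; rewrite ?subrr ?normr0//; exact: le_lt_trans ht _.
    split; first by apply/derivable0E; exact: (H 0).1.
    by rewrite -partial0E.
  rewrite !addrK in B0 B1.
  have -> : h + p = pt (h 0 0 + x) (h 0 1 + y) by apply: row2P; rewrite !mxE.
  have -> : f p = f (pt x y) by rewrite pt_eta.
  rewrite /df.
  rewrite [X in `|X|](_ : _ = (f (pt (h 0 0 + x) (h 0 1 + y)) - f (pt (h 0 0 + x) y)
     - partial 1 f p * h 0 1) + (f (pt (h 0 0 + x) y) - f (pt x y)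
     - partial 0 f p * h 0 0)); last by ring.
  apply: (le_trans (ler_normD _ _)); apply: (le_trans (lerD B1 B0)).
  have : `|h 0 0| <= `|h| /\ `|h 0 1| <= `|h|.
    by rewrite norm2 !le_max !lexx orbT.
  move=> [b0 b1]; rewrite -mulrDr.
  rewrite (_ : e * `|h| = e / 2 * (`|h| + `|h|)); last by field.
  by rewrite ler_pM2l// lerD.
have eqo : f \o shift p = cst (f p) + dfl +o_ (0 : plane) id.
  apply/eqaddoP => e e0; near=> h => /=.
  have -> : (f \o shift p - (cst (f p) + dfl)) h = f (h + p) - f p - df h.
    by rewrite /= !fctE /= opprD addrA.
  by near: h; exact: key.
split; first exact: diff_unique.
by apply/diff_locallyP; rewrite (diff_unique cdf eqo).
Unshelve. all: by end_near. Qed.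

Lemma line_derivable (f : plane -> R) v q (s : R) :
  derivable (fun t : R => f (t *: v + q)) s 1 <-> derivable f (s *: v + q) v.
Proof.
rewrite /derivable; set a := (X in cvg (X @ _)); set b := (X in _ <-> cvg (X @ _)).
suff -> : a = b by [].
by apply/funext => h; rewrite /a /b /= [h%:A]mulr1 scalerDl addrA.
Qed.

Lemma line_derive (f : plane -> R) v q (s : R) :
  'D_1 (fun t : R => f (t *: v + q)) s = 'D_v f (s *: v + q).
Proof.
rewrite /derive; set a := (X in lim (X @ _)).
set b := (X in _ = lim (X @ _)); suff -> : a = b by [].
by apply/funext => h; rewrite /a /b /= [h%:A]mulr1 scalerDl addrA.
Qed.

Lemma line_derivable0 (f : plane -> R) v q :
  derivable (fun t : R => f (t *: v + q)) 0 1 <-> derivable f q v.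
Proof. by rewrite line_derivable scale0r add0r. Qed.

Lemma line_derive0 (f : plane -> R) v q :
  'D_1 (fun t : R => f (t *: v + q)) 0 = 'D_v f q.
Proof. by rewrite line_derive scale0r add0r. Qed.

(** Two mean value estimates, first in the direction v and then in the direction w,
compare the second difference of f with h^2 times the mixed derivative. *)
Lemma mixed_increment (f : plane -> R) p v w (h d e : R) : 0 <= h ->
  (forall s t : R, `|s| <= h -> `|t| <= h -> let q := s *: v + (t *: w + p) in
    [/\ derivable f q v, derivable ('D_v f) q w &
        `|'D_w ('D_v f) q - d| <= e]) ->
  `|f (h *: v + (h *: w + p)) - f (h *: v + p) - f (h *: w + p) + f p
     - d * h * h| <= e * h * h.
Proof.
move=> h0 H.
pose phi s := f (s *: v + (h *: w + p)) - f (s *: v + (0 *: w + p)).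
have := @increment_bound phi 0 h (d * h) (e * h).
rewrite !subr0 ger0_norm// => main.
rewrite [X in `|X|](_ : _ = phi h - phi 0 - d * h * h); last first.
  by rewrite /phi !scale0r !add0r; ring.
apply: main => s; rewrite subr0 => hs.
have dt t : `|t| <= h -> derivable (fun s : R => f (s *: v + (t *: w + p))) s 1.
  move=> ht; apply: (iffRL (line_derivable f v (t *: w + p) s)).
  by case: (H s t hs ht).
have dth := dt h; rewrite ger0_norm// in dth.
have dt0 := dt 0; rewrite normr0 in dt0.
split; first by apply: derivableB; [exact: dth|exact: dt0].
rewrite deriveB; [|exact: dth|exact: dt0].
rewrite !line_derive.
have := @increment_bound (fun t => 'D_v f (t *: w + (s *: v + p))) 0 h d e.
rewrite !subr0 ger0_norm// => main.
rewrite !(addrCA (s *: v)); apply: main => t; rewrite subr0 => ht.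
have /= [_ b c] := H s t hs ht.
by rewrite (line_derive ('D_v f)) (line_derivable ('D_v f)) addrCA.
Qed.

Lemma close_slopes (D a b e h : R) : 0 < h ->
  `|D - a * h * h| <= e / 2 * h * h -> `|D - b * h * h| <= e / 2 * h * h ->
  `|a - b| <= e.
Proof.
move=> h0; have hh0 : 0 < h * h by exact: mulr_gt0.
rewrite -!mulrA; move: (h * h) hh0 => hh hh0 B1 B2.
rewrite -(ler_pM2r hh0) -{1}(gtr0_norm hh0) -normrM.
have -> : (a - b) * hh = (D - b * hh) - (D - a * hh) by ring.
apply: (le_trans (ler_normB _ _)); apply: (le_trans (lerD B2 B1)).
by rewrite le_eqVlt; apply/orP; left; apply/eqP; field.
Qed.

(** Schwarz's theorem: both mixed derivatives are close to the same second
difference divided by h^2, by [mixed_increment] with the two directions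
exchanged. *)
Theorem partialC (U : set plane) (f : plane -> R) p i j :
  open U -> U p -> class_C U 2 f ->
  partial i (partial j f) p = partial j (partial i f) p.
Proof.
move=> oU Up [_ /= H]; apply/eqP; rewrite -subr_eq0 -normr_eq0.
rewrite eq_le normr_ge0 andbT; apply/ler_addgt0Pr => e e0; rewrite add0r.
have e20 : 0 < e / 2 by rewrite divr_gt0.
have near_p (k l : 'I_2) : \forall q \near p,
    U q /\ `|partial k (partial l f) q - partial k (partial l f) p| <= e / 2.
  near=> q; split; first by near: q; exact: open_nbhs_nbhs.
  rewrite distrC; near: q.
  have := ((H l).2.2 k).2.1 p Up => /cvgrPdist_le; exact.
have [d /= d0 Hd] := (nbhs_ballP _ _).1 (filterI (near_p i j) (near_p j i)).
pose v : plane := delta_mx 0 j; pose w : plane := delta_mx 0 i.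
have small : \forall h \near 0^'+, forall s t : R, `|s| <= h -> `|t| <= h ->
     ball p d (s *: v + (t *: w + p)).
  near=> h => s t hs ht; rewrite -ball_normE /= addrA opprD addrCA subrr addr0.
  rewrite normrN.
  have nd k : `|delta_mx 0 k : plane| <= 1.
    rewrite norm2 !mxE ge_max; apply/andP.
    by case: (ord2P k) => -> /=; rewrite ?normr0 ?normr1 ?lexx ?ler01.
  apply: (le_lt_trans (ler_normD _ _)); rewrite !normrZ.
  apply: (@le_lt_trans _ _ (h + h)).
    apply: lerD.
      exact: le_trans (ler_piMr (normr_ge0 _) (nd _)) hs.
    exact: le_trans (ler_piMr (normr_ge0 _) (nd _)) ht.
  suff : h < d / 2 by lra.
  by near: h; apply: nbhs_right_lt; rewrite divr_gt0.
near (0 : R)^'+ => h.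
have h0 : 0 < h by near: h; exact: nbhs_right_gt.
have hb : forall s t : R, `|s| <= h -> `|t| <= h ->
  ball p d (s *: v + (t *: w + p)) by near: h.
have B1 := @mixed_increment f p v w h (partial i (partial j f) p) (e / 2) (ltW h0).
have B2 := @mixed_increment f p w v h (partial j (partial i f) p) (e / 2) (ltW h0).
have {}B1 := B1 _; have {}B2 := B2 _.
set D := (X in `|X - _ * h * h|) in B1.
have {}B1 : `|D - partial i (partial j f) p * h * h| <= e / 2 * h * h.
  apply: B1 => s t hs ht q; have /Hd [[Uq b] _] := hb s t hs ht.
  split => //; first exact: (H j).1.
  exact: ((H j).2.2 i).1.
have {}B2 : `|D - partial j (partial i f) p * h * h| <= e / 2 * h * h.
  rewrite [D](_ : _ = f (h *: w + (h *: v + p)) - f (h *: w + p) - f (h *: v + p) + f p); last first.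
    by rewrite /D addrCA; ring.
  apply: B2 => s t hs ht q; rewrite /q addrCA; have /Hd [_ [Uq b]] := hb t s ht hs.
  split => //; first exact: (H i).1.
  exact: ((H i).2.2 j).1.
exact: close_slopes h0 B1 B2.
Unshelve. all: by end_near. Qed.

(** * Closure properties of the classes C^k *)

Section closure.
Variable U : set plane.
Implicit Types (f g : plane -> R) (k : nat).

Lemma class_C_cont k f p : class_C U k f -> U p -> {for p, continuous f}.
Proof. by case: k => [|k] [H _] Up; exact: H. Qed.

Lemma class_C_derivable k f p i :
  class_C U k.+1 f -> U p -> derivable f p (delta_mx 0 i).
Proof. by move=> [_ /= H] Up; exact: (H i).1. Qed.

Lemma class_C_partial k f i : class_C U k.+1 f -> class_C U k (partial i f).
Proof. by move=> [_ /= H]; exact: (H i).2. Qed.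

Lemma class_C_pred k f : class_C U k.+1 f -> class_C U k f.
Proof.
elim: k f => [|k IH] f Hf; first by split=> // p; exact: class_C_cont Hf.
split=> [p|/= i]; first exact: class_C_cont Hf.
split=> [p|]; first exact: class_C_derivable Hf.
exact/IH/class_C_partial.
Qed.

Lemma class_C_le k l f : (l <= k)%N -> class_C U k f -> class_C U l f.
Proof.
move=> /subnK <-; elim: (k - l)%N => // n IH; rewrite addSn => /class_C_pred.
exact: IH.
Qed.

Hypothesis oU : open U.

Lemma near_open f g p : U p -> {in U, f =1 g} -> \forall q \near p, f q = g q.
Proof.
move=> Up fg; near=> q; apply: fg; rewrite inE; near: q.
exact: open_nbhs_nbhs.
Unshelve. all: by end_near. Qed.

Lemma partial_ext f g p i : U p -> {in U, f =1 g} -> partial i f p = partial i g p.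
Proof.
by move=> Up fg; apply: near_eq_derive; exact: near_open.
Qed.

Lemma derivable_ext f g p v : U p -> {in U, f =1 g} ->
  derivable f p v -> derivable g p v.
Proof.
by move=> Up fg; apply: near_eq_derivable; exact: near_open.
Qed.

Lemma class_C_ext k f g : {in U, f =1 g} -> class_C U k f -> class_C U k g.
Proof.
elim: k f g => [|k IH] f g fg Hf; have gf : {in U, g =1 f}.
- by move=> p /fg.
- split=> // p Up; have fp : f p = g p by apply: fg; rewrite inE.
  rewrite /prop_for /continuous_at -fp.
  exact: cvg_trans (near_eq_cvg (near_open Up fg)) (class_C_cont Hf Up).
- by move=> p /fg.
split=> [p Up|/= i].
  have fp : f p = g p by apply: fg; rewrite inE.
  rewrite /prop_for /continuous_at -fp.
  exact: cvg_trans (near_eq_cvg (near_open Up fg)) (class_C_cont Hf Up).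
split=> [p Up|].
  exact: derivable_ext Up fg (class_C_derivable Hf Up).
apply: IH (class_C_partial i Hf) => p; rewrite inE => Up.
exact: partial_ext.
Qed.

Lemma class_C_cst k (a : R) : class_C U k (fun=> a).
Proof.
elim: k a => [|k IH] a; first by split=> // p _; exact: cst_continuous.
split=> [p _|/= i]; first exact: cst_continuous.
split=> [p _|]; first exact: derivable_cst.
apply: class_C_ext (IH 0) => p _.
by rewrite /partial derive_cst.
Qed.

Lemma class_CD k f g : class_C U k f -> class_C U k g ->
  class_C U k (fun p => f p + g p).
Proof.
elim: k f g => [|k IH] f g Hf Hg.
  split=> // p Up; apply: (@continuousD _ _ _ f g).
    exact: class_C_cont Hf _. exact: class_C_cont Hg _.
split=> [p Up|/= i].
  apply: (@continuousD _ _ _ f g).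
    exact: class_C_cont Hf _. exact: class_C_cont Hg _.
split=> [p Up|].
  by apply: (@derivableD _ _ _ f g); [exact: class_C_derivable Hf _|exact: class_C_derivable Hg _].
apply: class_C_ext (IH _ _ (class_C_partial i Hf) (class_C_partial i Hg)) => p.
rewrite inE => Up; rewrite /partial (@deriveD _ _ _ f g) //.
  exact: class_C_derivable Hf Up. exact: class_C_derivable Hg Up.
Qed.

Lemma class_CM k f g : class_C U k f -> class_C U k g ->
  class_C U k (fun p => f p * g p).
Proof.
elim: k f g => [|k IH] f g Hf Hg.
  split=> // p Up; apply: (@continuousM _ _ f g).
    exact: class_C_cont Hf _. exact: class_C_cont Hg _.
split=> [p Up|/= i].
  apply: (@continuousM _ _ f g).
    exact: class_C_cont Hf _. exact: class_C_cont Hg _.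
split=> [p Up|].
  by apply: (@derivableM _ _ f g); [exact: class_C_derivable Hf _|exact: class_C_derivable Hg _].
apply: (@class_C_ext _ (fun p => f p * partial i g p + g p * partial i f p)).
  move=> p; rewrite inE => Up; rewrite /partial (@deriveM _ _ f g) //.
    exact: class_C_derivable Hf Up. exact: class_C_derivable Hg Up.
by apply: class_CD; apply: IH; first [exact: class_C_pred|exact: class_C_partial].
Qed.

Lemma class_CN k f : class_C U k f -> class_C U k (fun p => - f p).
Proof.
move=> Hf; apply: class_C_ext (class_CM (class_C_cst k (-1)) Hf) => p _.
by rewrite mulN1r.
Qed.

Lemma class_CB k f g : class_C U k f -> class_C U k g ->
  class_C U k (fun p => f p - g p).
Proof. by move=> Hf Hg; apply: class_CD => //; exact: class_CN. Qed.

Lemma class_CV k f : (forall p, U p -> f p != 0) -> class_C U k f ->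
  class_C U k (fun p => (f p)^-1).
Proof.
move=> f0; elim: k => [|k IH] Hf.
  split=> // p Up; apply: continuousV; [exact: f0|exact: class_C_cont Hf _].
split=> [p Up|/= i].
  by apply: continuousV; [exact: f0|exact: class_C_cont Hf _].
split=> [p Up|].
  by apply: derivableV; [exact: f0|exact: class_C_derivable Hf _].
have Vf := IH (class_C_pred Hf).
apply: (@class_C_ext _ (fun p => - ((f p)^-1 * (f p)^-1) * partial i f p)).
  move=> p; rewrite inE => Up; rewrite /partial deriveV ?f0//.
    by rewrite -exprVn expr2.
  exact: class_C_derivable Hf Up.
apply: class_CM (class_C_partial i Hf); apply: class_CN.
exact: class_CM.
Qed.

Lemma partial_comp1 (phi : R -> R) f p v : derivable phi (f p) 1 -> derivable f p v ->
  derivable (phi \o f) p v /\ 'D_v (phi \o f) p = 'D_1 phi (f p) * 'D_v f p.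
Proof.
move=> dphi df.
pose fl := fun t : R => f (t *: v + p).
have dfl : derivable fl 0 1 by exact: (iffRL (line_derivable0 f v p)).
have fl0 : fl 0 = f p by rewrite /fl scale0r add0r.
have H : is_derive (0 : R) 1 (phi \o fl) ('D_1 phi (f p) * 'D_v f p).
  rewrite -(line_derive0 f) -fl0.
  have H1 : is_derive (fl 0) 1 phi ('D_1 phi (fl 0)).
    by rewrite fl0; exact: derivableP.
  exact: (@is_derive1_comp R phi fl 0 _ _ H1 (derivableP dfl)).
split; first by apply: (iffLR (line_derivable0 (phi \o f) v p)); exact: ex_derive.
by rewrite -(line_derive0 (phi \o f)); exact: (@derive_val _ _ _ _ _ _ _ H).
Qed.

Lemma class_C_sqrt k f : (forall p, U p -> 0 < f p) -> class_C U k f ->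
  class_C U k (fun p => Num.sqrt (f p)).
Proof.
move=> f0; have dsq p : U p -> is_derive (f p) 1 (@Num.sqrt R) (2 * Num.sqrt (f p))^-1.
  by move=> Up; exact/is_derive1_sqrt/f0.
elim: k => [|k IH] Hf.
  split=> // p Up; apply: (@continuous_comp _ _ _ f) => //.
    exact: class_C_cont Hf _.
  exact: sqrt_continuous.
split=> [p Up|/= i].
  apply: (@continuous_comp _ _ _ f) => //.
    exact: class_C_cont Hf _.
  exact: sqrt_continuous.
have dc p : U p -> derivable (@Num.sqrt R \o f) p (delta_mx 0 i) /\
   partial i (@Num.sqrt R \o f) p = (2 * Num.sqrt (f p))^-1 * partial i f p.
  move=> Up; have [] := @partial_comp1 (@Num.sqrt R) f p (delta_mx 0 i).
  - by have := dsq p Up => H; exact: ex_derive.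
  - exact: class_C_derivable Hf Up.
  move=> d1 d2; split=> //; rewrite /partial d2; congr (_ * _).
  by have H := dsq p Up; rewrite derive_val.
split=> [p Up|]; first exact: (dc p Up).1.
apply: (@class_C_ext _ (fun p => (2 * Num.sqrt (f p))^-1 * partial i f p)).
  by move=> p; rewrite inE => Up; rewrite -(dc p Up).2.
apply: class_CM (class_C_partial i Hf); apply: class_CV.
  by move=> p Up; rewrite mulf_neq0// sqrtr_eq0 -ltNge f0.
exact: class_CM (class_C_cst _ _) (IH (class_C_pred Hf)).
Qed.

Lemma class_C_sum k (F : 'I_2 -> plane -> R) : (forall i, class_C U k (F i)) ->
  class_C U k (fun p => \sum_(i < 2) F i p).
Proof.
move=> H; apply: class_C_ext (class_CD (H 0) (H 1)) => p _.
by rewrite sum2.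
Qed.

End closure.

(** The set V may vary with the point: this is how functions that are given chart by
chart are recognized as smooth. *)
Lemma class_C_local (U : set plane) k (f : plane -> R) :
  (forall p, U p -> exists2 V : set plane, V p & class_C V k f) -> class_C U k f.
Proof.
elim: k f => [|k IH] f H.
  by split=> // p /H [V Vp Hf]; exact: class_C_cont Hf Vp.
split=> [p /H [V Vp Hf]|/= i]; first exact: class_C_cont Hf Vp.
split=> [p /H [V Vp Hf]|]; first exact: class_C_derivable Hf Vp.
apply: IH => p /H [V Vp Hf]; exists V => //; exact: class_C_partial.
Qed.

Lemma chain_rule (V : set plane) (f : plane -> R) (T : plane -> plane) p v :
  open V -> V (T p) -> class_C V 1 f ->
  (forall j, derivable (fun q => T q 0 j) p v) ->
  derivable (f \o T) p v /\
  'D_v (f \o T) p = \sum_(j < 2) 'D_v (fun q => T q 0 j) p * partial j f (T p).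
Proof.
move=> oV VT Cf dT.
have df := C1_differentiable oV VT Cf.
pose g := fun t : R => T (t *: v + p).
have g0 : g 0 = T p by rewrite /g scale0r add0r.
have dg : derivable g 0 1.
  apply/derivable_mxP => i j; rewrite (ord1 i).
  exact: (iffRL (line_derivable0 (fun q => T q 0 j) v p)).
have dgE : 'D_1 g 0 = \row_j 'D_v (fun q => T q 0 j) p.
  rewrite derive_mx//; apply/rowP => j; rewrite !mxE.
  exact: (line_derive0 (fun q => T q 0 j)).
have Df w : 'd f (T p) w = \sum_j w 0 j * partial j f (T p).
  rewrite {1}(row_sum_delta w) linear_sum; apply: eq_bigr => j _.
  by rewrite linearZ /= -deriveE.
have key : derivable (f \o g) 0 1 /\
    'D_1 (f \o g) 0 = \sum_(j < 2) 'D_v (fun q => T q 0 j) p * partial j f (T p).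
  have cg : differentiable g 0 by exact/derivable1_diffP.
  have fg0 : differentiable f (g 0) by rewrite g0.
  have dfg : differentiable (f \o g) 0 by exact: differentiable_comp.
  split; first exact: diff_derivable.
  have -> : 'D_1 (f \o g) 0 = 'd (f \o g) 0 1 by exact: deriveE.
  have -> : 'd (f \o g) 0 1 = 'd f (g 0) ('d g 0 1) by rewrite (diff_comp cg fg0).
  have -> : 'd g 0 1 = 'D_1 g 0 by rewrite deriveE.
  rewrite g0 Df dgE.
  by apply: eq_bigr => j _; rewrite mxE.
have [k1 k2] := key; split; first exact: (iffLR (line_derivable0 (f \o T) v p)).
by rewrite -k2 -(line_derive0 (f \o T)).
Qed.

Lemma continuous_plane (T : plane -> plane) p :
  (forall j, {for p, continuous (fun q => T q 0 j)}) -> {for p, continuous T}.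
Proof.
move=> cT; have near_p e : 0 < e -> \forall q \near p, `|T p - T q| < e.
  move=> e0; near=> q.
  rewrite norm2 !mxE gt_max; apply/andP; split; near: q.
    by have := cT 0 => /cvgrPdist_lt; apply.
  by have := cT 1 => /cvgrPdist_lt; apply.
exact: (iffRL (@cvgrPdist_lt R _ _ (nbhs p) _ T (T p))).
Unshelve. all: by end_near. Qed.

Lemma partial_comp (V : set plane) (f : plane -> R) (T : plane -> plane) p i :
  open V -> V (T p) -> class_C V 1 f ->
  (forall j, derivable (fun q => T q 0 j) p (delta_mx 0 i)) ->
  partial i (f \o T) p = \sum_(j < 2) partial i (fun q => T q 0 j) p * partial j f (T p).
Proof. by move=> oV VT Cf dT; have [] := chain_rule oV VT Cf dT. Qed.

Lemma class_C_comp (U V : set plane) k (f : plane -> R) (T : plane -> plane) :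
  open U -> open V -> (forall p, U p -> V (T p)) ->
  (forall j, class_C U k (fun q => T q 0 j)) -> class_C V k f ->
  class_C U k (f \o T).
Proof.
move=> oU oV UV; elim: k f => [|k IH] f CT Cf.
  split=> // p Up; apply: continuous_comp.
    by apply: continuous_plane => j; exact: class_C_cont (CT j) Up.
  exact: class_C_cont Cf (UV _ Up).
split=> [p Up|/= i].
  apply: continuous_comp.
    by apply: continuous_plane => j; exact: class_C_cont (CT j) Up.
  exact: class_C_cont Cf (UV _ Up).
have chain p : U p -> derivable (f \o T) p (delta_mx 0 i) /\
   partial i (f \o T) p = \sum_(j < 2) partial i (fun q => T q 0 j) p * partial j f (T p).
  move=> Up; apply: (chain_rule oV (UV _ Up)).
    exact: class_C_le _ Cf.
  by move=> j; exact: class_C_derivable (CT j) Up.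
split=> [p /chain []//|].
apply: (@class_C_ext _ oU _ (fun p =>
    \sum_(j < 2) partial i (fun q => T q 0 j) p * partial j f (T p))).
  by move=> p; rewrite inE => /chain [].
apply: (class_C_sum oU) => j; apply: (class_CM oU).
  exact: class_C_partial.
apply: IH; last exact: class_C_partial.
by move=> l; exact: class_C_pred.
Qed.

Lemma partial_shift (f : plane -> R) (z p : plane) i :
  partial i (fun q => f (q + z)) p = partial i f (p + z).
Proof.
rewrite /partial -(line_derive0 (fun q => f (q + z))) -(line_derive0 f).
apply: (f_equal (fun h : R -> R => 'D_1 h 0)).
by apply/funext => t; rewrite addrA.
Qed.

End plane.

(** * Computing partial derivatives *)

Section jets.
Variable R : realType.
Local Notation plane := 'rV[R]_2.

(** Carrying the derivability together with the value lets nested sums and products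
be differentiated by composing the lemmas below. *)
Definition has_partial i (f : plane -> R) p d :=
  derivable f p (delta_mx 0 i) /\ partial i f p = d.

Lemma has_partialD i f g p d e : has_partial i f p d -> has_partial i g p e ->
  has_partial i (fun q => f q + g q) p (d + e).
Proof.
move=> [df <-] [dg <-]; split; first exact: (@derivableD _ _ _ f g).
by rewrite /partial (@deriveD _ _ _ f g).
Qed.

Lemma has_partialM i f g p d e : has_partial i f p d -> has_partial i g p e ->
  has_partial i (fun q => f q * g q) p (d * g p + f p * e).
Proof.
move=> [df <-] [dg <-]; split.
  by apply: (@derivableM _ _ f g); [exact: df|exact: dg].
have E : partial i (fun q => f q * g q) p = f p * partial i g p + g p * partial i f p.
  by rewrite /partial (@deriveM _ _ f g); [|exact: df|exact: dg].
by rewrite E addrC; congr (_ + _); exact: mulrC.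
Qed.

Lemma has_partialN i f p d : has_partial i f p d -> has_partial i (fun q => - f q) p (- d).
Proof.
move=> [df <-]; split; first exact: (@derivableN _ _ _ f).
by rewrite /partial (@deriveN _ _ _ f).
Qed.

Lemma has_partialV i f p d : f p != 0 -> has_partial i f p d ->
  has_partial i (fun q => (f q)^-1) p (- (f p)^-1 * (f p)^-1 * d).
Proof.
move=> f0 [df <-]; split; first exact: derivableV.
by rewrite /partial deriveV// -exprVn expr2 mulNr.
Qed.

Lemma has_partial_sum i (F : 'I_2 -> plane -> R) p D : (forall j, has_partial i (F j) p (D j)) ->
  has_partial i (fun q => \sum_(j < 2) F j q) p (\sum_(j < 2) D j).
Proof.
move=> H; have -> : (fun q => \sum_(j < 2) F j q) = (fun q => F 0 q + F 1 q).
  by apply/funext => q; rewrite sum2.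
by rewrite sum2; exact: has_partialD.
Qed.

Lemma class_C_has_partial (U : set plane) k i f p : class_C U k.+1 f -> U p ->
  has_partial i f p (partial i f p).
Proof. by move=> Cf Up; split=> //; exact: class_C_derivable Cf Up. Qed.

Lemma has_partialE i f p d : has_partial i f p d -> partial i f p = d.
Proof. by case. Qed.

Lemma det2 (M : 'M[R]_2) : \det M = M 0 0 * M 1 1 - M 0 1 * M 1 0.
Proof.
rewrite (expand_det_row _ 0) sum2 /cofactor !det_mx11 !mxE /= expr0 expr1.
have -> : lift 0 0 = 1 :> 'I_2 by apply/val_inj.
have -> : lift 1 0 = 0 :> 'I_2 by apply/val_inj.
by ring.
Qed.

Lemma inv2 (M : 'M[R]_2) : \det M != 0 ->
  invmx M = \matrix_(i, j) ((\det M)^-1 *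
    (if i == 0 then if j == 0 then M 1 1 else - M 0 1
     else if j == 0 then - M 1 0 else M 0 0)).
Proof.
move=> d0; set N := \matrix_(i, j) _.
have NM : N *m M = 1%:M.
  apply/matrixP => i j; rewrite !mxE sum2 !mxE /= /N.
  move: d0; rewrite det2 => d0.
  by case: (ord2P i) => ->; case: (ord2P j) => -> /=; field.
have uM : M \in unitmx by rewrite unitmxE unitfE.
by rewrite -[LHS]mul1mx -NM -mulmxA mulmxV// mulmx1.
Qed.

End jets.

(** * Integration over the unit interval and the unit square *)

Section unit_interval.
Variable R : realType.
Local Notation mu := (@lebesgue_measure R).
Implicit Types (f g : R -> R).

Lemma continuous_integrable f a b : continuous f ->
  mu.-integrable `[a, b] (EFin \o f).
Proof.
move=> cf; apply: continuous_compact_integrable; first exact: segment_compact.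
exact: continuous_subspaceT.
Qed.

Definition int1 f : R := \int[mu]_(x in `[0, 1]) f x.

Lemma int1D f g : continuous f -> continuous g ->
  int1 (fun x => f x + g x) = int1 f + int1 g.
Proof. by move=> cf cg; apply: RintegralD => //; exact: continuous_integrable. Qed.

Lemma int1B f g : continuous f -> continuous g ->
  int1 (fun x => f x - g x) = int1 f - int1 g.
Proof. by move=> cf cg; apply: RintegralB => //; exact: continuous_integrable. Qed.

Lemma int1Z a f : continuous f -> int1 (fun x => a * f x) = a * int1 f.
Proof. by move=> cf; apply: RintegralZl => //; exact: continuous_integrable. Qed.

Lemma le_int1 f g : continuous f -> continuous g ->
  (forall x, 0 <= x <= 1 -> f x <= g x) -> int1 f <= int1 g.
Proof.
move=> cf cg fg; apply: le_Rintegral => //; try exact: continuous_integrable.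
Qed.

Lemma Rintegral_itv_cst a b c : a <= b -> \int[mu]_(x in `[a, b]) c = c * (b - a).
Proof.
move=> ab; rewrite Rintegral_cst//; congr (_ * _).
rewrite /= lebesgue_measure_itv /= lte_fin; case: ltP => [//|ba].
by apply/eqP; rewrite eq_sym subr_eq0 eq_le ab ba.
Qed.

Lemma int1_cst c : int1 (fun=> c) = c.
Proof. by rewrite /int1 Rintegral_itv_cst// subr0 mulr1. Qed.

Lemma FTC_itv (F : R -> R) a b : a < b ->
  (forall x, derivable F x 1) -> continuous ('D_1 F) ->
  \int[mu]_(x in `[a, b]) 'D_1 F x = F b - F a.
Proof.
move=> ab dF cF; rewrite /Rintegral (@continuous_FTC2 _ _ F)//.
- exact: continuous_subspaceT.
- have cont x : {for x, continuous F}.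
    exact/differentiable_continuous/derivable1_diffP.
  split; first by move=> x _.
    exact/cvg_at_right_filter/cont.
  exact/cvg_at_left_filter/cont.
- by move=> x _; rewrite derive1E.
Qed.

Lemma int1_derive_periodic (F : R -> R) :
  (forall x, derivable F x 1) -> continuous ('D_1 F) -> F 1 = F 0 ->
  int1 ('D_1 F) = 0.
Proof. by move=> dF cF F01; rewrite /int1 FTC_itv// F01 subrr. Qed.

Lemma sub_itv_int1 f a b : continuous f -> (forall x, 0 <= x <= 1 -> 0 <= f x) ->
  0 <= a -> b <= 1 -> \int[mu]_(x in `[a, b]) f x <= int1 f.
Proof.
move=> cf f0 a0 b1.
have sub : `[a, b] `<=` `[0, 1].
  move=> x /=; rewrite !in_itv /= => /andP[ax xb].
  by rewrite (le_trans a0 ax) (le_trans xb b1).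
rewrite /int1 /Rintegral; apply: fine_le.
- by apply: integrable_fin_num => //; exact: continuous_integrable.
- by apply: integrable_fin_num => //; exact: continuous_integrable.
apply: ge0_subset_integral => //.
  by have /measurable_int := continuous_integrable 0 1 cf.
Qed.

Lemma le_sub_int1 f a b m : continuous f -> (forall x, 0 <= x <= 1 -> 0 <= f x) ->
  0 <= a -> b <= 1 -> a <= b -> (forall x, a <= x <= b -> m <= f x) ->
  m * (b - a) <= int1 f.
Proof.
move=> cf f0 a0 b1 ab mf; apply: le_trans (sub_itv_int1 cf f0 a0 b1).
rewrite -Rintegral_itv_cst//; apply: le_Rintegral => //.
- by apply: continuous_integrable => x; exact: cst_continuous.
- exact: continuous_integrable.
Qed.

Lemma oscillation_le_int1 (F : R -> R) a b : (forall x, derivable F x 1) ->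
  continuous ('D_1 F) -> 0 <= a <= 1 -> 0 <= b <= 1 ->
  `|F b - F a| <= int1 (fun x => `|'D_1 F x|).
Proof.
move=> dF cF; wlog ab : a b / a <= b.
  move=> H a01 b01; have [/H|/ltW /H] := leP a b; first exact.
  by rewrite distrC; apply.
move=> /andP[a0 a1] /andP[b0 b1].
have cn : continuous (fun x => `|'D_1 F x|).
  by move=> x; apply: (cvg_norm (cF x)).
move: ab; rewrite le_eqVlt => /predU1P[->|ab].
  rewrite subrr normr0 -[leLHS](int1_cst 0); apply: le_int1 => //.
  by move=> x; exact: cst_continuous.
rewrite -FTC_itv//.
apply: le_trans (sub_itv_int1 cn _ a0 b1) => //.
apply: le_normr_Rintegral => //; exact: continuous_integrable.
Qed.

Lemma oscillation_le (F g : R -> R) (a b : R) : (forall x : R, is_derive x 1 F (g x)) ->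
  continuous g -> 0 <= a <= 1 -> 0 <= b <= 1 ->
  `|F b - F a| <= int1 (fun x => `|g x|).
Proof.
move=> dF cg a01 b01.
have E : 'D_1 F = g by apply/funext => x; exact: derive_val.
by rewrite -E; apply: oscillation_le_int1 => //; rewrite E.
Qed.

End unit_interval.

Section unit_square.
Variable R : realType.
Local Notation plane := 'rV[R]_2.
Local Notation mu := (@lebesgue_measure R).
Implicit Types (F G : plane -> R).

Lemma continuous_pt_r x : continuous (@pt R x).
Proof.
move=> y; apply/cvgrPdist_lt => e e0; near=> z.
rewrite norm2 !mxE /= subrr normr0 gt_max e0 /=.
by near: z; have /cvgrPdist_lt := @cvg_id _ (nbhs y); apply.
Unshelve. all: by end_near. Qed.

Lemma continuous_pt_l y : continuous (fun x => @pt R x y).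
Proof.
move=> x; apply/cvgrPdist_lt => e e0; near=> z.
rewrite norm2 !mxE /= subrr normr0 gt_max e0 andbT.
by near: z; have /cvgrPdist_lt := @cvg_id _ (nbhs x); apply.
Unshelve. all: by end_near. Qed.

Lemma continuous_slice_r F x : continuous F -> continuous (fun y => F (pt x y)).
Proof.
by move=> cF y; apply: continuous_comp; [exact: continuous_pt_r|exact: cF].
Qed.

Lemma continuous_slice_l F y : continuous F -> continuous (fun x => F (pt x y)).
Proof.
move=> cF x; apply: (@continuous_comp _ _ _ (fun x => pt x y) F).
  exact: continuous_pt_l.
exact: cF.
Qed.

Lemma bounded_on_box F (B : R) : continuous F ->
  exists2 M, 0 <= M & forall x y, `|x| <= B -> `|y| <= B -> `|F (pt x y)| <= M.
Proof.
move=> cF; pose K := [set v : plane | forall i, `[- B, B]%classic (v 0 i)].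
have cK : compact K.
  have cI (i : 'I_2) : compact `[- B, B]%classic by exact: segment_compact.
  exact: (rV_compact cI).
have /compact_bounded [M [_ HM]] : compact (F @` K).
  by apply: continuous_compact => //; exact: continuous_subspaceT.
exists (Num.max 0 (M + 1)); first by rewrite le_max lexx.
move=> x y xB yB; rewrite le_max; apply/orP; right.
apply: (HM (M + 1)); first by rewrite ltrDl.
exists (pt x y) => // i; rewrite /= in_itv /= -ler_norml.
by case: (ord2P i) => ->; rewrite mxE.
Qed.

(** Continuity under the integral sign; the dominating constant comes from a box
containing all the relevant points. *)
Lemma continuous_inner a b F : continuous F ->
  continuous (fun x => \int[mu]_(y in `[a, b]) F (pt x y)).
Proof.
move=> cF x0.
have [M M0 HM] := @bounded_on_box F (`|x0| + 1 + `|a| + `|b|) cF.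
have := @continuity_under_integral R _ _ mu (fun x y => F (pt x y)) `[a, b] _
  (x0 - 1) (x0 + 1) _ _ (cst M).
apply => //.
- by move=> x _; apply: continuous_integrable; exact: continuous_slice_r.
- by apply: aeW => y _ x _; exact: continuous_slice_l.
- by apply: continuous_integrable => x; exact: cst_continuous.
- move=> x; rewrite /= in_itv /= => /andP[x1 x2]; apply: aeW => y.
  rewrite /= in_itv /= => /andP[ya yb]; apply: HM.
    apply: (@le_trans _ _ (`|x0| + 1)); last by rewrite -addrA lerDl addr_ge0.
    rewrite ler_norml; have := ler_norm x0; have := ler_norm (- x0).
    by rewrite normrN => *; apply/andP; split; lra.
  apply: (@le_trans _ _ (`|a| + `|b|)).
    rewrite ler_norml; have := ler_norm b; have := ler_norm (- a).
    have := normr_ge0 a; have := normr_ge0 b.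
    by rewrite normrN => *; apply/andP; split; lra.
  by have := normr_ge0 x0; lra.
- by rewrite inE /= in_itv /=; apply/andP; split; lra.
Qed.

(** As iterated integrals of continuous functions suffice, the plane never needs a
measure; the price is the exchange of the two integrals, [int2_swap]. *)
Definition int2 F : R := int1 (fun x => int1 (fun y => F (pt x y))).

Lemma int2D F G : continuous F -> continuous G ->
  int2 (fun p => F p + G p) = int2 F + int2 G.
Proof.
move=> cF cG; rewrite /int2 -int1D; [|exact: continuous_inner..].
by apply: eq_Rintegral => x _; apply: int1D; exact: continuous_slice_r.
Qed.

Lemma int2B F G : continuous F -> continuous G ->
  int2 (fun p => F p - G p) = int2 F - int2 G.
Proof.
move=> cF cG; rewrite /int2 -int1B; [|exact: continuous_inner..].
by apply: eq_Rintegral => x _; apply: int1B; exact: continuous_slice_r.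
Qed.

Lemma int2Z a F : continuous F -> int2 (fun p => a * F p) = a * int2 F.
Proof.
move=> cF; rewrite /int2 -int1Z; [|exact: continuous_inner].
by apply: eq_Rintegral => x _; apply: int1Z; exact: continuous_slice_r.
Qed.

Lemma le_int2 F G : continuous F -> continuous G ->
  (forall p, F p <= G p) -> int2 F <= int2 G.
Proof.
move=> cF cG FG; apply: le_int1; [exact: continuous_inner..|] => x _.
by apply: le_int1; [exact: continuous_slice_r..|] => y _.
Qed.

Lemma int2_cst c : int2 (fun=> c) = c.
Proof.
rewrite /int2 -[RHS]int1_cst; apply: eq_Rintegral => x _; exact: int1_cst.
Qed.

Lemma int2_ge_square F x0 y0 r m : continuous F -> (forall p, 0 <= F p) ->
  0 <= r -> 0 <= x0 -> 0 <= y0 -> x0 + r <= 1 -> y0 + r <= 1 -> 0 <= m ->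
  (forall x y, x0 <= x <= x0 + r -> y0 <= y <= y0 + r -> m <= F (pt x y)) ->
  m * r * r <= int2 F.
Proof.
move=> cF F0 r0 x00 y00 x1 y1 m0 mF; have xr : x0 + r - x0 = r by ring.
have yr : y0 + r - y0 = r by ring.
rewrite -{2}xr; apply: le_sub_int1 => //; rewrite ?lerDl//.
- exact: continuous_inner.
- move=> x _; rewrite -[leLHS]int1_cst; apply: le_int1 => //.
    by move=> ?; exact: cst_continuous.
  exact: continuous_slice_r.
- move=> x xx; rewrite -{1}yr; apply: le_sub_int1 => //; rewrite ?lerDl//.
    exact: continuous_slice_r.
  by move=> y; exact: mF.
Qed.

Lemma int2_partial1 F : (forall p, derivable F p (delta_mx 0 1)) ->
  continuous (partial 1 F) -> (forall x, F (pt x 1) = F (pt x 0)) ->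
  int2 (partial 1 F) = 0.
Proof.
move=> dF cF perF; rewrite /int2 -[RHS]int1_cst.
apply: eq_Rintegral => x _.
rewrite -[RHS](@int1_derive_periodic _ (fun y => F (pt x y))).
- by apply: eq_Rintegral => y _; rewrite partial1E.
- by move=> y; apply/derivable1E.
- have -> : 'D_1 (fun y : R => F (pt x y)) = (fun y => partial 1 F (pt x y)).
    by apply/funext => y; rewrite partial1E.
  exact: continuous_slice_r.
- exact: perF.
Qed.

Lemma Rintegral_bound f a b (M : R) : continuous f -> a <= b ->
  (forall x, a <= x <= b -> `|f x| <= M) ->
  `|\int[mu]_(x in `[a, b]) f x| <= M * (b - a).
Proof.
move=> cf ab fM.
have cn : continuous (fun x => `|f x|) by move=> x; apply: (cvg_norm (cf x)).
apply: (@le_trans _ _ (\int[mu]_(x in `[a, b]) `|f x|)).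
  by apply: le_normr_Rintegral => //; exact: continuous_integrable.
rewrite -Rintegral_itv_cst//; apply: le_Rintegral => //.
- exact: continuous_integrable.
- by apply: continuous_integrable => x; exact: cst_continuous.
Qed.

Definition transpose F : plane -> R := fun p => F (pt (p 0 1) (p 0 0)).

Lemma continuous_transpose F : continuous F -> continuous (transpose F).
Proof.
move=> cF p; apply: (@continuous_comp _ _ _ (fun p : plane => pt (p 0 1) (p 0 0)) F).
  apply: continuous_plane => j; case: (ord2P j) => ->.
    have -> : (fun q : plane => pt (q 0 1) (q 0 0) 0 0) = (fun q => q 0 1).
      by apply/funext => q; rewrite mxE.
    exact: coord_continuous.
  have -> : (fun q : plane => pt (q 0 1) (q 0 0) 0 1) = (fun q => q 0 0).
    by apply/funext => q; rewrite mxE.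
  exact: coord_continuous.
exact: cF.
Qed.

Lemma transposeE F x y : transpose F (pt x y) = F (pt y x).
Proof. by rewrite /transpose !mxE. Qed.

Lemma continuous_inner_l a b F : continuous F ->
  continuous (fun y => \int[mu]_(x in `[a, b]) F (pt x y)).
Proof.
move=> /continuous_transpose cF; have := @continuous_inner a b _ cF.
by under eq_fun do under eq_Rintegral do rewrite transposeE.
Qed.

Lemma derive_primitive (f : R -> R) (x : R) : continuous f -> 0 < x ->
  derivable (fun a : R => \int[mu]_(t in `[0, a]) f t) x 1 /\
  'D_1 (fun a : R => \int[mu]_(t in `[0, a]) f t) x = f x.
Proof.
move=> cf x0; rewrite -derive1E.
apply: (@continuous_FTC1_closed R f 0 x (x + 1)) => //; first by rewrite ltrDl.
  exact: continuous_integrable.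
exact: cf.
Qed.

(** Replace the outer interval [0, 1] by [0, a]: both iterated integrals are then
functions of a with the same derivative, by the fundamental theorem of calculus
on one side and differentiation under the integral sign on the other, and both
tend to 0 with a. *)
Lemma int2_swap F : continuous F ->
  int2 F = int1 (fun y => int1 (fun x => F (pt x y))).
Proof.
move=> cF; pose phi x := int1 (fun y => F (pt x y)).
pose P a y := \int[mu]_(x in `[0, a]) F (pt x y).
pose Phi (a : R) := \int[mu]_(x in `[0, a]) phi x.
pose Psi (a : R) := int1 (P a).
pose D : R -> R := Phi - Psi.
have cphi : continuous phi by exact: continuous_inner.
have cP a : continuous (P a) by exact: continuous_inner_l.
have [M M0 HM] := @bounded_on_box F 2 cF.
have in2 (x : R) : 0 <= x <= 2 -> `|x| <= 2.
  by move=> /andP[x0 x2]; rewrite ger0_norm.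
have dP (x y : R) : 0 < x -> derivable (P ^~ y) x 1 /\ 'D_1 (P ^~ y) x = F (pt x y).
  move=> x0; apply: (@derive_primitive (fun x => F (pt x y))) => //.
  exact: continuous_slice_l.
have dD (a : R) : 0 < a < 2 -> derivable D a 1 /\ 'D_1 D a = 0.
  move=> /andP[a0 a2]; have [d1 e1] : derivable Phi a 1 /\ 'D_1 Phi a = phi a.
    exact: derive_primitive.
  have ub x y : `]0, 2[%classic x -> `[0, 1]%classic y ->
      `|partial1of2 P x y| <= M.
    rewrite /= !in_itv /= => /andP[x0 x2] /andP[y0 y1].
    rewrite partial1of2E (dP x y x0).2; apply: HM; apply: in2.
      by rewrite (ltW x0) (ltW x2).
    by rewrite y0 (le_trans y1)// ler1n.
  have iM : mu.-integrable `[0, 1] (EFin \o cst M).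
    by apply: continuous_integrable => x; exact: cst_continuous.
  have Ia : `]0, 2[%classic a by rewrite /= in_itv /= a0 a2.
  have iP x : `]0, 2[%classic x -> mu.-integrable `[0, 1] (EFin \o P x).
    by move=> _; exact: continuous_integrable.
  have dP1 x y : `]0, 2[%classic x -> `[0, 1]%classic y -> derivable (P ^~ y) x 1.
    by rewrite /= !in_itv /= => /andP[x0 x2] _; exact: (dP x y x0).1.
  have m01 : measurable (`[0, 1]%classic : set (measurableTypeR R)) by [].
  have d2 : derivable Psi a 1 := derivable_under_integral m01 Ia iP dP1 (fun=> M0) iM ub.
  have e2 : 'D_1 Psi a = _ := etrans (esym (derive1E Psi a)) (differentiation_under_integral m01 Ia iP dP1 (fun=> M0) iM ub).
  split; first exact (derivableB d1 d2).
  have -> : 'D_1 D a = 'D_1 Phi a - 'D_1 Psi a by exact (deriveB d1 d2).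
  apply: etrans (congr2 (fun x y => x - y) e1 e2) _.
  apply/eqP; rewrite subr_eq0; apply/eqP; apply: eq_Rintegral => y _.
  by rewrite partial1of2E (dP a y a0).2.
have Dsmall (e : R) : 0 < e <= 1 -> `|D e| <= M * e + M * e.
  move=> /andP[e0 e1]; apply: (le_trans (ler_normB _ _)); apply: lerD.
    rewrite -[X in M * X]subr0; apply: Rintegral_bound => //; first exact: ltW.
    move=> x /andP[x0 xe]; rewrite -[M]mulr1 -[X in M * X]subr0.
    apply: Rintegral_bound => //; first exact: continuous_slice_r.
    move=> y /andP[y0 y1]; apply: HM; apply: in2.
      by rewrite x0 (le_trans xe)// (le_trans e1)// ler1n.
    by rewrite y0 (le_trans y1)// ler1n.
  rewrite -[M * e]mulr1 -[X in _ * X]subr0; apply: Rintegral_bound => //.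
  move=> y /andP[y0 y1]; rewrite -[e in M * e]subr0.
  apply: Rintegral_bound => //; [exact: continuous_slice_l|exact: ltW|].
  move=> x /andP[x0 xe]; apply: HM; apply: in2.
    by rewrite x0 (le_trans xe)// (le_trans e1)// ler1n.
  by rewrite y0 (le_trans y1)// ler1n.
have Dcst (e : R) : 0 < e < 1 -> D 1 = D e.
  move=> /andP[e0 e1].
  have pos (x : R) : x \in `[e, 1] -> 0 < x < 2.
    rewrite in_itv /= => /andP[ex x1]; rewrite (lt_le_trans e0 ex) /=.
    by rewrite (le_lt_trans x1)// ltr1n.
  have [c _ ] : exists2 c, c \in `[e, 1] & D 1 - D e = 0 * (1 - e).
    apply: (@MVT_segment R D (fun=> 0)); first exact: ltW.
      move=> x xe; have [] : derivable D x 1 /\ 'D_1 D x = 0.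
        by apply/dD/pos; exact: subset_itv_oo_cc xe.
      by move=> d <-; exact: derivableP.
    by apply: derivable_within_continuous => x /pos /dD [].
  by rewrite mul0r => /eqP; rewrite subr_eq0 => /eqP.
apply/eqP; rewrite -subr_eq0 -normr_le0; apply/ler_addgt0Pr => e e0; rewrite add0r.
have -> : int2 F - int1 (fun y => int1 (fun x => F (pt x y))) = D 1 by [].
pose d := Num.min (2^-1) (e / (M + M + 1)).
have M1 : 0 < M + M + 1 by lra.
have d0 : 0 < d by rewrite lt_min invr_gt0 ltr0n divr_gt0.
have d1 : d < 1 by rewrite gt_min invf_lt1 ?ltr1n.
rewrite (Dcst d) ?d0//; apply: (le_trans (Dsmall d _)); first by rewrite d0 ltW.
rewrite -mulrDl; apply: (@le_trans _ _ ((M + M + 1) * d)).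
  by rewrite ler_pM2r// lerDl.
by rewrite mulrC -ler_pdivlMr// ge_min lexx orbT.
Qed.

Lemma int2_partial0 F : (forall p, derivable F p (delta_mx 0 0)) ->
  continuous (partial 0 F) -> (forall y, F (pt 1 y) = F (pt 0 y)) ->
  int2 (partial 0 F) = 0.
Proof.
move=> dF cF perF; rewrite (int2_swap cF) -[RHS]int1_cst.
apply: eq_Rintegral => y _.
rewrite -[RHS](@int1_derive_periodic _ (fun x => F (pt x y))).
- by apply: eq_Rintegral => x _; rewrite partial0E.
- by move=> x; apply/derivable0E.
- have -> : 'D_1 (fun x : R => F (pt x y)) = (fun x => partial 0 F (pt x y)).
    by apply/funext => x; rewrite partial0E.
  exact: continuous_slice_l.
- exact: perF.
Qed.

End unit_square.

(** * Periodic functions and variation along broken paths *)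

Section biperiodicity.
Variable R : realType.
Local Notation plane := 'rV[R]_2.
Implicit Types (F G : plane -> R).

Definition biperiodic F := forall p z, z \is a mxOver Num.int -> F (p + z) = F p.

Lemma pt_int (x y : R) : x \in Num.int -> y \in Num.int -> pt x y \is a mxOver Num.int.
Proof. by move=> xi yi; apply/mxOverP => i j; rewrite mxE; case: ifP. Qed.

Lemma ptD (x y x' y' : R) : pt x y + pt x' y' = pt (x + x') (y + y').
Proof. by apply: row2P; rewrite !mxE. Qed.

Lemma periodic_edge0 F y : biperiodic F -> F (pt 1 y) = F (pt 0 y).
Proof.
move=> pF; rewrite -(pF (pt 0 y) (pt 1 0)) ?ptD ?add0r ?addr0//.
by apply: pt_int; rewrite ?rpred0 ?rpred1.
Qed.

Lemma periodic_edge1 F x : biperiodic F -> F (pt x 1) = F (pt x 0).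
Proof.
move=> pF; rewrite -(pF (pt x 0) (pt 0 1)) ?ptD ?add0r ?addr0//.
by apply: pt_int; rewrite ?rpred0 ?rpred1.
Qed.

Lemma periodic_partial F i : biperiodic F -> biperiodic (partial i F).
Proof.
move=> pF p z zi; rewrite -partial_shift; congr (partial i _ p).
by apply/funext => q; exact: pF.
Qed.

Lemma reduce_mod1 (p : plane) : exists x y, [/\ 0 <= x < 1, 0 <= y < 1 &
  forall F, biperiodic F -> F (pt x y) = F p].
Proof.
have frac (x : R) : exists2 n : R, n \in Num.int & 0 <= x - n < 1.
  exists (Num.floor x)%:~R; first exact: intr_int.
  by have /andP[h1 h2] := floor_itv x; rewrite intrD in h2; apply/andP; split; lra.
have [m mi m1] := frac (p 0 0); have [n ni n1] := frac (p 0 1).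
exists (p 0 0 - m), (p 0 1 - n); split=> // F pF.
rewrite -(pF p (pt (- m) (- n))); last by apply: pt_int; rewrite rpredN.
by rewrite -[p in RHS]pt_eta ptD.
Qed.

Lemma C0_continuous F : class_C setT 0 F -> continuous F.
Proof. by move=> H p; exact: class_C_cont H _. Qed.

Lemma continuous_C0 F : continuous F -> class_C setT 0 F.
Proof. by move=> cF; split=> // p _; exact: cF. Qed.

Lemma continuous_norm F : continuous F -> continuous (fun p => `|F p|).
Proof.
by move=> cF p; exact: (@cvg_norm R R plane (nbhs p) _ F (F p) (cF p)).
Qed.

Lemma int2_partial F i : class_C setT 1 F -> biperiodic F -> int2 (partial i F) = 0.
Proof.
move=> CF pF; have cp : continuous (partial i F).
  exact/C0_continuous/class_C_partial.
case: (ord2P i) => ii; rewrite ii in cp *.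
  apply: int2_partial0 => // [p|y]; first exact: class_C_derivable CF _.
  exact: periodic_edge0.
apply: int2_partial1 => // [p|y]; first exact: class_C_derivable CF _.
exact: periodic_edge1.
Qed.

Lemma bounded_periodic F : continuous F -> biperiodic F ->
  exists2 M, 0 < M & forall p, `|F p| <= M.
Proof.
move=> cF pF; have [M M0 HM] := bounded_on_box 1 cF.
exists (M + 1); first by lra.
move=> p; have [x [y [/andP[x0 x1] /andP[y0 y1] <-]]] := reduce_mod1 p => //.
apply: (@le_trans _ _ M); last by lra.
by apply: HM; rewrite ger0_norm// ltW.
Qed.

(** A square with lower left corner (x, y) always fits in the unit square when x and
y are less than 1. *)
Lemma near_square F x y m : continuous F -> 0 <= x < 1 -> 0 <= y < 1 ->
  m < F (pt x y) ->
  exists r, [/\ 0 < r, x + r <= 1, y + r <= 1 &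
    forall x' y', x <= x' <= x + r -> y <= y' <= y + r -> m < F (pt x' y')].
Proof.
move=> cF /andP[x0 x1] /andP[y0 y1] mF.
have H : \forall q \near pt x y, m < F q by exact: (@cvgr_gt R _ (nbhs (pt x y)) _ F (F (pt x y)) (cF _) m mF).
have [d /= d0 Hd] := (nbhs_ballP _ _).1 H.
exists (Num.min (d / 2) (Num.min (1 - x) (1 - y))).
set r := Num.min _ _.
have r0 : 0 < r by rewrite !lt_min !subr_gt0 x1 y1 divr_gt0.
have [rd rx ry] : [/\ r <= d / 2, r <= 1 - x & r <= 1 - y].
  by rewrite /r !ge_min !lexx ?orbT.
split=> //; [lra|lra|] => x' y' /andP[a1 a2] /andP[b1 b2].
apply: Hd; rewrite -ball_normE /= norm2 !mxE /= gt_max !ltr_norml.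
by apply/andP; split; apply/andP; split; lra.
Qed.

Lemma int2_gt0 F x y : continuous F -> (forall p, 0 <= F p) ->
  0 <= x < 1 -> 0 <= y < 1 -> 0 < F (pt x y) -> 0 < int2 F.
Proof.
move=> cF F0 x01 y01 Fp.
have F2 : F (pt x y) / 2 < F (pt x y) by lra.
have [r [r0 x1 y1 H]] := near_square cF x01 y01 F2.
apply: (@lt_le_trans _ _ (F (pt x y) / 2 * r * r)).
  by rewrite !mulr_gt0.
move: x01 y01 => /andP[x0 _] /andP[y0 _].
apply: (@int2_ge_square _ _ x y) => //; first exact: ltW.
  by rewrite divr_ge0// ltW.
by move=> x' y' hx hy; apply/ltW/H.
Qed.

Lemma int2_eq0 F : continuous F -> biperiodic F -> (forall p, 0 <= F p) ->
  int2 F <= 0 -> forall p, F p = 0.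
Proof.
move=> cF pF F0 I0 p; have [x [y [x01 y01 E]]] := reduce_mod1 p.
rewrite -(E F pF); apply/eqP; rewrite eq_le F0 andbT leNgt; apply/negP => Fp.
by have := int2_gt0 cF F0 x01 y01 Fp; rewrite ltNge I0.
Qed.

Section paths.
Variable L : plane -> R.
Hypothesis CL : class_C setT 1 L.

Definition row_variation y := int1 (fun x => `|partial 0 L (pt x y)|).
Definition col_variation x := int1 (fun y => `|partial 1 L (pt x y)|).

Lemma continuous_abs_partial i : continuous (fun p => `|partial i L p|).
Proof. exact/continuous_norm/C0_continuous/class_C_partial. Qed.

Lemma continuous_row_variation : continuous row_variation.
Proof. exact: (continuous_inner_l (@continuous_abs_partial 0)). Qed.

Lemma continuous_col_variation : continuous col_variation.
Proof. exact: (continuous_inner (@continuous_abs_partial 1)). Qed.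

Lemma row_oscillation x x' y : 0 <= x <= 1 -> 0 <= x' <= 1 ->
  `|L (pt x' y) - L (pt x y)| <= row_variation y.
Proof.
move=> x01 x'01; apply: (@oscillation_le R (fun t => L (pt t y))
   (fun t => partial 0 L (pt t y))) => // [t|].
  apply: DeriveDef; last by rewrite partial0E.
  apply/derivable0E; exact: class_C_derivable CL I.
exact/continuous_slice_l/C0_continuous/class_C_partial.
Qed.

Lemma col_oscillation x y y' : 0 <= y <= 1 -> 0 <= y' <= 1 ->
  `|L (pt x y') - L (pt x y)| <= col_variation x.
Proof.
move=> y01 y'01; apply: (@oscillation_le R (fun t => L (pt x t))
   (fun t => partial 1 L (pt x t))) => // [t|].
  apply: DeriveDef; last by rewrite partial1E.
  apply/derivable1E; exact: class_C_derivable CL I.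
exact/continuous_slice_r/C0_continuous/class_C_partial.
Qed.

Lemma row_variation_ge0 y : 0 <= row_variation y.
Proof.
rewrite -[leLHS](int1_cst 0); apply: le_int1 => [x||x _].
- exact: cst_continuous.
- exact: (continuous_slice_l (@continuous_abs_partial 0)).
- exact: normr_ge0.
Qed.

Lemma col_variation_ge0 x : 0 <= col_variation x.
Proof.
rewrite -[leLHS](int1_cst 0); apply: le_int1 => [y||y _].
- exact: cst_continuous.
- exact: (continuous_slice_r (@continuous_abs_partial 1)).
- exact: normr_ge0.
Qed.

Lemma int1_row_variation : int1 row_variation = int2 (fun p => `|partial 0 L p|).
Proof. by rewrite (int2_swap (@continuous_abs_partial 0)). Qed.

(** Join any point (x, y') to a point (x1, y) of the given segment by a vertical and
a horizontal segment, and average over y. *)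
Lemma int2_lower_bound x1 y1 r l : 0 <= x1 <= 1 -> 0 <= y1 -> 0 < r -> y1 + r <= 1 ->
  (forall y, y1 <= y <= y1 + r -> l <= L (pt x1 y)) ->
  l - int2 (fun p => `|partial 0 L p|) / r - int2 (fun p => `|partial 1 L p|)
    <= int2 L.
Proof.
move=> x01 y0 r0 yr lL; set al := int2 _; set be := int2 _.
have step x y' : 0 <= x <= 1 -> 0 <= y' <= 1 -> l - al / r - col_variation x <= L (pt x y').
  move=> hx hy'; suff : (l - col_variation x - L (pt x y')) * r <= al.
    by rewrite -ler_pdivlMr// => H; lra.
  rewrite /al -int1_row_variation -{1}(addrK y1 r) [r + y1]addrC.
  apply: (le_sub_int1 continuous_row_variation) => // [y _||y hy].
  - exact: row_variation_ge0.
  - by rewrite lerDl ltW.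
  have y01 : 0 <= y <= 1 by move: hy => /andP[? ?]; apply/andP; split; lra.
  have := row_oscillation y hx x01; have := col_oscillation x hy' y01; have := lL y hy.
  by rewrite !ler_norml => ? /andP[? ?] /andP[? ?]; lra.
have -> : l - al / r - be = int1 (fun x => l - al / r - col_variation x).
  rewrite int1B ?int1_cst//; last exact: continuous_col_variation.
  by move=> ?; exact: cst_continuous.
have cl : continuous (fun x => l - al / r - col_variation x).
  by move=> x; apply: (@continuousB _ _ _ (cst _) col_variation);
    [exact: cst_continuous|exact: continuous_col_variation].
have cL : continuous L by apply: C0_continuous; exact: class_C_pred.
apply: le_int1 => //; first exact: continuous_inner.
move=> x hx; rewrite -[leLHS]int1_cst; apply: le_int1 => [?||y hy].
- exact: cst_continuous.
- exact: continuous_slice_r.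
- exact: step.
Qed.

Lemma IVT_zero (v : R -> R) a b : continuous v -> 0 <= a <= 1 -> 0 <= b <= 1 ->
  0 < v a -> v b <= 0 -> exists2 c, 0 <= c <= 1 & v c = 0.
Proof.
move=> cv /andP[a0 a1] /andP[b0 b1] va vb.
have [ab|/ltW ba] := leP a b.
  have [||c] := @IVT R v a b 0 ab.
  - exact: continuous_subspaceT.
  - by rewrite ge_min le_max vb (ltW va) orbT.
  rewrite in_itv /= => /andP[ac cb] vc; exists c => //.
  by rewrite (le_trans a0 ac) (le_trans cb b1).
have [||c] := @IVT R v b a 0 ba.
- exact: continuous_subspaceT.
- by rewrite ge_min le_max vb (ltW va) orbT.
rewrite in_itv /= => /andP[ac cb] vc; exists c => //.
by rewrite (le_trans b0 ac) (le_trans cb a1).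
Qed.

(** For x in the second segment and y in the first, the path from (x1, y) along the
row y to (x, y) and then along the column x to (x, y2) meets a zero of u, by the
intermediate value theorem. There L vanishes, so L varies by at least l along the
path; average over x and y. *)
Lemma sign_change_cost (u : plane -> R) x1 y1 x2 y2 r l : continuous u ->
  (forall p, u p = 0 -> L p = 0) ->
  0 <= x1 <= 1 -> 0 <= y1 -> 0 <= x2 -> 0 <= y2 <= 1 ->
  0 < r -> y1 + r <= 1 -> x2 + r <= 1 ->
  (forall y, y1 <= y <= y1 + r -> 0 < u (pt x1 y) /\ l <= L (pt x1 y)) ->
  (forall x, x2 <= x <= x2 + r -> u (pt x y2) <= 0) ->
  l <= (int2 (fun p => `|partial 0 L p|) + int2 (fun p => `|partial 1 L p|)) / r.
Proof.
move=> cu uL x101 y10 x20 y201 r0 yr xr pos neg.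
set al := int2 _; set be := int2 _.
have step x : x2 <= x <= x2 + r -> l - al / r <= col_variation x.
  move=> hx; suff : (l - col_variation x) * r <= al.
    by rewrite -ler_pdivlMr// => H; lra.
  have x01 : 0 <= x <= 1 by move: hx => /andP[? ?]; apply/andP; split; lra.
  rewrite /al -int1_row_variation -{1}(addrK y1 r) [r + y1]addrC.
  apply: (le_sub_int1 continuous_row_variation) => // [y _||y hy].
  - exact: row_variation_ge0.
  - by rewrite lerDl ltW.
  have y01 : 0 <= y <= 1 by move: hy => /andP[? ?]; apply/andP; split; lra.
  have [u0 lL] := pos y hy.
  have [ux|ux] := leP (u (pt x y)) 0.
    have [z z01 /uL Lz] := IVT_zero (continuous_slice_l cu) x101 x01 u0 ux.
    have := row_oscillation y z01 x101; rewrite Lz subr0 => /(le_trans (ler_norm _)).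
    by have := col_variation_ge0 x; lra.
  have [z z01 /uL Lz] := IVT_zero (continuous_slice_r cu) y01 y201 ux (neg x hx).
  have := col_oscillation x z01 y01; rewrite Lz subr0 => /(le_trans (ler_norm _)) H1.
  by have := row_oscillation y x01 x101; rewrite ler_norml => /andP[_ H2]; lra.
have : (l - al / r) * r <= be.
  rewrite -{2}(addrK x2 r) [r + x2]addrC.
  apply: (le_sub_int1 continuous_col_variation) => // [x _|].
    exact: col_variation_ge0.
  by rewrite lerDl ltW.
by rewrite -ler_pdivlMr// mulrDl => H; lra.
Qed.

End paths.

End biperiodicity.

(** * The logarithmic profile *)

Section onevar.
Variable R : realType.
Local Notation plane := 'rV[R]_2.

Lemma continuous_cst1 (a : R) : continuous (fun _ : R => a).
Proof. by move=> x; exact: cst_continuous. Qed.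

Lemma continuousM1 (f g : R -> R) : continuous f -> continuous g ->
  continuous (fun x => f x * g x).
Proof. by move=> cf cg x; apply: (@continuousM _ _ f g); [exact: cf|exact: cg]. Qed.

Lemma continuousD1 (f g : R -> R) : continuous f -> continuous g ->
  continuous (fun x => f x + g x).
Proof. by move=> cf cg x; apply: (@continuousD _ _ _ f g); [exact: cf|exact: cg]. Qed.

Lemma continuousB1 (f g : R -> R) : continuous f -> continuous g ->
  continuous (fun x => f x - g x).
Proof. by move=> cf cg x; apply: (@continuousB _ _ _ f g); [exact: cf|exact: cg]. Qed.

Lemma continuousV1 (f : R -> R) : continuous f -> (forall x, f x != 0) ->
  continuous (fun x => (f x)^-1).
Proof. by move=> cf f0 x; apply: continuousV; [exact: f0|exact: cf]. Qed.

Lemma class_C0_comp1 (phi : R -> R) (f : plane -> R) :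
  continuous phi -> class_C setT 0 f -> class_C setT 0 (fun p => phi (f p)).
Proof.
move=> cphi cf; apply: continuous_C0 => p.
apply: (@continuous_comp _ _ _ f phi); last exact: cphi.
exact: C0_continuous cf p.
Qed.

Lemma partial_comp1E (phi phi' : R -> R) (f : plane -> R) p i :
  (forall x : R, is_derive x 1 phi (phi' x)) -> class_C setT 1 f ->
  partial i (fun q => phi (f q)) p = phi' (f p) * partial i f p.
Proof.
move=> dphi Cf.
have [] := @partial_comp1 R phi f p (delta_mx 0 i).
- by have H := dphi (f p); exact: ex_derive.
- exact: class_C_derivable Cf I.
by move=> _ E; rewrite /partial E; congr (_ * _); have H := dphi (f p); exact: derive_val.
Qed.

Lemma class_C1_comp1 (phi phi' : R -> R) (f : plane -> R) :
  (forall x : R, is_derive x 1 phi (phi' x)) -> continuous phi' ->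
  class_C setT 1 f -> class_C setT 1 (fun p => phi (f p)).
Proof.
move=> dphi cphi' Cf.
have cphi : continuous phi.
  by move=> x; apply/differentiable_continuous/derivable1_diffP; have H := dphi x; exact: ex_derive.
have d p i : derivable (fun q => phi (f q)) p (delta_mx 0 i).
  have dphif : derivable phi (f p) 1 by have H := dphi (f p); exact: ex_derive.
  by have [] := partial_comp1 dphif (class_C_derivable (i := i) Cf (I : [set: plane] p)).
split=> [p _|/= i].
  exact: (C0_continuous (class_C0_comp1 cphi (class_C_pred Cf))).
split=> [p _|]; first exact: d.
change (class_C setT 0 (partial i (fun q => phi (f q)))).
apply: (@class_C_ext _ _ openT _ (fun p => phi' (f p) * partial i f p)).
  by move=> p _; rewrite (partial_comp1E p i dphi Cf).
apply: (class_CM openT); first exact: class_C0_comp1 (class_C_pred Cf).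
exact: class_C_partial.
Qed.

Lemma partialDE (f g : plane -> R) p i : class_C setT 1 f -> class_C setT 1 g ->
  partial i (fun q => f q + g q) p = partial i f p + partial i g p.
Proof.
move=> Cf Cg; apply: has_partialE.
exact: (has_partialD (class_C_has_partial i Cf I) (class_C_has_partial i Cg I)).
Qed.

Lemma partial_cst (x : R) p i : partial i (fun=> x) p = 0.
Proof. by rewrite /partial derive_cst. Qed.

Lemma partialME (f g : plane -> R) p i : class_C setT 1 f -> class_C setT 1 g ->
  partial i (fun q => f q * g q) p = f p * partial i g p + g p * partial i f p.
Proof.
move=> Cf Cg; rewrite addrC [g p * _]mulrC; apply: has_partialE.
exact: (has_partialM (class_C_has_partial i Cf I) (class_C_has_partial i Cg I)).
Qed.

Lemma partialVE (f : plane -> R) p i : class_C setT 1 f -> f p != 0 ->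
  partial i (fun q => (f q)^-1) p = - (f p)^-1 * (f p)^-1 * partial i f p.
Proof.
move=> Cf f0; apply: has_partialE.
exact: (has_partialV f0 (class_C_has_partial i Cf I)).
Qed.

Section logprofile.
Variable d : R.
Hypothesis d0 : 0 < d.

Definition log_profile (x : R) := ln (1 + x ^+ 2 / d).

Lemma log_profile_arg x : 0 < 1 + x ^+ 2 / d.
Proof. by rewrite ltr_pwDl// divr_ge0 ?sqr_ge0 ?ltW. Qed.

Lemma sqrD_gt0 x : 0 < x ^+ 2 + d.
Proof. by rewrite ltr_wpDl// sqr_ge0. Qed.

Lemma is_derive_sq (x : R) : is_derive x 1 (fun y : R => y ^+ 2) (2 * x).
Proof.
apply: (is_derive_eq (is_deriveX (f := id) 2 (is_derive_id x 1))).
by rewrite /= [_ *: _]mulr1 expr1.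
Qed.

Lemma is_derive_log_profile (x : R) : is_derive x 1 log_profile (2 * x / (x ^+ 2 + d)).
Proof.
have H1 : is_derive x (1 : R) (fun y : R => 1 + y ^+ 2 / d) (2 * x / d).
  have Hs := is_derive_sq x.
  have -> : (fun y : R => 1 + y ^+ 2 / d) = cst 1 + d^-1 \*: (fun y : R => y ^+ 2).
    by apply/funext => y; rewrite mulrC.
  by apply: is_derive_eq; rewrite add0r [_ *: _]mulrC.
have H2 := is_derive1_ln (log_profile_arg x).
have H3 := @is_derive1_comp R (@ln R) (fun y : R => 1 + y ^+ 2 / d) x _ _ H2 H1.
have -> : 2 * x / (x ^+ 2 + d) = (1 + x ^+ 2 / d)^-1 * (2 * x / d).
  have -> : x ^+ 2 + d = d * (1 + x ^+ 2 / d) by field; rewrite lt0r_neq0.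
  by rewrite invfM; ring.
exact: H3.
Qed.

Lemma log_profile_ge0 x : 0 <= log_profile x.
Proof. by apply: ln_ge0; rewrite lerDl divr_ge0 ?sqr_ge0 ?ltW. Qed.

Lemma log_profile0 : log_profile 0 = 0.
Proof. by rewrite /log_profile expr0n /= mul0r addr0 ln1. Qed.

Lemma log_profile_le x : log_profile x <= x ^+ 2 / d.
Proof. by apply: le_ln1Dx; apply: (lt_le_trans (ltrN10 R)); rewrite divr_ge0 ?sqr_ge0 ?ltW. Qed.

Lemma log_profile_mono x y : `|x| <= `|y| -> log_profile x <= log_profile y.
Proof.
move=> xy; rewrite ler_ln ?posrE ?log_profile_arg// lerD2l ler_pM2r ?invr_gt0//.
by rewrite -[x ^+ 2]real_normK ?num_real// -[y ^+ 2]real_normK ?num_real// lerXn2r ?nnegrE.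
Qed.

Lemma continuous_log_profile : continuous log_profile.
Proof.
by move=> x; apply/differentiable_continuous/derivable1_diffP; have H := is_derive_log_profile x;
  exact: ex_derive.
Qed.

(** The weight h of the energy identity: large near 0, yet with h(x) x^2 within 1 of
the logarithm ([log_weight_sq]). *)
Definition log_weight (x : R) := (1 + log_profile x) / (x ^+ 2 + d).
(** The derivative of x |-> h(x) x, where h is [log_weight]. *)
Definition log_weight' (x : R) :=
  (2 * x ^+ 2 + 2 * d * (1 + log_profile x)) / (x ^+ 2 + d) ^+ 2 - log_weight x.

Lemma continuous_sq : continuous (fun x : R => x ^+ 2).
Proof.
move=> x; apply/differentiable_continuous/derivable1_diffP.
by have H := is_derive_sq x; exact: ex_derive.
Qed.

Lemma continuous_sqD : continuous (fun x : R => x ^+ 2 + d).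
Proof. by move=> x; exact: (cvgD (@continuous_sq x) (cvg_cst d)). Qed.

Lemma continuous_log_weight : continuous log_weight.
Proof.
apply: (@continuousM1 (fun x => 1 + log_profile x) (fun x => (x ^+ 2 + d)^-1)).
  exact: (continuousD1 (@continuous_cst1 1) continuous_log_profile).
apply: continuousV1 continuous_sqD _ => x.
by rewrite lt0r_neq0// sqrD_gt0.
Qed.

Lemma continuous_log_weight' : continuous log_weight'.
Proof.
apply: continuousB1 continuous_log_weight; apply: continuousM1; last first.
  apply: continuousV1 => [|x]; last by rewrite expf_neq0// lt0r_neq0// sqrD_gt0.
  exact: (continuousM1 continuous_sqD continuous_sqD).
apply: continuousD1; apply: continuousM1.
- exact: continuous_cst1.
- exact: continuous_sq.
- exact: continuous_cst1.
- exact: (continuousD1 (@continuous_cst1 1) continuous_log_profile).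
Qed.

Lemma is_derive_log_weight (x : R) : is_derive x 1 (fun y => log_weight y * y) (log_weight' x).
Proof.
have n0 : x ^+ 2 + d != 0 by rewrite lt0r_neq0// sqrD_gt0.
have H1 := is_derive_log_profile x.
have H2 := is_derive_sq x.
have H3 : is_derive x (1 : R) (cst 1 + log_profile) (0 + 2 * x / (x ^+ 2 + d)).
  exact: is_deriveD.
have H4 : is_derive x (1 : R) ((fun y : R => y ^+ 2) + cst d) (2 * x + 0).
  exact: is_deriveD.
have H5 : is_derive x (1 : R) (fun y => (((fun y : R => y ^+ 2) + cst d) y)^-1)
    (- (x ^+ 2 + d) ^- 2 *: (2 * x + 0)).
  apply: DeriveDef; first by apply: derivableV.
  by rewrite deriveV// derive_val.
have H6 := is_deriveM H3 H5.
have H7 := is_deriveM H6 (is_derive_id x 1).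
apply: (is_derive_eq H7).
rewrite /log_weight' /log_weight /= !fctE /GRing.scale /=; move: (log_profile x) => l.
by field.
Qed.

(** The right-hand side of the energy identity thus controls the squared derivative of
[log_profile], which is 4 x^2 / (x^2 + d)^2. *)
Lemma log_weight_gain x : 2 / (x ^+ 2 + d) <= log_weight' x + log_weight x.
Proof.
rewrite /log_weight' subrK; have s0 := sqrD_gt0 x.
rewrite ler_pdivlMr ?exprn_gt0//.
rewrite (_ : 2 / (x ^+ 2 + d) * (x ^+ 2 + d) ^+ 2 = 2 * (x ^+ 2 + d)); last first.
  by field; rewrite lt0r_neq0.
have := log_profile_ge0 x => l0.
have : 0 <= d * log_profile x by rewrite mulr_ge0 // ltW.
move: (log_profile x) (x ^+ 2) l0 s0 => l y *; lra.
Qed.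

Lemma log_weight_sq x : log_profile x <= log_weight x * x ^+ 2 <= log_profile x + 1.
Proof.
have s0 := sqrD_gt0 x; have l0 := log_profile_ge0 x; have l1 := log_profile_le x.
have x0 : 0 <= x ^+ 2 by exact: sqr_ge0.
have l2 : d * log_profile x <= x ^+ 2 by rewrite mulrC -ler_pdivlMr.
rewrite /log_weight mulrAC; apply/andP; split.
  by rewrite ler_pdivlMr//; lra.
rewrite ler_pdivrMr//.
have : 0 <= d * log_profile x by rewrite mulr_ge0 // ltW.
move=> H; rewrite -subr_ge0.
have -> : (log_profile x + 1) * (x ^+ 2 + d) - (1 + log_profile x) * x ^+ 2 = d * log_profile x + d by ring.
by rewrite addr_ge0// ltW.
Qed.

End logprofile.
End onevar.

(** * Coordinates, and functions vanishing to second order *)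

Section coordinate.
Variable R : realType.
Local Notation plane := 'rV[R]_2.

Lemma coord_derive (p : plane) i j :
  derivable (fun q : plane => q 0 j) p (delta_mx 0 i) /\
  partial i (fun q : plane => q 0 j) p = (j == i)%:R.
Proof.
have E : (fun t : R => (t *: delta_mx 0 i + p) 0 j) =
    (fun t : R => t * (j == i)%:R) + cst (p 0 j) :> (R -> R).
  by apply/funext => t; rewrite !mxE /= fctE.
have H : is_derive (0 : R) 1 ((fun t : R => t * (j == i)%:R) + cst (p 0 j))
    ((j == i)%:R + 0).
  apply: is_deriveD; have -> : (fun t : R => t * (j == i)%:R) = (j == i)%:R \*: id.
    by apply/funext => t; rewrite /= mulrC.
  by apply: is_derive_eq; rewrite [_ *: _]mulr1.
split.
  apply: (iffLR (line_derivable0 (fun q : plane => q 0 j) _ _)); rewrite E.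
  exact: ex_derive.
rewrite /partial -(line_derive0 (fun q : plane => q 0 j)) E.
by rewrite (@derive_val _ _ _ _ _ _ _ H) addr0.
Qed.

Lemma C1_coord j : class_C setT 1 (fun q : plane => q 0 j).
Proof.
split=> [p _|/= i]; first exact: coord_continuous.
split=> [p _|]; first exact: (coord_derive p i j).1.
change (class_C setT 0 (partial i (fun q : plane => q 0 j))).
apply: (@class_C_ext _ _ openT _ (fun=> (j == i)%:R)); last exact: class_C_cst openT _ _.
by move=> p _; rewrite (coord_derive p i j).2.
Qed.

End coordinate.

Section increments.
Variable R : realType.
Local Notation plane := 'rV[R]_2.

Lemma row_increment (F : plane -> R) C x0 x y : class_C setT 1 F ->
  (forall p, `|partial 0 F p| <= C) ->
  `|F (pt x y) - F (pt x0 y)| <= C * `|x - x0|.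
Proof.
move=> CF HC.
have := @increment_bound R (fun t => F (pt t y)) x0 x 0 C.
rewrite mul0r subr0; apply => t _; split.
  apply/derivable0E; exact: class_C_derivable CF I.
by rewrite -partial0E subr0.
Qed.

Lemma col_increment (F : plane -> R) C x y0 y : class_C setT 1 F ->
  (forall p, `|partial 1 F p| <= C) ->
  `|F (pt x y) - F (pt x y0)| <= C * `|y - y0|.
Proof.
move=> CF HC.
have := @increment_bound R (fun t => F (pt x t)) y0 y 0 C.
rewrite mul0r subr0; apply => t _; split.
  apply/derivable1E; exact: class_C_derivable CF I.
by rewrite -partial1E subr0.
Qed.

Lemma partial_max (F : plane -> R) x y : class_C setT 1 F ->
  (forall p, F p <= F (pt x y)) -> forall i, partial i F (pt x y) = 0.
Proof.
move=> CF Fm i; case: (ord2P i) => ->.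
  rewrite partial0E.
  have H : is_derive x 1 (fun t => F (pt t y)) 0.
    apply: (@derive1_at_max R _ (x - 1) (x + 1)); first by lra.
    - move=> t _; apply/derivable0E; exact: class_C_derivable CF I.
    - by rewrite in_itv /=; apply/andP; split; lra.
    - by move=> t _; exact: Fm.
  exact: derive_val.
rewrite partial1E.
have H : is_derive y 1 (fun t => F (pt x t)) 0.
  apply: (@derive1_at_max R _ (y - 1) (y + 1)); first by lra.
  - move=> t _; apply/derivable1E; exact: class_C_derivable CF I.
  - by rewrite in_itv /=; apply/andP; split; lra.
  - by move=> t _; exact: Fm.
exact: derive_val.
Qed.

Lemma quadratic_zero (F : plane -> R) x0 y0 : class_C setT 2 F -> biperiodic F ->
  F (pt x0 y0) = 0 -> (forall i, partial i F (pt x0 y0) = 0) ->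
  exists2 C, 0 < C & forall r x y, 0 <= r -> x0 <= x <= x0 + r -> y0 <= y <= y0 + r ->
    `|F (pt x y)| <= C * (r * r).
Proof.
move=> CF pF F0 dF0.
have bnd i j : exists2 M, 0 < M & forall p, `|partial i (partial j F) p| <= M.
  apply: bounded_periodic; last by do 2![apply: periodic_partial].
  by apply: C0_continuous; do 2![apply: class_C_partial].
have [M00 M000 H00] := bnd 0 0; have [M01 M010 H01] := bnd 0 1.
have [M10 M100 H10] := bnd 1 0; have [M11 M110 H11] := bnd 1 1.
pose M := M00 + M01 + M10 + M11.
have M0 : 0 < M by rewrite /M; lra.
have HM i j p : `|partial i (partial j F) p| <= M.
  have [m00 m01 m10 m11] : [/\ M00 <= M, M01 <= M, M10 <= M & M11 <= M].
    by rewrite /M; split; lra.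
  have := H00 p; have := H01 p; have := H10 p; have := H11 p.
  by case: (ord2P i) => ->; case: (ord2P j) => -> h11 h10 h01 h00;
    [exact: le_trans h00 m00|exact: le_trans h01 m01|exact: le_trans h10 m10|
     exact: le_trans h11 m11].
(* Along one axis F grows by at most 2 M r times r, as its gradient is at most 2 M r. *)
exists (4 * M); first by rewrite mulr_gt0.
move=> r x y r0 hx hy.
have nearE (t t0 : R) : t0 <= t <= t0 + r -> `|t - t0| <= r.
  by move=> /andP[? ?]; rewrite ger0_norm; lra.
have C1 i : class_C setT 1 (partial i F) by exact: class_C_partial.
have dF i x' y' : x0 <= x' <= x0 + r -> y0 <= y' <= y0 + r ->
    `|partial i F (pt x' y')| <= 2 * M * r.
  move=> /nearE hx' /nearE hy'.
  have h1 := row_increment x0 x' y' (C1 i) (HM 0 i).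
  have h2 := col_increment x0 y0 y' (C1 i) (HM 1 i).
  rewrite dF0 subr0 in h2.
  have h3 : M * `|x' - x0| <= M * r by rewrite ler_pM2l.
  have h4 : M * `|y' - y0| <= M * r by rewrite ler_pM2l.
  have := ler_normD (partial i F (pt x' y') - partial i F (pt x0 y')) (partial i F (pt x0 y')).
  rewrite subrK => h5; lra.
have inc0 : `|F (pt x y) - F (pt x0 y)| <= 2 * M * r * r.
  have [z zx ->] : exists2 z, z \in `[x0, x] & F (pt x y) - F (pt x0 y) =
      partial 0 F (pt z y) * (x - x0).
    apply: (@MVT_segment R (fun t => F (pt t y)) (fun t => partial 0 F (pt t y))).
    - by case/andP: hx.
    - move=> t _; apply: DeriveDef; last by rewrite partial0E.
      apply/derivable0E; exact: class_C_derivable CF I.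
    - apply: derivable_within_continuous => t _; apply/derivable0E.
      exact: class_C_derivable CF I.
  rewrite normrM ler_pM// ?nearE//; apply: dF => //.
  by move: zx hx; rewrite in_itv /= => /andP[-> ?] /andP[? ?]; apply/andP; split => //; lra.
have inc1 : `|F (pt x0 y) - F (pt x0 y0)| <= 2 * M * r * r.
  have [z zy ->] : exists2 z, z \in `[y0, y] & F (pt x0 y) - F (pt x0 y0) =
      partial 1 F (pt x0 z) * (y - y0).
    apply: (@MVT_segment R (fun t => F (pt x0 t)) (fun t => partial 1 F (pt x0 t))).
    - by case/andP: hy.
    - move=> t _; apply: DeriveDef; last by rewrite partial1E.
      apply/derivable1E; exact: class_C_derivable CF I.
    - apply: derivable_within_continuous => t _; apply/derivable1E.
      exact: class_C_derivable CF I.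
  rewrite normrM ler_pM// ?nearE//; apply: dF; first by rewrite lexx lerDl.
  by move: zy hy; rewrite in_itv /= => /andP[-> ?] /andP[? ?]; apply/andP; split => //; lra.
rewrite F0 subr0 in inc1.
have := ler_normD (F (pt x y) - F (pt x0 y)) (F (pt x0 y)); rewrite subrK => h.
have -> : 4 * M * (r * r) = 2 * M * r * r + 2 * M * r * r by ring.
by apply: (le_trans h); exact: lerD.
Qed.

Lemma sin_le (x : R) : `|sin x| <= `|x|.
Proof.
have := @increment_bound R sin 0 x 0 1; rewrite sin0 !subr0 mul0r subr0 mul1r.
by apply => t _; rewrite derive_val subr0; split=> //; exact: cos_max.
Qed.

End increments.

Opaque class_C partial int2.

(** * Energy estimates for the Ricci equation *)

Section system.
Variable R : realType.
Local Notation plane := 'rV[R]_2.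
Implicit Types (A : 'I_2 -> 'I_2 -> plane -> R).

Lemma variation_too_small (r s1 s2 : R) : 0 < r -> s1 <= r / 8 -> s2 <= r / 8 ->
  2^-1 <= (s1 + s2) / r -> False.
Proof. by move=> r0 h1 h2; rewrite ler_pdivlMr//; lra. Qed.

Lemma deficit_sum (e s s1 s2 : R) : 1 - e / 3 - s1 - s2 <= s -> s1 <= e / 3 ->
  s2 <= e / 3 -> 1 - s <= e.
Proof. lra. Qed.

Definition div_grad A (f : plane -> R) p : R :=
  \sum_(i < 2) partial i (fun q => \sum_(j < 2) A i j q * partial j f q) p.

Definition grad_sq A (f : plane -> R) p : R :=
  \sum_(i < 2) \sum_(j < 2) A i j p * partial i f p * partial j f p.

(** What the proof retains of a periodic solution: A is sqrt(det g) g^-1, of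
determinant one, P is a periodic field whose divergence is the curvature density,
and the Ricci equation is multiplied by the area density rho. *)
Record ricci_system (a b c : R) (K rho : plane -> R) A (P : 'I_2 -> plane -> R) : Prop :=
 RicciSystem {
  rsK : class_C setT 2 K;
  rsKper : biperiodic K;
  rsrho : class_C setT 0 rho;
  rsrhoper : biperiodic rho;
  rsrho0 : forall p, 0 < rho p;
  rsA : forall i j, class_C setT 1 (A i j);
  rsAper : forall i j, biperiodic (A i j);
  rsAsym : forall p, A 1 0 p = A 0 1 p;
  rsAdet : forall p, A 0 0 p * A 1 1 p - A 0 1 p ^+ 2 = 1;
  rsA00 : forall p, 0 < A 0 0 p;
  rsP : forall i, class_C setT 1 (P i);
  rsPper : forall i, biperiodic (P i);
  rsGB : forall p, rho p * K p = partial 0 (P 0) p + partial 1 (P 1) p;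
  rseq : forall p, (c - K p) * div_grad A K p + grad_sq A K p
    + rho p * ((a * K p + b) * (K p - c) ^+ 2) = 0 }.

Variables (a b c : R) (K rho : plane -> R) (A : 'I_2 -> 'I_2 -> plane -> R).
Variable P : 'I_2 -> plane -> R.
Hypothesis Hs : ricci_system a b c K rho A P.

Let CK2 := rsK Hs.
Let CK1 := class_C_pred CK2.
Let CK0 := class_C_pred CK1.
Let CdK i := class_C_partial i CK2.
Let CdK0 i := class_C_pred (CdK i).
Let Crho := rsrho Hs.
Let CA := rsA Hs.
Let CA0 i j := class_C_pred (CA i j).

Definition dev p := K p - c.
Definition source p := rho p * (a * K p + b).

Lemma C0_grad_sq : class_C setT 0 (grad_sq A K).
Proof.
do 2![apply: (class_C_sum openT) => ?].
by apply: (class_CM openT) => //; apply: (class_CM openT).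
Qed.

Lemma C0_source : class_C setT 0 source.
Proof.
apply: (class_CM openT) => //; apply: (class_CD openT); last exact: class_C_cst openT _ _.
by apply: (class_CM openT) => //; exact: class_C_cst openT _ _.
Qed.

Lemma C1_dev : class_C setT 1 dev.
Proof. exact: (class_CB openT CK1 (class_C_cst openT 1 c)). Qed.

Lemma C0_dev : class_C setT 0 dev.
Proof. exact: class_C_pred C1_dev. Qed.

Lemma partial_dev i p : partial i dev p = partial i K p.
Proof.
rewrite /dev (partialDE p i CK1 (class_C_cst openT 1 (- c))).
by rewrite partial_cst addr0.
Qed.

Lemma int2_rhoK : int2 (fun p => rho p * K p) = 0.
Proof.
have C0dP i : class_C setT 0 (partial i (P i)) by exact/class_C_partial/(rsP Hs).
have -> : (fun p => rho p * K p) = (fun p => partial 0 (P 0) p + partial 1 (P 1) p).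
  by apply/funext => p; exact: rsGB Hs p.
rewrite int2D; [|exact: C0_continuous (C0dP 0)|exact: C0_continuous (C0dP 1)].
rewrite (int2_partial 0 (rsP Hs 0) (rsPper Hs 0)).
by rewrite (int2_partial 1 (rsP Hs 1) (rsPper Hs 1)) addr0.
Qed.

Definition trace_coef p := A 0 0 p + A 1 1 p.

Lemma trace_coef_gt0 p : 0 < trace_coef p.
Proof.
have A00 := rsA00 Hs p; have Ad := rsAdet Hs p; rewrite /trace_coef addr_gt0//.
rewrite -(pmulr_rgt0 _ A00); have := sqr_ge0 (A 0 1 p); lra.
Qed.

(** The determinant being 1, the eigenvalues of A are inverse to one another, so the
largest one is at most the trace and the smallest one at least its inverse. *)
Lemma quad_lower p (v w : R) :
  v ^+ 2 + w ^+ 2 <= trace_coef p *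
   (A 0 0 p * v * v + A 0 1 p * v * w + (A 0 1 p * w * v + A 1 1 p * w * w)).
Proof.
have Ad := rsAdet Hs p; rewrite /trace_coef; rewrite -subr_ge0.
have -> : (A 0 0 p + A 1 1 p) *
 (A 0 0 p * v * v + A 0 1 p * v * w + (A 0 1 p * w * v + A 1 1 p * w * w)) -
 (v ^+ 2 + w ^+ 2) = (A 0 0 p * v + A 0 1 p * w) ^+ 2 + (A 0 1 p * v + A 1 1 p * w) ^+ 2 +
   ((A 0 0 p * A 1 1 p - A 0 1 p ^+ 2) - 1) * (v ^+ 2 + w ^+ 2) by ring.
by rewrite Ad subrr mul0r addr0 addr_ge0// sqr_ge0.
Qed.

Lemma grad_sq_lower p :
  partial 0 K p ^+ 2 + partial 1 K p ^+ 2 <= trace_coef p * grad_sq A K p.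
Proof.
rewrite /grad_sq !sum2 (rsAsym Hs); exact: quad_lower.
Qed.

Lemma grad_sq_ge0 p : 0 <= grad_sq A K p.
Proof.
rewrite -(pmulr_rge0 _ (trace_coef_gt0 p)); apply: le_trans (grad_sq_lower p).
by rewrite addr_ge0 ?sqr_ge0.
Qed.

(** Integrate the divergence of h(dev) dev A(grad K), whose integral vanishes by
periodicity, and eliminate dev div(A grad K) with the Ricci equation. *)
Lemma energy_identity (h h' : R -> R) :
  (forall x : R, is_derive x 1 (fun y => h y * y) (h' x)) ->
  continuous h -> continuous h' ->
  int2 (fun p => (h' (dev p) + h (dev p)) * grad_sq A K p) +
  int2 (fun p => source p * (h (dev p) * dev p ^+ 2)) = 0.
Proof.
move=> dh ch ch'.
pose V i p := \sum_(j < 2) A i j p * partial j K p.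
have CV i : class_C setT 1 (V i).
  apply: (class_C_sum openT) => j.
  exact: (class_CM openT (rsA Hs i j) (class_C_partial j (rsK Hs))).
pose H p := h (dev p) * dev p.
have CH : class_C setT 1 H by exact: (class_C1_comp1 dh ch' C1_dev).
have dH i p : partial i H p = h' (dev p) * partial i K p.
  by rewrite (partial_comp1E p i dh C1_dev) partial_dev.
have CX i : class_C setT 1 (fun p => H p * V i p) by exact: class_CM openT _ _ _ CH (CV i).
have pX i : biperiodic (fun p => H p * V i p).
  move=> p z zi; have -> : V i (p + z) = V i p.
    apply: eq_bigr => j _; rewrite (rsAper Hs) //.
    by rewrite (periodic_partial _ (rsKper Hs)).
  by rewrite /H /dev (rsKper Hs).
have I0 i : int2 (partial i (fun p => H p * V i p)) = 0 by exact: (int2_partial i (CX i) (pX i)).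
have c1 : class_C setT 0 (fun p => (h' (dev p) + h (dev p)) * grad_sq A K p).
  apply: (class_CM openT); last exact: C0_grad_sq.
  by apply: (class_CD openT); apply: class_C0_comp1 => //; exact: C0_dev.
have c2 : class_C setT 0 (fun p => source p * (h (dev p) * dev p ^+ 2)).
  apply: (class_CM openT); first exact: C0_source.
  apply: (class_CM openT); first by apply: class_C0_comp1 => //; exact: C0_dev.
  by apply: (class_CM openT); exact: C0_dev.
rewrite -int2D; [|exact: C0_continuous..].
rewrite -[RHS]addr0 -{1}(I0 0) -(I0 1) -int2D; first last.
- exact/C0_continuous/class_C_partial/CX.
- exact/C0_continuous/class_C_partial/CX.
congr int2; apply/funext => p; rewrite !(partialME _ _ CH (CV _)) !dH.
have E : dev p * (partial 0 (V 0) p + partial 1 (V 1) p) =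
    grad_sq A K p + source p * dev p ^+ 2.
  have := rseq Hs p; rewrite /div_grad sum2 -/(V 0) -/(V 1) /source /dev => E.
  by apply/eqP; rewrite -subr_eq0; apply/eqP; rewrite -[RHS]oppr0 -E; ring.
have E2 : grad_sq A K p = V 0 p * partial 0 K p + V 1 p * partial 1 K p.
  rewrite /grad_sq /V !sum2.
  by move: (A 0 0 p) (A 0 1 p) (A 1 0 p) (A 1 1 p) (partial 0 K p) (partial 1 K p) => *; ring.
transitivity (h' (dev p) * (V 0 p * partial 0 K p + V 1 p * partial 1 K p) +
   h (dev p) * (dev p * (partial 0 (V 0) p + partial 1 (V 1) p))).
  by rewrite E -E2; ring.
by rewrite /H; ring.
Qed.

Lemma C0_trace_coef : class_C setT 0 trace_coef.
Proof. exact: (class_CD openT (CA0 0 0) (CA0 1 1)). Qed.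

Lemma biperiodic_trace_coef : biperiodic trace_coef.
Proof. by move=> p z zi; rewrite /trace_coef !(rsAper Hs). Qed.

Lemma biperiodic_dev : biperiodic dev.
Proof. by move=> p z zi; rewrite /dev (rsKper Hs). Qed.

Lemma biperiodic_source : biperiodic source.
Proof. by move=> p z zi; rewrite /source (rsKper Hs)// (rsrhoper Hs). Qed.

Section logtest.
Variables (d T : R).
Hypotheses (d0 : 0 < d) (T0 : 0 < T).

Definition logtest p := log_profile d (dev p) * T^-1.
Definition logrem p := log_weight d (dev p) * dev p ^+ 2 - log_profile d (dev p).
Definition flux := - int2 (fun p => source p * (log_weight d (dev p) * dev p ^+ 2)).

Lemma C1_log_profile_dev : class_C setT 1 (fun p => log_profile d (dev p)).
Proof.
apply: (class_C1_comp1 (is_derive_log_profile d0) _ C1_dev).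
apply: continuousM1; last first.
  apply: (continuousV1 (@continuous_sqD R d)) => x.
  by rewrite lt0r_neq0// sqrD_gt0.
exact: mulrl_continuous.
Qed.

Lemma C1_logtest : class_C setT 1 logtest.
Proof. exact: (class_CM openT C1_log_profile_dev (class_C_cst openT 1 T^-1)). Qed.

Lemma partial_logtest i p :
  partial i logtest p = 2 * dev p / (dev p ^+ 2 + d) * T^-1 * partial i K p.
Proof.
rewrite /logtest (partialME p i C1_log_profile_dev (class_C_cst openT 1 T^-1)).
rewrite partial_cst mulr0 add0r (partial_comp1E p i (is_derive_log_profile d0) C1_dev).
rewrite partial_dev; move: (dev p) (partial i K p) => x y; ring.
Qed.

Lemma gain_integrable :
  class_C setT 0 (fun p => (log_weight' d (dev p) + log_weight d (dev p)) * grad_sq A K p).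
Proof.
apply: (class_CM openT _ C0_grad_sq); apply: (class_CD openT).
  exact: (class_C0_comp1 (continuous_log_weight' d0) C0_dev).
exact: (class_C0_comp1 (continuous_log_weight d0) C0_dev).
Qed.

Lemma flux_gain :
  flux = int2 (fun p => (log_weight' d (dev p) + log_weight d (dev p)) * grad_sq A K p).
Proof.
have := energy_identity (is_derive_log_weight d0) (continuous_log_weight d0) (continuous_log_weight' d0).
by move/eqP; rewrite addr_eq0 => /eqP ->.
Qed.

Lemma C0_partial_logtest_sq i : class_C setT 0 (fun p => partial i logtest p ^+ 2).
Proof. exact: (class_CM openT (class_C_partial i C1_logtest) (class_C_partial i C1_logtest)). Qed.

(** By [log_weight_gain] the squared derivative of [log_profile] is at most twice the
factor of A(grad K, grad K) in the energy identity, and [quad_lower] compares A with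
the identity. *)
Lemma logtest_energy M : (forall p, trace_coef p <= M) ->
  int2 (fun p => partial 0 logtest p ^+ 2) + int2 (fun p => partial 1 logtest p ^+ 2)
    <= 2 * M / T ^+ 2 * flux.
Proof.
move=> HM; have M0 : 0 < M by apply: lt_le_trans (HM 0); exact: trace_coef_gt0.
have c0 := C0_continuous (C0_partial_logtest_sq 0).
have c1 := C0_continuous (C0_partial_logtest_sq 1).
rewrite -(int2D c0 c1) flux_gain -(int2Z _ (C0_continuous gain_integrable)).
apply: le_int2.
- exact: C0_continuous (class_CD openT (C0_partial_logtest_sq 0) (C0_partial_logtest_sq 1)).
- exact: C0_continuous (class_CM openT (class_C_cst openT 0 _) gain_integrable).
move=> p; rewrite !partial_logtest.
have s0 := sqrD_gt0 d0 (dev p); have g0 := grad_sq_ge0 p.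
have gain := log_weight_gain d0 (dev p); have gl := grad_sq_lower p.
have {}gl : partial 0 K p ^+ 2 + partial 1 K p ^+ 2 <= M * grad_sq A K p.
  by apply: le_trans gl _; rewrite ler_wpM2r.
set x := dev p in s0 gain *; set y := log_weight' d x + log_weight d x in gain *.
set k := 2 * x / (x ^+ 2 + d) * T^-1.
have k2 : k ^+ 2 <= 2 / T ^+ 2 * y.
  apply: (@le_trans _ _ (2 / T ^+ 2 * (2 / (x ^+ 2 + d)))); last first.
    by rewrite ler_pM2l// divr_gt0// exprn_gt0.
  have -> : k ^+ 2 = 2 / T ^+ 2 * (2 / (x ^+ 2 + d) * (x ^+ 2 / (x ^+ 2 + d))).
    by rewrite /k; field; rewrite !lt0r_neq0.
  rewrite ler_pM2l ?divr_gt0 ?exprn_gt0//.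
  rewrite ger_pMr ?divr_gt0// ler_pdivrMr// mul1r lerDl; exact: ltW.
clearbody k; rewrite !exprMn -mulrDr.
apply: (@le_trans _ _ (k ^+ 2 * (M * grad_sq A K p))).
  by rewrite ler_wpM2l ?sqr_ge0.
apply: (@le_trans _ _ (2 / T ^+ 2 * y * (M * grad_sq A K p))).
  by rewrite ler_wpM2r// mulr_ge0// ltW.
by rewrite le_eqVlt; apply/orP; left; apply/eqP; move: (grad_sq A K p) => *; ring.
Qed.

Lemma logrem01 p : 0 <= logrem p <= 1.
Proof. by have /andP[? ?] := log_weight_sq d0 (dev p); rewrite /logrem; apply/andP; split; lra. Qed.

Lemma C0_logrem : class_C setT 0 logrem.
Proof.
apply: (class_CB openT); last exact: class_C_pred C1_log_profile_dev.
apply: (class_CM openT).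
  exact: (class_C0_comp1 (continuous_log_weight d0) C0_dev).
exact: (class_CM openT C0_dev C0_dev).
Qed.

Lemma flux_split :
  flux = - (T * int2 (fun p => source p * logtest p)) - int2 (fun p => source p * logrem p).
Proof.
have C1 : class_C setT 0 (fun p => source p * logtest p).
  exact: (class_CM openT C0_source (class_C_pred C1_logtest)).
have C2 : class_C setT 0 (fun p => source p * logrem p).
  exact: (class_CM openT C0_source C0_logrem).
rewrite -(int2Z T (C0_continuous C1)) -opprD -int2D; last 2 first.
- exact: C0_continuous (class_CM openT (class_C_cst openT 0 T) C1).
- exact: C0_continuous C2.
congr (- int2 _); apply/funext => p; rewrite /logtest /logrem.
move: (source p) (log_profile d (dev p)) (log_weight d (dev p)) => s l w.
by rewrite [T * _]mulrCA [T * _]mulrCA divff ?lt0r_neq0//; ring.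
Qed.

Lemma logtest_ge0 p : 0 <= logtest p.
Proof. by rewrite /logtest mulr_ge0 ?log_profile_ge0// invr_ge0 ltW. Qed.

Lemma logtest_eq0 p : dev p = 0 -> logtest p = 0.
Proof. by rewrite /logtest => ->; rewrite log_profile0 mul0r. Qed.

End logtest.

Lemma int2_abs_le (F : plane -> R) e : class_C setT 0 F -> 0 < e ->
  int2 (fun p => `|F p|) <= (e + int2 (fun p => F p ^+ 2) / e) / 2.
Proof.
move=> CF e0; have CF2 : class_C setT 0 (fun p => F p ^+ 2) by exact: (class_CM openT CF CF).
have C1 : class_C setT 0 (fun p => e^-1 * F p ^+ 2).
  exact: (class_CM openT (class_C_cst openT 0 _) CF2).
have C2 : class_C setT 0 (fun p => e + e^-1 * F p ^+ 2).
  exact: (class_CD openT (class_C_cst openT 0 _) C1).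
have -> : (e + int2 (fun p => F p ^+ 2) / e) / 2 =
    int2 (fun p => 2^-1 * (e + e^-1 * F p ^+ 2)).
  rewrite (int2Z _ (C0_continuous C2)) int2D; last 2 first.
  - by move=> p; exact: cst_continuous.
  - exact: C0_continuous C1.
  by rewrite int2_cst (int2Z _ (C0_continuous CF2)) mulrC [_ / e]mulrC.
apply: le_int2.
- exact/continuous_norm/C0_continuous.
- exact: C0_continuous (class_CM openT (class_C_cst openT 0 _) C2).
move=> p; move: (F p) => x; rewrite mulrC ler_pdivlMr//.
rewrite -(ler_pM2l e0) (_ : e * (e + e^-1 * x ^+ 2) = e * e + x ^+ 2); last first.
  by field; rewrite lt0r_neq0.
rewrite -[x ^+ 2]real_normK ?num_real//; move: `|x| => y.
rewrite -subr_ge0 (_ : _ - _ = (e - y) ^+ 2); last by ring.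
exact: sqr_ge0.
Qed.

(** The value of d for which [log_profile] takes the value T at Y. *)
Definition log_offset (Y T : R) := Y ^+ 2 / (expR T - 1).

Lemma expRB1_gt0 (T : R) : 0 < T -> 0 < expR T - 1.
Proof. by move=> T0; rewrite subr_gt0 expR_gt1. Qed.

Lemma log_offset_gt0 Y T : 0 < Y -> 0 < T -> 0 < log_offset Y T.
Proof. by move=> Y0 T0; rewrite divr_gt0 ?exprn_gt0// expRB1_gt0. Qed.

Lemma logp_offset Y T x : 0 < Y -> 0 < T ->
  log_profile (log_offset Y T) x = ln (1 + (x / Y) ^+ 2 * (expR T - 1)).
Proof.
move=> Y0 T0; rewrite /log_profile /log_offset; congr (ln (1 + _)).
have e0 := expRB1_gt0 T0; move: (expR T - 1) e0 => e e0.
by field; rewrite !lt0r_neq0.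
Qed.

Section scaled.
Variables (Y B M : R).
Hypothesis Y0 : 0 < Y.
Hypothesis devY : forall p, `|dev p| <= Y.
Hypothesis sourceB : forall p, `|source p| <= B.
Hypothesis trM : forall p, trace_coef p <= M.

Definition test T := logtest (log_offset Y T) T.

Lemma test_le1 T p : 0 < T -> test T p <= 1.
Proof.
move=> T0; rewrite /test /logtest ler_pdivrMr// mul1r.
have : log_profile (log_offset Y T) Y = T.
  rewrite logp_offset// divff ?lt0r_neq0// expr1n mul1r addrC subrK.
  exact: expRK.
move=> {2}<-; apply: log_profile_mono; first exact: log_offset_gt0.
by rewrite [leRHS]ger0_norm// ltW.
Qed.

(** The offset d decreases like exp(-T), so changing dev by a fixed factor changes
the logarithm by a bounded amount, which is negligible after division by T. *)
Lemma test_ge T p m : 0 < T -> 0 < m -> m <= `|dev p| ->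
  1 - ln ((Y / m) ^+ 2) / T <= test T p.
Proof.
move=> T0 m0 mp; have mY : m <= Y by apply: le_trans mp _.
rewrite /test /logtest ler_pdivlMr// mulrBl mul1r divfK ?lt0r_neq0//.
apply: (@le_trans _ _ (log_profile (log_offset Y T) m)); last first.
  by apply: log_profile_mono; [exact: log_offset_gt0|rewrite [leLHS]ger0_norm// ltW].
rewrite logp_offset// -[T in T - _]expRK -ln_div; last 2 first.
- by rewrite posrE expR_gt0.
- by rewrite posrE exprn_gt0// divr_gt0.
have e0 := expRB1_gt0 T0; have my : (m / Y) ^+ 2 <= 1.
  apply: exprn_ile1; first by rewrite divr_ge0 ?ltW.
  by rewrite ler_pdivrMr// mul1r.
rewrite ler_ln ?posrE; last 2 first.
- by rewrite divr_gt0 ?expR_gt0// exprn_gt0// divr_gt0.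
- by rewrite ltr_pwDl// mulr_ge0 ?sqr_ge0 ?ltW.
have -> : expR T / (Y / m) ^+ 2 = (m / Y) ^+ 2 * expR T.
  by rewrite mulrC -exprVn invf_div.
rewrite mulrBr mulr1; lra.
Qed.

Lemma B_ge0 : 0 <= B. Proof. exact: le_trans (normr_ge0 _) (sourceB 0). Qed.

Lemma M_gt0 : 0 < M. Proof. by apply: lt_le_trans (trM 0); exact: trace_coef_gt0. Qed.

Lemma int2_source_le (F : plane -> R) : class_C setT 0 F -> (forall p, 0 <= F p) ->
  `|int2 (fun p => source p * F p)| <= B * int2 F.
Proof.
move=> CF F0; rewrite -(int2Z _ (C0_continuous CF)).
have C1 : class_C setT 0 (fun p => source p * F p) by exact: (class_CM openT C0_source CF).
have C2 : class_C setT 0 (fun p => B * F p) by exact: (class_CM openT (class_C_cst openT 0 B) CF).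
rewrite ler_norml -mulN1r -(int2Z _ (C0_continuous C2)); apply/andP; split; apply: le_int2.
- exact: C0_continuous (class_CM openT (class_C_cst openT 0 _) C2).
- exact: C0_continuous.
- move=> p; rewrite mulN1r -mulNr ler_wpM2r//.
  by have := sourceB p; rewrite ler_norml => /andP[].
- exact: C0_continuous.
- exact: C0_continuous.
- move=> p; rewrite ler_wpM2r//; exact: le_trans (ler_norm _) (sourceB p).
Qed.

Lemma C1_test T : 0 < T -> class_C setT 1 (test T).
Proof. by move=> T0; apply: C1_logtest; exact: log_offset_gt0. Qed.

Lemma C0_deficit T : 0 < T -> class_C setT 0 (fun p => 1 - test T p).
Proof.
move=> T0; exact: (class_CB openT (class_C_cst openT 0 1) (class_C_pred (C1_test T0))).
Qed.

Lemma deficit_ge0 T p : 0 < T -> 0 <= 1 - test T p.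
Proof. by move=> T0; rewrite subr_ge0 test_le1. Qed.

Lemma int2_rem_le T : 0 < T ->
  `|int2 (fun p => source p * logrem (log_offset Y T) p)| <= B.
Proof.
move=> T0; have d0 := log_offset_gt0 Y0 T0.
apply: le_trans (int2_source_le (C0_logrem d0) _) _.
  by move=> p; have /andP[] := logrem01 d0 p.
rewrite -[leRHS]mulr1 ler_wpM2l ?B_ge0// -[leRHS]int2_cst; apply: le_int2.
- exact: C0_continuous (C0_logrem d0).
- by move=> p; exact: cst_continuous.
- by move=> p; have /andP[] := logrem01 d0 p.
Qed.

(** Writing test = 1 - (1 - test), the flux is minus T times the total source up to
the deficit and to the bounded remainder [logrem]. *)
Lemma flux_deficit T : 0 < T ->
  flux (log_offset Y T) + T * int2 source <= T * (B * int2 (fun p => 1 - test T p)) + B.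
Proof.
move=> T0; have d0 := log_offset_gt0 Y0 T0; rewrite (flux_split d0 T0).
have C1 : class_C setT 0 (fun p => source p * test T p).
  exact: (class_CM openT C0_source (class_C_pred (C1_test T0))).
have E : int2 source - int2 (fun p => source p * test T p) =
    int2 (fun p => source p * (1 - test T p)).
  rewrite -int2B; [|exact: C0_continuous C0_source|exact: C0_continuous C1].
  by congr int2; apply/funext => p; rewrite mulrBr mulr1.
have h1 := int2_source_le (C0_deficit T0) (fun p => deficit_ge0 p T0).
have h2 := int2_rem_le T0.
rewrite -/(test T); move: E h1 h2.
set s1 := int2 (fun p => source p * test T p); set s2 := int2 source.
set s3 := int2 (fun p => source p * (1 - test T p)); set s4 := int2 (fun p => source p * logrem _ p).
move=> E /ler_normlW h1 /lerNnormlW h2; clearbody s1 s2 s3 s4.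
rewrite addrAC -[- (T * s1) + _]addrC -mulrBr E.
by apply: lerD; [rewrite ler_pM2l|lra].
Qed.

Lemma flux_le T : 0 < T -> flux (log_offset Y T) <= B * (T + 1).
Proof.
move=> T0; have d0 := log_offset_gt0 Y0 T0; rewrite (flux_split d0 T0).
have h2 := int2_rem_le T0.
have := int2_source_le (class_C_pred (C1_test T0)) (fun p => logtest_ge0 d0 T0 p).
have : int2 (test T) <= 1.
  rewrite -[leRHS]int2_cst; apply: le_int2 => [||p]; last exact: test_le1.
    exact: C0_continuous (class_C_pred (C1_test T0)).
  by move=> p; exact: cst_continuous.
rewrite -/(test T); move: h2.
set s1 := int2 (fun p => source p * test T p).
set s4 := int2 (fun p => source p * logrem _ p).
set s5 := int2 (test T).
move=> /lerNnormlW h2 h5 /lerNnormlW h1.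
have h6 : B * s5 <= B by rewrite -[leRHS]mulr1 ler_wpM2l ?B_ge0.
have h7 : - s1 <= B by lra.
have : T * - s1 <= T * B by rewrite ler_pM2l.
by rewrite mulrN mulrDr mulr1 [B * T]mulrC; lra.
Qed.

Lemma small_gradient e : 0 < e -> exists2 T0, 1 <= T0 &
  forall T, T0 <= T -> forall i, int2 (fun p => `|partial i (test T) p|) <= e.
Proof.
move=> e0; exists (1 + 4 * M * B / e ^+ 2).
  by rewrite lerDl divr_ge0 ?sqr_ge0// mulr_ge0 ?B_ge0// mulr_ge0// ltW ?M_gt0.
move=> T TT; have q0 : 0 <= 4 * M * B / e ^+ 2.
  by rewrite divr_ge0 ?sqr_ge0// mulr_ge0 ?B_ge0// mulr_ge0// ltW ?M_gt0.
have T0 : 0 < T by lra.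
have d0 := log_offset_gt0 Y0 T0.
have En : int2 (fun p => partial 0 (test T) p ^+ 2) + int2 (fun p => partial 1 (test T) p ^+ 2)
    <= e ^+ 2.
  apply: le_trans (logtest_energy d0 T0 trM) _.
  apply: (@le_trans _ _ (2 * M / T ^+ 2 * (B * (T + 1)))).
    by rewrite ler_wpM2l ?flux_le// divr_ge0 ?sqr_ge0// mulr_ge0// ltW ?M_gt0.
  apply: (@le_trans _ _ (4 * M * B / T)).
    have -> : 4 * M * B / T = 2 * M / T ^+ 2 * (B * (T + T)) by field; rewrite lt0r_neq0.
    rewrite ler_wpM2l//; first by rewrite divr_ge0 ?sqr_ge0// mulr_ge0// ltW ?M_gt0.
    by rewrite ler_wpM2l ?B_ge0// lerD2l; lra.
  by rewrite ler_pdivrMr// [e ^+ 2 * T]mulrC -ler_pdivrMr ?exprn_gt0//; lra.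
have sq0 i : 0 <= int2 (fun p => partial i (test T) p ^+ 2).
  rewrite -[leLHS](int2_cst 0); apply: le_int2 => [p||p]; last exact: sqr_ge0.
    exact: cst_continuous.
  exact: C0_continuous (C0_partial_logtest_sq T d0 i).
move=> i; apply: (le_trans (int2_abs_le (class_C_partial i (C1_test T0)) e0)).
rewrite ler_pdivrMr//; have : int2 (fun p => partial i (test T) p ^+ 2) <= e ^+ 2.
  case: (ord2P i) => ->; apply: le_trans En.
    by rewrite lerDl sq0.
  by rewrite lerDr sq0.
move: (int2 _) => s.
by move=> h; rewrite mulr_natr mulr2n lerD2l ler_pdivrMr// -expr2.
Qed.

Lemma test_near1 e m : 0 < e -> 0 < m -> exists2 T0, 1 <= T0 &
  forall T, T0 <= T -> forall p, m <= `|dev p| -> 1 - e <= test T p.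
Proof.
move=> e0 m0; exists (Num.max 1 (ln ((Y / m) ^+ 2) / e)); first by rewrite le_max lexx.
move=> T; rewrite ge_max => /andP[T1 Te] p mp.
have T0 : 0 < T by lra.
apply: le_trans (test_ge T0 m0 mp); rewrite lerB// ler_pdivrMr//.
by rewrite [e * T]mulrC -ler_pdivrMr.
Qed.

(** The energy of the test function tends to 0, while [sign_change_cost] bounds it from
below. *)
Lemma no_sign_change p q : 0 < dev p -> dev q < 0 -> False.
Proof.
have cd : continuous dev := C0_continuous C0_dev.
have cN : continuous (fun p => - dev p) := C0_continuous (class_CN openT C0_dev).
have [x1 [y1 [x101 y101 E1]]] := reduce_mod1 p.
have [x2 [y2 [x201 y201 E2]]] := reduce_mod1 q.
rewrite -(E1 _ biperiodic_dev) -(E2 _ biperiodic_dev) => dp dq.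
set m := dev (pt x1 y1) / 2.
have m0 : 0 < m by rewrite divr_gt0.
have [r1 [r10 xr1 yr1 H1]] := @near_square _ dev x1 y1 m cd x101 y101 ltac:(rewrite /m; lra).
have [r2 [r20 xr2 yr2 H2]] := @near_square _ (fun p => - dev p) x2 y2 0 cN x201 y201 ltac:(by rewrite oppr_gt0).
set r := Num.min r1 r2.
have r0 : 0 < r by rewrite lt_min r10.
have [rr1 rr2] : r <= r1 /\ r <= r2 by rewrite /r !ge_min !lexx orbT.
have e0 : 0 < r / 8 by rewrite divr_gt0.
have [T1 T11 HT1] := small_gradient e0.
have [T2 T21 HT2] := @test_near1 (2^-1) m ltac:(by []) m0.
set T := Num.max T1 T2.
have [TT1 TT2] : T1 <= T /\ T2 <= T by rewrite /T !le_max !lexx orbT.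
have T0 : 0 < T by lra.
move: x101 y101 x201 y201 => /andP[x10 x11] /andP[y10 y11] /andP[x20 x21] /andP[y20 y21].
have le01 (x : R) : 0 <= x -> x < 1 -> 0 <= x <= 1 by move=> -> /ltW ->.
have yr : y1 + r <= 1 by apply: le_trans yr1; rewrite lerD2l.
have xr : x2 + r <= 1 by apply: le_trans xr2; rewrite lerD2l.
have pos y : y1 <= y <= y1 + r -> 0 < dev (pt x1 y) /\ 2^-1 <= test T (pt x1 y).
  move=> /andP[hy1 hy2]; have m1 : m < dev (pt x1 y).
    apply: H1; first by rewrite lexx lerDl ltW.
    by rewrite hy1 (le_trans hy2)// lerD2l.
  have dy0 := lt_trans m0 m1; split=> //.
  have := HT2 T TT2 (pt x1 y); rewrite (_ : 1 - 2^-1 = 2^-1 :> R); last by field.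
  by apply; rewrite gtr0_norm// ltW.
have neg x : x2 <= x <= x2 + r -> dev (pt x y2) <= 0.
  move=> /andP[hx1 hx2]; rewrite -oppr_ge0; apply/ltW/H2.
    by rewrite hx1 (le_trans hx2)// lerD2l.
  by rewrite lexx lerDl ltW.
have := sign_change_cost (C1_test T0) cd (fun p => @logtest_eq0 (log_offset Y T) T p)
  (le01 _ x10 x11) y10 x20 (le01 _ y20 y21) r0 yr xr pos neg.
exact: (variation_too_small r0 (HT1 T TT1 0) (HT1 T TT1 1)).
Qed.

(** The test function is close to 1 on a segment where dev does not vanish, and
[int2_lower_bound] spreads this to the whole square at the cost of its energy. *)
Lemma small_deficit p e : dev p != 0 -> 0 < e -> exists2 T0, 1 <= T0 &
  forall T, T0 <= T -> int2 (fun p => 1 - test T p) <= e.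
Proof.
have cn : continuous (fun p => `|dev p|) := continuous_norm (C0_continuous C0_dev).
have [x1 [y1 [x101 y101 E1]]] := reduce_mod1 p.
rewrite -(E1 _ biperiodic_dev) -normr_gt0 => dp e0.
set m := `|dev (pt x1 y1)| / 2.
have m0 : 0 < m by rewrite divr_gt0.
have [r [r0 xr yr H]] := @near_square _ (fun p => `|dev p|) x1 y1 m cn x101 y101 ltac:(rewrite /m; lra).
have e30 : 0 < e / 3 by rewrite divr_gt0.
have er0 : 0 < r * (e / 3) by rewrite mulr_gt0.
have [T1 T11 HT1] := small_gradient e30.
have [T2 T21 HT2] := @test_near1 (e / 3) m e30 m0.
have [T3 T31 HT3] := small_gradient er0.
exists (Num.max T1 (Num.max T2 T3)); first by rewrite le_max T11.
move=> T; rewrite !ge_max => /and3P[TT1 TT2 TT3].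
have T0 : 0 < T by lra.
move: x101 y101 => /andP[? ?] /andP[? ?].
have x101 : 0 <= x1 <= 1 by apply/andP; split; lra.
have := @int2_lower_bound R (test T) (C1_test T0) x1 y1 r (1 - e / 3) x101 _ r0 yr.
move=> /(_ _ _) H4; have {}H4 : 1 - e / 3 - int2 (fun p => `|partial 0 (test T) p|) / r -
    int2 (fun p => `|partial 1 (test T) p|) <= int2 (test T).
  apply: H4 => // y hy; apply: HT2 => //; apply/ltW/H => //.
  by rewrite lexx lerDl ltW.
have g0 := HT3 T TT3 0; have g1 := HT1 T TT1 1.
have {}g0 : int2 (fun p => `|partial 0 (test T) p|) / r <= e / 3.
  by rewrite ler_pdivrMr// mulrC.
rewrite int2B; last 2 first.
- by move=> ?; exact: cst_continuous.
- exact: C0_continuous (class_C_pred (C1_test T0)).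
rewrite int2_cst; exact: (deficit_sum H4 g0 g1).
Qed.

End scaled.

End system.

(** * A periodic logarithmic bump *)

Section bump.
Variable R : realType.
Local Notation plane := 'rV[R]_2.
Variables (x0 y0 e : R).
Hypothesis e0 : 0 < e.

Lemma is_derive_sin_pi (a t : R) :
  is_derive t 1 (fun u => sin (pi * (u - a))) (pi * cos (pi * (t - a))).
Proof.
have H1 : is_derive t (1 : R) (pi \*: (id - cst a)) (pi *: (1 - 0)).
  exact: is_deriveZ.
have H2 := @is_derive1_comp R sin (pi \*: (id - cst a)) t _ _ (is_derive_sin _) H1.
by apply: (is_derive_eq H2); rewrite subr0 [_ *: _]mulr1 mulrC.
Qed.

Lemma is_derive_cos_pi (a t : R) :
  is_derive t 1 (fun u => cos (pi * (u - a))) (- pi * sin (pi * (t - a))).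
Proof.
have H1 : is_derive t (1 : R) (pi \*: (id - cst a)) (pi *: (1 - 0)).
  exact: is_deriveZ.
have H2 := @is_derive1_comp R cos (pi \*: (id - cst a)) t _ _ (is_derive_cos _) H1.
by apply: (is_derive_eq H2); rewrite subr0 [_ *: _]mulr1 !mulNr mulrC.
Qed.

Definition bump_center (j : 'I_2) := if j == 0 then x0 else y0.
Definition sin_at j (p : plane) := sin (pi * (p 0 j - bump_center j)).
Definition cos_at j (p : plane) := cos (pi * (p 0 j - bump_center j)).

Lemma continuous_sin_pi (a : R) : continuous (fun u => sin (pi * (u - a))).
Proof.
move=> t; apply/differentiable_continuous/derivable1_diffP.
by have H := is_derive_sin_pi a t; exact: ex_derive.
Qed.

Lemma continuous_cos_pi (a : R) : continuous (fun u => cos (pi * (u - a))).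
Proof.
move=> t; apply/differentiable_continuous/derivable1_diffP.
by have H := is_derive_cos_pi a t; exact: ex_derive.
Qed.

Lemma C1_sin_at j : class_C setT 1 (sin_at j).
Proof.
apply: (class_C1_comp1 (is_derive_sin_pi (bump_center j)) _ (C1_coord R j)).
exact: (continuousM1 (@continuous_cst1 R pi) (@continuous_cos_pi _)).
Qed.

Lemma C1_cos_at j : class_C setT 1 (cos_at j).
Proof.
apply: (class_C1_comp1 (is_derive_cos_pi (bump_center j)) _ (C1_coord R j)).
exact: (continuousM1 (@continuous_cst1 R (- pi)) (@continuous_sin_pi _)).
Qed.

Lemma partial_sin_at i j p : partial i (sin_at j) p = pi * cos_at j p * (j == i)%:R.
Proof.
by rewrite (partial_comp1E p i (is_derive_sin_pi (bump_center j)) (C1_coord R j)) (coord_derive p i j).2.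
Qed.

Lemma partial_cos_at i j p : partial i (cos_at j) p = - pi * sin_at j p * (j == i)%:R.
Proof.
by rewrite (partial_comp1E p i (is_derive_cos_pi (bump_center j)) (C1_coord R j)) (coord_derive p i j).2.
Qed.

(** The periodic substitute for |p - p0|^2 + e, where p0 = (x0, y0). *)
Definition bump_arg p := sin_at 0 p * sin_at 0 p + sin_at 1 p * sin_at 1 p + e.

Lemma C1_bump_arg : class_C setT 1 bump_arg.
Proof.
apply: (class_CD openT _ (class_C_cst openT 1 e)).
by apply: (class_CD openT); apply: (class_CM openT); exact: C1_sin_at.
Qed.

Lemma bump_arg_ge p : e <= bump_arg p.
Proof. by rewrite /bump_arg lerDr addr_ge0// -expr2 sqr_ge0. Qed.

Lemma bump_arg_gt0 p : 0 < bump_arg p. Proof. exact: lt_le_trans (bump_arg_ge p). Qed.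

Lemma bump_arg_neq0 p : bump_arg p != 0. Proof. by rewrite lt0r_neq0// bump_arg_gt0. Qed.

Lemma sin_at_sq_le1 j p : sin_at j p * sin_at j p <= 1.
Proof. by rewrite /sin_at -expr2 sin2cos2 lerBlDr lerDl sqr_ge0. Qed.

Lemma cos_at_sq j p : cos_at j p * cos_at j p = 1 - sin_at j p * sin_at j p.
Proof. by rewrite /cos_at /sin_at -!expr2 cos2sin2. Qed.

Lemma partial_bump_arg i p : partial i bump_arg p = 2 * pi * sin_at i p * cos_at i p.
Proof.
have C2 j : class_C setT 1 (fun p => sin_at j p * sin_at j p).
  by apply: (class_CM openT); exact: C1_sin_at.
rewrite /bump_arg (partialDE p i (class_CD openT (C2 0) (C2 1)) (class_C_cst openT 1 e)).
rewrite (partialDE p i (C2 0) (C2 1)) partial_cst.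
rewrite !(partialME p i (C1_sin_at _) (C1_sin_at _)) !partial_sin_at.
by case: (ord2P i) => -> /=; rewrite !(mulr1, mulr0, add0r, addr0); ring.
Qed.

Definition bump_grad i p := 2 * pi * sin_at i p * cos_at i p * (bump_arg p)^-1.
Definition bump_log p := ln (bump_arg p).

Lemma C1_bump_grad i : class_C setT 1 (bump_grad i).
Proof.
apply: (class_CM openT); last first.
  by apply: (class_CV openT) => [p _|]; [exact: bump_arg_neq0|exact: C1_bump_arg].
apply: (class_CM openT); last exact: C1_cos_at.
by apply: (class_CM openT); [exact: class_C_cst openT _ _|exact: C1_sin_at].
Qed.

Lemma bump_log_derive i p : derivable bump_log p (delta_mx 0 i) /\ partial i bump_log p = bump_grad i p.
Proof.
have H := is_derive1_ln (bump_arg_gt0 p).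
have dln : derivable (@ln R) (bump_arg p) 1 by exact: ex_derive.
have [d E] := partial_comp1 dln (class_C_derivable (i := i) C1_bump_arg (I : [set: plane] p)).
split; first exact: d.
have -> : partial i bump_log p = 'D_1 (@ln R) (bump_arg p) * partial i bump_arg p by exact: E.
by rewrite (@derive_val _ _ _ _ _ _ _ H) partial_bump_arg /bump_grad mulrC.
Qed.

Lemma C1_bump_log : class_C setT 1 bump_log.
Proof.
have d i p := (bump_log_derive i p).1.
split=> [p _|/= i].
  apply: (@continuous_comp _ _ _ bump_arg (@ln R)); first exact: C0_continuous (class_C_pred C1_bump_arg) p.
  by apply: continuous_ln; exact: bump_arg_gt0.
split=> [p _|]; first exact: d.
change (class_C setT 0 (partial i bump_log)).
apply: (@class_C_ext _ _ openT _ (bump_grad i)); last exact: class_C_pred (C1_bump_grad i).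
by move=> p _; rewrite (bump_log_derive i p).2.
Qed.

Definition bump_lap p := partial 0 (bump_grad 0) p + partial 1 (bump_grad 1) p.

Lemma partial_gr i p : partial i (bump_grad i) p =
  2 * pi * pi * (1 - 2 * (sin_at i p * sin_at i p)) * (bump_arg p)^-1 -
  4 * pi * pi * (sin_at i p * sin_at i p) * (1 - sin_at i p * sin_at i p) * ((bump_arg p)^-1 * (bump_arg p)^-1).
Proof.
have Cs : class_C setT 1 (fun p => 2 * pi * sin_at i p).
  by apply: (class_CM openT); [exact: class_C_cst openT _ _|exact: C1_sin_at].
have Csc : class_C setT 1 (fun p => 2 * pi * sin_at i p * cos_at i p).
  by apply: (class_CM openT) Cs _; exact: C1_cos_at.
have Cv : class_C setT 1 (fun p => (bump_arg p)^-1).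
  by apply: (class_CV openT) => [q _|]; [exact: bump_arg_neq0|exact: C1_bump_arg].
rewrite /bump_grad (partialME p i Csc Cv) (partialME p i Cs (C1_cos_at i)).
rewrite (partialME p i (class_C_cst openT 1 (2 * pi)) (C1_sin_at i)) partial_cst.
rewrite (partialVE i C1_bump_arg (bump_arg_neq0 p)).
rewrite partial_sin_at partial_cos_at partial_bump_arg eqxx /=.
have := cos_at_sq i p; move: (sin_at i p) (cos_at i p) ((bump_arg p)^-1) => s k w E.
have -> : 2 * pi * s * k * (- w * w * (2 * pi * s * k)) =
   - 4 * pi * pi * (s * s) * (k * k) * (w * w) by ring.
have -> : (2 * pi * s * (- pi * s * 1) + k * (2 * pi * (pi * k * 1) + s * 0)) =
   2 * pi * pi * (k * k - s * s) by ring.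
by rewrite E; ring.
Qed.

Lemma bump_lapE p : let q := (sin_at 0 p * sin_at 0 p) * (sin_at 1 p * sin_at 1 p) in
  bump_lap p = 4 * pi * pi * (e * (1 - (bump_arg p - e)) - 2 * q) * ((bump_arg p)^-1 * (bump_arg p)^-1).
Proof.
rewrite /= /bump_lap !partial_gr; have := bump_arg_neq0 p.
have : bump_arg p = sin_at 0 p * sin_at 0 p + sin_at 1 p * sin_at 1 p + e by [].
move: (bump_arg p) (sin_at 0 p * sin_at 0 p) (sin_at 1 p * sin_at 1 p) => s u v E s0.
have -> : 2 * pi * pi * (1 - 2 * u) * s^-1 = 2 * pi * pi * (1 - 2 * u) * s * (s^-1 * s^-1).
  by field.
have -> : 2 * pi * pi * (1 - 2 * v) * s^-1 = 2 * pi * pi * (1 - 2 * v) * s * (s^-1 * s^-1).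
  by field.
by move: (s^-1 * s^-1) => w; rewrite E; ring.
Qed.

(** In the plane ln(|p|^2 + e) is subharmonic; periodicity only costs a bounded
negative part, uniformly in e. *)
Lemma bump_lap_ge p : - (3 * pi * pi) <= bump_lap p.
Proof.
rewrite bump_lapE; have sp := bump_arg_gt0 p; have pp := pi_gt0 R.
have : bump_arg p = sin_at 0 p * sin_at 0 p + sin_at 1 p * sin_at 1 p + e by [].
have : 0 <= sin_at 0 p * sin_at 0 p by rewrite -expr2 sqr_ge0.
have : 0 <= sin_at 1 p * sin_at 1 p by rewrite -expr2 sqr_ge0.
move: (bump_arg p) (sin_at 0 p * sin_at 0 p) (sin_at 1 p * sin_at 1 p) sp => s u v s0 v0 u0 E.
have -> : - (3 * pi * pi) = 4 * pi * pi * (- (3 / 4) * (s * s)) * (s^-1 * s^-1).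
  by field; rewrite lt0r_neq0.
rewrite ler_pM2r ?mulr_gt0 ?invr_gt0//.
have p4 : 0 < 4 * pi * pi :> R by rewrite !mulr_gt0.
rewrite ler_pM2l// E -subr_ge0.
have -> : e * (1 - (u + v + e - e)) - 2 * (u * v) - - (3 / 4) * ((u + v + e) * (u + v + e)) =
   e + (4^-1) * (u + v - e) ^+ 2 + 2^-1 * (u - v) ^+ 2 + 2^-1 * e * e + e * (u + v) by field.
have h2 := sqr_ge0 (u + v - e); have h3 := sqr_ge0 (u - v).
have h4 : 0 <= e * e by rewrite mulr_ge0 // ltW.
have h5 : 0 <= e * (u + v) by rewrite mulr_ge0 ?addr_ge0// ltW.
have h6 : 0 <= e by exact: ltW.
move: h2 h3 h4 h5 h6; rewrite -[2^-1 * e * e]mulrA.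
by move: (e * e) (e * (u + v)) ((u + v - e) ^+ 2) ((u - v) ^+ 2) => *; lra.
Qed.

Lemma bump_lap_core p : bump_arg p <= e + e -> e <= 3^-1 -> pi * pi / (2 * e) <= bump_lap p.
Proof.
rewrite bump_lapE; have sp := bump_arg_gt0 p; have pp := pi_gt0 R.
have : bump_arg p = sin_at 0 p * sin_at 0 p + sin_at 1 p * sin_at 1 p + e by [].
have : 0 <= sin_at 0 p * sin_at 0 p by rewrite -expr2 sqr_ge0.
have : 0 <= sin_at 1 p * sin_at 1 p by rewrite -expr2 sqr_ge0.
move: (bump_arg p) (sin_at 0 p * sin_at 0 p) (sin_at 1 p * sin_at 1 p) sp => s u v s0 v0 u0 E s2 e3.
have p4 : 0 < 4 * pi * pi :> R by rewrite !mulr_gt0.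
have num : e / 2 <= e * (1 - (s - e)) - 2 * (u * v).
  have uv : u + v <= e by lra.
  have h1 : (u + v) * (u + v) <= e * e by rewrite ler_pM// addr_ge0.
  have h2 : e * (u + v) <= e * e by rewrite ler_pM2l.
  have h3 : e * e <= e * 3^-1 by rewrite ler_pM2l.
  have h4 : 0 <= (u - v) ^+ 2 by exact: sqr_ge0.
  have h5 : 4 * (u * v) = (u + v) * (u + v) - (u - v) ^+ 2 by ring.
  have -> : e * (1 - (s - e)) = e - e * (u + v) by rewrite E; ring.
  lra.
apply: (@le_trans _ _ (4 * pi * pi * (e / 2) * (s^-1 * s^-1))).
  have ss : s * s <= 4 * (e * e).
    rewrite (_ : 4 * (e * e) = (e + e) * (e + e)); last by ring.
    by rewrite ler_pM// ltW.
  rewrite -invfM ler_pdivlMr ?mulr_gt0//.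
  rewrite mulrAC ler_pdivrMr ?mulr_gt0//.
  have -> : 4 * pi * pi * (e / 2) * (2 * e) = pi * pi * (4 * (e * e)) by field.
  by rewrite ler_pM2l// mulr_gt0.
by rewrite ler_pM2r ?mulr_gt0 ?invr_gt0// ler_pM2l.
Qed.

(** The factors sin and cos both change sign after one period of length 1, so that
their product does not. *)
Lemma bump_edge0 (y : R) : bump_grad 0 (pt 1 y) = bump_grad 0 (pt 0 y) /\ bump_arg (pt 1 y) = bump_arg (pt 0 y).
Proof.
have E1 : pi * (1 - x0) = pi * (0 - x0) + pi by ring.
have s1 : sin_at 0 (pt 1 y) = - sin_at 0 (pt 0 y).
  by rewrite /sin_at !mxE /bump_center /= E1 sinDpi.
have c1 : cos_at 0 (pt 1 y) = - cos_at 0 (pt 0 y).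
  by rewrite /cos_at !mxE /bump_center /= E1 cosDpi.
have s2 : sin_at 1 (pt 1 y) = sin_at 1 (pt 0 y) by rewrite /sin_at !mxE.
have q1 : bump_arg (pt 1 y) = bump_arg (pt 0 y) by rewrite /bump_arg s1 s2 mulrNN.
split=> //; rewrite /bump_grad q1 s1 c1.
by move: (sin_at _ _) (cos_at _ _) ((bump_arg _)^-1) => *; ring.
Qed.

Lemma bump_edge1 (x : R) : bump_grad 1 (pt x 1) = bump_grad 1 (pt x 0) /\ bump_arg (pt x 1) = bump_arg (pt x 0).
Proof.
have E1 : pi * (1 - y0) = pi * (0 - y0) + pi by ring.
have s1 : sin_at 1 (pt x 1) = - sin_at 1 (pt x 0).
  by rewrite /sin_at !mxE /bump_center /= E1 sinDpi.
have c1 : cos_at 1 (pt x 1) = - cos_at 1 (pt x 0).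
  by rewrite /cos_at !mxE /bump_center /= E1 cosDpi.
have s2 : sin_at 0 (pt x 1) = sin_at 0 (pt x 0) by rewrite /sin_at !mxE.
have q1 : bump_arg (pt x 1) = bump_arg (pt x 0) by rewrite /bump_arg s1 s2 mulrNN.
split=> //; rewrite /bump_grad q1 s1 c1.
by move: (sin_at _ _) (cos_at _ _) ((bump_arg _)^-1) => *; ring.
Qed.

Lemma C0_bump_lap : class_C setT 0 bump_lap.
Proof. by apply: (class_CD openT); apply: class_C_partial; exact: C1_bump_grad. Qed.

(** Integration by parts; there is no boundary term as F and the bump agree on
opposite edges. *)
Lemma green_bump (F : plane -> R) : class_C setT 1 F ->
  (forall y, F (pt 1 y) = F (pt 0 y)) -> (forall x, F (pt x 1) = F (pt x 0)) ->
  int2 (fun p => F p * bump_lap p) =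
  - int2 (fun p => partial 0 F p * bump_grad 0 p + partial 1 F p * bump_grad 1 p).
Proof.
move=> CF F0 F1.
have CX i : class_C setT 1 (fun p => F p * bump_grad i p) by exact: class_CM openT _ _ _ CF (C1_bump_grad i).
have I0 : int2 (partial 0 (fun p => F p * bump_grad 0 p)) = 0.
  apply: int2_partial0 => [p||y].
  - exact: class_C_derivable (CX 0) I.
  - exact: C0_continuous (class_C_partial 0 (CX 0)).
  - by rewrite F0 (bump_edge0 y).1.
have I1 : int2 (partial 1 (fun p => F p * bump_grad 1 p)) = 0.
  apply: int2_partial1 => [p||x].
  - exact: class_C_derivable (CX 1) I.
  - exact: C0_continuous (class_C_partial 1 (CX 1)).
  - by rewrite F1 (bump_edge1 x).1.
have C1 : class_C setT 0 (fun p => F p * bump_lap p).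
  exact: (class_CM openT (class_C_pred CF) C0_bump_lap).
have C2 : class_C setT 0 (fun p => partial 0 F p * bump_grad 0 p + partial 1 F p * bump_grad 1 p).
  apply: (class_CD openT).
    exact: (class_CM openT (class_C_partial 0 CF) (class_C_pred (C1_bump_grad 0))).
  exact: (class_CM openT (class_C_partial 1 CF) (class_C_pred (C1_bump_grad 1))).
apply/eqP; rewrite -addr_eq0 -(int2D (C0_continuous C1) (C0_continuous C2)).
rewrite -[X in _ == X]addr0 -{1}I0 -I1 -int2D.
- apply/eqP; congr int2; apply/funext => p.
  rewrite !(partialME p _ CF (C1_bump_grad _)) /bump_lap.
  by move: (F p) (partial 0 (bump_grad 0) p) (partial 1 (bump_grad 1) p) (partial 0 F p) (partial 1 F p)
    (bump_grad 0 p) (bump_grad 1 p) => *; ring.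
- exact: C0_continuous (class_C_partial 0 (CX 0)).
- exact: C0_continuous (class_C_partial 1 (CX 1)).
Qed.

Lemma int2_bump_lap : int2 bump_lap = 0.
Proof.
have := green_bump (class_C_cst openT 1 1) (fun=> erefl) (fun=> erefl).
have -> : (fun p => 1 * bump_lap p) = bump_lap by apply/funext => p; rewrite mul1r.
move=> ->; have -> : (fun p => partial 0 (fun=> 1) p * bump_grad 0 p + partial 1 (fun=> 1) p * bump_grad 1 p)
    = (fun=> 0) by apply/funext => p; rewrite !partial_cst !mul0r addr0.
by rewrite int2_cst oppr0.
Qed.

(** By [green_bump] applied to ln 3 minus the bump, the energy is the integral of
that function, which is at most ln(3/e), against the Laplacian, whose integral is
0 and which is at least -3 pi^2. *)
Lemma bump_grad_energy : e <= 1 ->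
  int2 (fun p => bump_grad 0 p * bump_grad 0 p + bump_grad 1 p * bump_grad 1 p) <= 3 * pi * pi * ln (3 / e).
Proof.
move=> e1; pose k : R := ln 3; set c3 := 3 * pi * pi.
have pp := pi_gt0 R; have c30 : 0 < c3 by rewrite !mulr_gt0.
have lgk p : bump_log p <= k.
  rewrite ler_ln ?posrE ?bump_arg_gt0// /bump_arg; have := sin_at_sq_le1 0 p; have := sin_at_sq_le1 1 p; lra.
have lge p : ln e <= bump_log p by rewrite ler_ln ?posrE ?bump_arg_gt0// bump_arg_ge.
have CF : class_C setT 1 (fun p => k - bump_log p).
  exact: (class_CB openT (class_C_cst openT 1 k) C1_bump_log).
have dF i p : partial i (fun p => k - bump_log p) p = - bump_grad i p.
  have -> : (fun p => k - bump_log p) = (fun p => k + (-1) * bump_log p).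
    by apply/funext => q; rewrite mulN1r.
  rewrite (partialDE p i (class_C_cst openT 1 k) (class_CM openT (class_C_cst openT 1 (-1)) C1_bump_log)).
  rewrite (partialME p i (class_C_cst openT 1 (-1)) C1_bump_log) !partial_cst mulr0 addr0 add0r mulN1r.
  by rewrite (bump_log_derive i p).2.
have G : int2 (fun p => (k - bump_log p) * bump_lap p) =
    int2 (fun p => bump_grad 0 p * bump_grad 0 p + bump_grad 1 p * bump_grad 1 p).
  rewrite (green_bump CF); last 2 first.
  - by move=> y; rewrite /bump_log (bump_edge0 y).2.
  - by move=> x; rewrite /bump_log (bump_edge1 x).2.
  rewrite -mulN1r -int2Z.
    congr int2; apply/funext => p; rewrite !dF.
    by move: (bump_grad 0 p) (bump_grad 1 p) => u v; ring.
  apply: C0_continuous; apply: (class_CD openT); apply: (class_CM openT);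
    do ?[exact: class_C_pred (C1_bump_grad _)|exact: class_C_partial].
rewrite -G ln_div ?posrE// -/k.
have Cl : class_C setT 0 (fun p => bump_lap p + c3) := class_CD openT C0_bump_lap (class_C_cst openT 0 c3).
have : int2 (fun p => (k - bump_log p) * bump_lap p) <= int2 (fun p => (k - ln e) * (bump_lap p + c3)).
  apply: le_int2.
  - exact: C0_continuous (class_CM openT (class_C_pred CF) C0_bump_lap).
  - exact: C0_continuous (class_CM openT (class_C_cst openT 0 _) Cl).
  move=> p; have h1 := bump_lap_ge p; have h2 := lgk p; have h3 := lge p.
  have h4 : (k - bump_log p) * (bump_lap p + c3) <= (k - ln e) * (bump_lap p + c3).
    apply: ler_wpM2r; last by rewrite lerB.
    by rewrite -lerBlDr sub0r; exact: h1.
  have h5 : 0 <= (k - bump_log p) * c3 by rewrite mulr_ge0 ?subr_ge0// ltW.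
  by rewrite mulrDr in h4 *; lra.
rewrite (int2Z _ (C0_continuous Cl)) int2D; last 2 first.
- exact: C0_continuous C0_bump_lap.
- by move=> p; exact: cst_continuous.
by rewrite int2_bump_lap int2_cst add0r mulrC.
Qed.

End bump.

(** * The test function against the bump: no zero when the total source vanishes *)

Section strict.
Variable R : realType.
Local Notation plane := 'rV[R]_2.
Variables (a b c : R) (K rho : plane -> R) (A : 'I_2 -> 'I_2 -> plane -> R).
Variable P : 'I_2 -> plane -> R.
Hypothesis Hs : ricci_system a b c K rho A P.

(** The numerical contradiction behind [no_zero]: s1 and s2 are the energies of the
test function and of the bump, d is the deficit, l1 their pairing, and T is large
while e is a bound for the deficit. *)
Lemma final_arith (c3 k2 M B e T d s1 s2 l1 : R) :
  0 < c3 -> k2 = 16 * c3 -> 0 < M -> 0 <= B -> 0 < T -> 64 * k2 * M * B <= T ->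
  e * (64 * (c3 + k2 * M * B + 1)) <= 1 -> 0 <= d <= e ->
  s1 <= 2 * M / T ^+ 2 * (T * (B * d) + B) -> s2 <= c3 * T ->
  l1 <= (k2 * T / 2) * s1 + (2 * k2 * T)^-1 * s2 ->
  8^-1 <= l1 + c3 * d -> False.
Proof.
move=> c30 k2E M0 B0 T0 TkMB he /andP[d0 de] hs1 hs2 hl h8.
have k20 : 0 < k2 by lra.
have q0 : 0 <= k2 * M * B by rewrite !mulr_ge0// ltW.
have h1 : k2 * T / 2 * s1 <= k2 * M * B * d + k2 * M * B / T.
  apply: (@le_trans _ _ (k2 * T / 2 * (2 * M / T ^+ 2 * (T * (B * d) + B)))).
    by rewrite ler_pM2l// divr_gt0// mulr_gt0.
  by rewrite le_eqVlt; apply/orP; left; apply/eqP; field; rewrite lt0r_neq0.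
have h2 : (2 * k2 * T)^-1 * s2 <= 32^-1.
  apply: (@le_trans _ _ ((2 * k2 * T)^-1 * (c3 * T))).
    by rewrite ler_pM2l// invr_gt0 !mulr_gt0.
  rewrite k2E le_eqVlt; apply/orP; left; apply/eqP; field.
  by rewrite !lt0r_neq0.
have h3 : k2 * M * B / T <= 64^-1.
  rewrite ler_pdivrMr// -(@ler_pM2l _ 64)// !mulrA divff ?mul1r//; lra.
have h4 : k2 * M * B * d + c3 * d <= 64^-1.
  rewrite -mulrDl.
  have p0 : 0 < c3 + k2 * M * B + 1 by lra.
  have de2 : (k2 * M * B + c3) * d <= (c3 + k2 * M * B + 1) * e.
    apply: ler_pM => //; first by lra.
    by lra.
  apply: le_trans de2 _.
  rewrite -(@ler_pM2l _ 64)// divff// mulrC; apply: le_trans he.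
  by rewrite le_eqVlt; apply/orP; left; apply/eqP; ring.
move: h1 h2 h3 h4 hl h8.
move: (k2 * T / 2 * s1) ((2 * k2 * T)^-1 * s2) (k2 * M * B / T) (k2 * M * B * d) (c3 * d).
by move=> *; lra.
Qed.

Lemma sum_ge_terms (u v w x y : R) : 0 < u -> 0 < v -> 0 < w -> 0 < x -> 0 <= y ->
  let T := u + 4 + v + w + x + y in
  [/\ u <= T, 4 <= T & v <= T] /\ [/\ w <= T, x <= T & y <= T].
Proof. by move=> u0 v0 w0 x0 y0 /=; split; split; lra. Qed.

(** Half of the lower bound of the bump Laplacian times the area of a square of side r:
the powers of r cancel. *)
Lemma eighth_square (w r : R) : w != 0 -> r != 0 ->
  8^-1 = 2^-1 * (w * w / (2 * (2 * (w * w) * (r * r)))) * r * r.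
Proof. by move=> wn rn; field; rewrite ?wn ?rn. Qed.

Lemma log_eps (r T : R) : 0 < r -> r <= 1 -> (r * r) * (r * r) = expR (- T) ->
  ln (3 / (2 * (pi * pi) * (r * r))) <= T.
Proof.
move=> r0 r1 r4; have pp := pi_gt0 R; have p2 := pi_ge2 R.
have rr0 : 0 < r * r by rewrite mulr_gt0.
have ep0 : 0 < 2 * (pi * pi) * (r * r) by rewrite !mulr_gt0.
rewrite -[leRHS]expRK ler_ln ?posrE ?divr_gt0 ?expR_gt0//.
rewrite ler_pdivrMr//.
have -> : expR T = ((r * r) * (r * r))^-1 by rewrite r4 expRN invrK.
rewrite mulrC invfM.
have -> : 2 * (pi * pi) * (r * r) * ((r * r)^-1 * (r * r)^-1) = 2 * (pi * pi) * (r * r)^-1.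
  by rewrite -[LHS]mulrA; congr (_ * _); rewrite mulrA divff ?mul1r// gt_eqF.
have h1 : 1 <= (r * r)^-1 by rewrite invf_ge1// -[1]mulr1 ler_pM// ltW.
have h2 : 4 <= pi * pi :> R.
  have -> : 4 = 2 * 2 :> R by ring.
  by rewrite ler_pM.
apply: (@le_trans _ _ (2 * (pi * pi))).
  by apply: (@le_trans _ _ (2 * 4)); [rewrite -natrM ler_nat|rewrite ler_pM2l].
by rewrite ler_peMr// mulr_ge0// mulr_ge0// ltW.
Qed.

(** Young's inequality with weight k after integration by parts; [no_zero] takes k of
order T, which balances an energy o(1/T) against one of order T. *)
Lemma green_young x0 y0 (ep : R) (ep0 : 0 < ep) (L : plane -> R) (k : R) :
  class_C setT 1 L -> biperiodic L -> 0 < k ->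
  int2 (fun p => (1 - L p) * bump_lap x0 y0 ep p) <=
  k / 2 * int2 (fun p => partial 0 L p ^+ 2 + partial 1 L p ^+ 2) +
  (2 * k)^-1 * int2 (fun p => bump_grad x0 y0 ep 0 p * bump_grad x0 y0 ep 0 p
                              + bump_grad x0 y0 ep 1 p * bump_grad x0 y0 ep 1 p).
Proof.
move=> CL perL k0; pose G i := bump_grad x0 y0 ep i.
have CGi i : class_C setT 0 (G i) := class_C_pred (C1_bump_grad x0 y0 ep0 i).
have CdL i : class_C setT 0 (partial i L) := class_C_partial i CL.
pose E1 p := partial 0 L p ^+ 2 + partial 1 L p ^+ 2.
pose E2 p := G 0 p * G 0 p + G 1 p * G 1 p.
have C0sq i : class_C setT 0 (fun p => partial i L p ^+ 2) := class_CM openT (CdL i) (CdL i).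
have CE1 : class_C setT 0 E1 := class_CD openT (C0sq 0) (C0sq 1).
have CE2 : class_C setT 0 E2.
  exact: (class_CD openT (class_CM openT (CGi 0) (CGi 0)) (class_CM openT (CGi 1) (CGi 1))).
have C1L : class_C setT 1 (fun p => 1 - L p) := class_CB openT (class_C_cst openT 1 1) CL.
rewrite -/(E1) -/(E2) (green_bump x0 y0 ep0 C1L); last 2 first.
- by move=> y; rewrite (periodic_edge0 y perL).
- by move=> x; rewrite (periodic_edge1 x perL).
have dF i p : partial i (fun p => 1 - L p) p = - partial i L p.
  have -> : (fun p => 1 - L p) = (fun p => 1 + (-1) * L p).
    by apply/funext => u; rewrite mulN1r.
  rewrite (partialDE p i (class_C_cst openT 1 1) (class_CM openT (class_C_cst openT 1 (-1)) CL)).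
  by rewrite (partialME p i (class_C_cst openT 1 (-1)) CL) !partial_cst mulr0 addr0 add0r mulN1r.
have Ca : class_C setT 0 (fun p => partial 0 L p * G 0 p + partial 1 L p * G 1 p).
  exact: (class_CD openT (class_CM openT (CdL 0) (CGi 0)) (class_CM openT (CdL 1) (CGi 1))).
have -> : (fun p => partial 0 (fun p => 1 - L p) p * bump_grad x0 y0 ep 0 p +
    partial 1 (fun p => 1 - L p) p * bump_grad x0 y0 ep 1 p) =
    (fun p => -1 * (partial 0 L p * G 0 p + partial 1 L p * G 1 p)).
  apply/funext => p; rewrite !dF /G.
  by move: (bump_grad x0 y0 ep 0 p) (bump_grad x0 y0 ep 1 p) (partial 0 L p) (partial 1 L p) => *; ring.
rewrite (int2Z _ (C0_continuous Ca)) mulN1r opprK.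
rewrite -(int2Z _ (C0_continuous CE1)) -(int2Z _ (C0_continuous CE2)).
have Cb1 : class_C setT 0 (fun p => k / 2 * E1 p) := class_CM openT (class_C_cst openT 0 _) CE1.
have Cb2 : class_C setT 0 (fun p => (2 * k)^-1 * E2 p) := class_CM openT (class_C_cst openT 0 _) CE2.
rewrite -(int2D (C0_continuous Cb1) (C0_continuous Cb2)).
apply: le_int2; [exact: C0_continuous|exact: C0_continuous (class_CD openT Cb1 Cb2)|].
move=> p; rewrite /E1 /E2.
move: (partial 0 L p) (partial 1 L p) (G 0 p) (G 1 p) => u v g h; rewrite -subr_ge0.
have -> : k / 2 * (u ^+ 2 + v ^+ 2) + (2 * k)^-1 * (g * g + h * h) - (u * g + v * h) =
  (2 * k)^-1 * ((k * u - g) ^+ 2 + (k * v - h) ^+ 2) by field; rewrite lt0r_neq0.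
by rewrite mulr_ge0 ?invr_ge0 ?addr_ge0 ?sqr_ge0// mulr_ge0// ltW.
Qed.

(** See the introduction: the integral of (1 - test) times the bump Laplacian, shifted
by 3 pi^2 to be nonnegative, is at least 1/8 because of the square at the zero, but
smaller for large T by [green_young]. *)
Lemma no_zero x0 y0 q : 0 <= x0 < 1 -> 0 <= y0 < 1 -> int2 (source a b K rho) = 0 ->
  dev c K q != 0 -> dev c K (pt x0 y0) = 0 ->
  (forall i, partial i K (pt x0 y0) = 0) -> False.
Proof.
move=> /andP[x00 x01] /andP[y00 y01] I0 qn0 d0 dK0.
have cd : class_C setT 0 (dev c K) := C0_dev Hs.
have C2d : class_C setT 2 (dev c K).
  exact: (class_CB openT (rsK Hs) (class_C_cst openT 2 c)).
have [Y1 Y10 HY1] := bounded_periodic (C0_continuous cd) (biperiodic_dev Hs).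
have [B B0 HB] := bounded_periodic (C0_continuous (C0_source Hs)) (biperiodic_source Hs).
have [M M0 HM'] := bounded_periodic (C0_continuous (C0_trace_coef Hs)) (biperiodic_trace_coef Hs).
have HM p : trace_coef A p <= M by apply: le_trans (HM' p); exact: ler_norm.
have ddev0 i : partial i (dev c K) (pt x0 y0) = 0 by rewrite (partial_dev Hs).
have [C C0 HC] := quadratic_zero C2d (biperiodic_dev Hs) d0 ddev0.
(* Y bounds dev everywhere and also its quadratic growth at the zero. *)
pose Y := Y1 + C.
have Y0 : 0 < Y by rewrite addr_gt0.
have HY p : `|dev c K p| <= Y by apply: le_trans (HY1 p) _; rewrite lerDl ltW.
have pp := pi_gt0 R; have p2 := pi_ge2 R.
pose c3 : R := 3 * pi * pi; have c30 : 0 < c3 by rewrite !mulr_gt0.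
pose k2 : R := 16 * c3; have k20 : 0 < k2 by rewrite mulr_gt0.
have B0' := ltW B0.
have w0 : 0 < 64 * (c3 + k2 * M * B + 1).
  by rewrite mulr_gt0// ltr_wpDl// addr_ge0 ?mulr_ge0// ltW.
pose e := (64 * (c3 + k2 * M * B + 1))^-1.
have e0 : 0 < e by rewrite invr_gt0.
have [T1 T11 HT1] := small_deficit Hs Y0 HY HB HM qn0 e0.
have T1_gt0 : 0 < T1 by lra.
have sx0 : 0 < 1 - x0 by rewrite subr_gt0.
have sy0 : 0 < 1 - y0 by rewrite subr_gt0.
(* The terms ensure in turn that the deficit is small, that the square of side r stays
   inside the unit square, that ep <= 1/3, and the numerical condition on T. *)
pose T := T1 + 4 + 10 * pi + 4 / (1 - x0) + 4 / (1 - y0) + 64 * k2 * M * B.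
have u1 : 0 < 4 / (1 - x0) by rewrite divr_gt0.
have u2 : 0 < 4 / (1 - y0) by rewrite divr_gt0.
have u3 : 0 < 10 * pi :> R by rewrite mulr_gt0.
have u4 : 0 <= 64 * k2 * M * B by rewrite !mulr_ge0// ltW.
have [[TT1 T4 Tpi] [Tx Ty TB]] := sum_ge_terms T1_gt0 u3 u1 u2 u4.
rewrite -/T in TT1 T4 Tpi Tx Ty TB.
have T0 : 0 < T := lt_le_trans T1_gt0 TT1.
clearbody T.
(* dev is at most Y r^2 on the square, and exp T r^4 = 1, so the argument of the
   logarithm in the test function is at most 2 there. *)
pose r := expR (- (T / 4)).
have r0 : 0 < r by exact: expR_gt0.
have rT : r <= 4 / T.
  have -> : 4 / T = (T / 4)^-1 by rewrite invf_div.
  rewrite /r expRN lef_pV2 ?posrE ?expR_gt0 ?divr_gt0//.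
  by apply: le_trans (expR_ge1Dx _); rewrite lerDr.
have r4 : (r * r) * (r * r) = expR (- T).
  by rewrite /r -!expRD; congr expR; field.
have xr : x0 + r <= 1.
  rewrite -lerBrDl; apply: le_trans rT _.
  by rewrite ler_pdivrMr// mulrC -ler_pdivrMr.
have yr : y0 + r <= 1.
  rewrite -lerBrDl; apply: le_trans rT _.
  by rewrite ler_pdivrMr// mulrC -ler_pdivrMr.
have r1 : r <= 1 by apply: le_trans xr; rewrite lerDr.
clearbody r.
have rr0 : 0 < r * r by rewrite mulr_gt0.
(* The squares of the sines add up to at most ep on the square of side r. *)
pose ep := 2 * (pi * pi) * (r * r).
have ep0 : 0 < ep by rewrite !mulr_gt0.
have ep3 : ep <= 3^-1.
  have h1 : r * pi <= 4 / 10.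
    apply: (@le_trans _ _ (4 / T * pi)); first by rewrite ler_pM2r.
    by rewrite mulrAC ler_pdivrMr//; lra.
  have h2 : (r * pi) * (r * pi) <= 4 / 10 * (4 / 10).
    by rewrite ler_pM// mulr_ge0// ltW.
  have -> : ep = 2 * ((r * pi) * (r * pi)) by rewrite /ep; ring.
  by move: ((r * pi) * (r * pi)) h2 => *; lra.
pose L := test c K Y T.
have CL : class_C setT 1 L := C1_test Hs Y0 T0.
have L1 p : L p <= 1 := test_le1 Y0 HY p T0.
have Lsq x y : x0 <= x <= x0 + r -> y0 <= y <= y0 + r -> L (pt x y) <= 2^-1.
  move=> hx hy; rewrite /L /test /logtest ler_pdivrMr//.
  apply: (@le_trans _ _ (ln 2)); last first.
    by have := @ln_sublinear R 2 ltac:(by []); lra.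
  rewrite logp_offset// ler_ln ?posrE; last 2 first.
  - rewrite ltr_pwDl// mulr_ge0 ?sqr_ge0// ltW//; exact: expRB1_gt0.
  - by [].
  suff : (dev c K (pt x y) / Y) ^+ 2 * (expR T - 1) <= 1 by lra.
  have dr : `|dev c K (pt x y) / Y| <= r * r.
    rewrite normrM normfV (gtr0_norm Y0) ler_pdivrMr//.
    apply: le_trans (HC r x y (ltW r0) hx hy) _.
    by rewrite mulrC ler_pM2l// /Y lerDr ltW.
  have dr2 : (dev c K (pt x y) / Y) ^+ 2 <= expR (- T).
    rewrite -r4 -[leLHS]real_normK ?num_real// expr2.
    by rewrite ler_pM.
  apply: (@le_trans _ _ (expR (- T) * (expR T - 1))).
    by rewrite ler_wpM2r// ltW// expRB1_gt0.
  by rewrite mulrBr mulr1 -expRD addNr expR0 lerBlDr lerDl ltW// expR_gt0.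
pose G i := bump_grad x0 y0 ep i.
pose lp := bump_lap x0 y0 ep.
have lpc p : 0 <= lp p + c3 by rewrite -lerBlDr sub0r; exact: bump_lap_ge.
have lps x y : x0 <= x <= x0 + r -> y0 <= y <= y0 + r -> pi * pi / (2 * ep) <= lp (pt x y).
  move=> hx hy; apply: bump_lap_core => //.
  have sb t t0 : t0 <= t <= t0 + r -> sin (pi * (t - t0)) * sin (pi * (t - t0)) <= pi * pi * (r * r).
    move=> /andP[t1 t2]; rewrite -expr2 -real_normK ?num_real// expr2.
    have -> : pi * pi * (r * r) = (pi * r) * (pi * r) by ring.
    have h : `|sin (pi * (t - t0))| <= pi * r.
      apply: le_trans (sin_le _) _; rewrite normrM (gtr0_norm pp) ler_pM2l//.
      by rewrite ger0_norm ?subr_ge0// lerBlDl.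
    by rewrite ler_pM.
  rewrite /bump_arg /sin_at !mxE /bump_center /= lerD2r /ep.
  have := sb x x0 hx; have := sb y y0 hy => h1 h2.
  have -> : 2 * (pi * pi) * (r * r) = pi * pi * (r * r) + pi * pi * (r * r) by ring.
  exact: lerD.
have C1L : class_C setT 1 (fun p => 1 - L p) := class_CB openT (class_C_cst openT 1 1) CL.
have Clp : class_C setT 0 (fun p => lp p + c3).
  exact: (class_CD openT (C0_bump_lap x0 y0 ep0) (class_C_cst openT 0 c3)).
have Cprod : class_C setT 0 (fun p => (1 - L p) * (lp p + c3)).
  exact: (class_CM openT (class_C_pred C1L) Clp).
have low : 8^-1 <= int2 (fun p => (1 - L p) * (lp p + c3)).
  have -> : 8^-1 = 2^-1 * (pi * pi / (2 * ep)) * r * r.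
    have [pn rn] : (pi : R) != 0 /\ r != 0 by split; rewrite gt_eqF.
    exact: eighth_square.
  apply: (@int2_ge_square _ _ x0 y0) => //; rewrite ?(ltW r0)//.
  - exact: C0_continuous.
  - by move=> p; rewrite mulr_ge0// subr_ge0.
  - by rewrite mulr_ge0// divr_ge0 ?mulr_ge0// ltW.
  move=> x y hx hy; have h1 := Lsq x y hx hy; have h2 := lps x y hx hy.
  apply: ler_pM => //; first by rewrite divr_ge0 ?mulr_ge0// ltW.
    by lra.
  by apply: le_trans h2 _; rewrite lerDl ltW.
have CGi i : class_C setT 0 (G i) := class_C_pred (C1_bump_grad x0 y0 ep0 i).
have CdL i : class_C setT 0 (partial i L) := class_C_partial i CL.
pose E1 p := partial 0 L p ^+ 2 + partial 1 L p ^+ 2.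
pose E2 p := G 0 p * G 0 p + G 1 p * G 1 p.
have C0sq i : class_C setT 0 (fun p => partial i L p ^+ 2) := class_CM openT (CdL i) (CdL i).
have CE1 : class_C setT 0 E1 := class_CD openT (C0sq 0) (C0sq 1).
have CE2 : class_C setT 0 E2.
  exact: (class_CD openT (class_CM openT (CGi 0) (CGi 0)) (class_CM openT (CGi 1) (CGi 1))).
have perL : biperiodic L.
  by move=> p z zi; rewrite /L /test /logtest (biperiodic_dev Hs).
have dev_int : int2 (fun p => (1 - L p) * lp p) <=
    k2 * T / 2 * int2 E1 + (2 * k2 * T)^-1 * int2 E2.
  have kT : 0 < k2 * T by rewrite mulr_gt0.
  by have := green_young x0 y0 ep0 CL perL kT; rewrite [2 * (k2 * T)]mulrA.
have E1b : int2 E1 <= 2 * M / T ^+ 2 * (T * (B * int2 (fun p => 1 - L p)) + B).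
  have -> : int2 E1 = int2 (fun p => partial 0 L p ^+ 2) + int2 (fun p => partial 1 L p ^+ 2).
    by rewrite -(int2D (C0_continuous (C0sq 0)) (C0_continuous (C0sq 1))).
  apply: le_trans (logtest_energy Hs (log_offset_gt0 Y0 T0) T0 HM) _.
  apply: ler_wpM2l; first by rewrite divr_ge0 ?sqr_ge0// mulr_ge0// ltW.
  have := flux_deficit Hs Y0 HY HB T0.
  by rewrite I0 mulr0 addr0.
have E2b : int2 E2 <= c3 * T.
  apply: le_trans (bump_grad_energy x0 y0 ep0 _) _; first by apply: le_trans ep3 _; rewrite invf_le1// ler1n.
  by rewrite -/c3 ler_pM2l//; exact: log_eps.
have dd : 0 <= int2 (fun p => 1 - L p) <= e.
  apply/andP; split; last exact: HT1.
  rewrite -[leLHS](int2_cst 0); apply: le_int2 => [p||p]; first exact: cst_continuous.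
    exact: C0_continuous (class_C_pred C1L).
  by rewrite subr_ge0.
have he : e * (64 * (c3 + k2 * M * B + 1)) <= 1 by rewrite mulVf// lt0r_neq0.
apply: (@final_arith c3 k2 M B e T _ _ _ _ c30 erefl M0 B0' T0 TB he dd E1b E2b dev_int).
have CP1 : class_C setT 0 (fun p => (1 - L p) * lp p).
  exact: (class_CM openT (class_C_pred C1L) (C0_bump_lap x0 y0 ep0)).
have CP2 : class_C setT 0 (fun p => c3 * (1 - L p)).
  exact: (class_CM openT (class_C_cst openT 0 c3) (class_C_pred C1L)).
rewrite -(int2Z _ (C0_continuous (class_C_pred C1L))).
rewrite -(int2D (C0_continuous CP1) (C0_continuous CP2)).
apply: le_trans low _; rewrite le_eqVlt; apply/orP; left; apply/eqP; congr int2.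
by apply/funext => p; move: (L p) (lp p) => *; ring.
Qed.

End strict.

(** * The proposition for a periodic Ricci system *)

Section consequences.
Variable R : realType.
Local Notation plane := 'rV[R]_2.
Variables (a b c : R) (K rho : plane -> R) (A : 'I_2 -> 'I_2 -> plane -> R).
Variable P : 'I_2 -> plane -> R.
Hypothesis Hs : ricci_system a b c K rho A P.

Let CK0 : class_C setT 0 K := class_C_pred (class_C_pred (rsK Hs)).
Let CrK : class_C setT 0 (fun p => rho p * K p) := class_CM openT (rsrho Hs) CK0.

Lemma ricci_bounds : exists Y B M : R, [/\ 0 < Y, forall p, `|dev c K p| <= Y,
  forall p, `|source a b K rho p| <= B & forall p, trace_coef A p <= M].
Proof.
have [Y Y0 HY] := bounded_periodic (C0_continuous (C0_dev Hs)) (biperiodic_dev Hs).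
have [B B0 HB] := bounded_periodic (C0_continuous (C0_source Hs)) (biperiodic_source Hs).
have [M M0 HM'] := bounded_periodic (C0_continuous (C0_trace_coef Hs)) (biperiodic_trace_coef Hs).
exists Y, B, M; split=> // p; apply: le_trans (HM' p); exact: ler_norm.
Qed.

Lemma one_sign : (forall p, dev c K p <= 0) \/ (forall p, 0 <= dev c K p).
Proof.
have [Y [B [M [Y0 HY HB HM]]]] := ricci_bounds.
have [[p pp]|np] := pselect (exists p, 0 < dev c K p); last first.
  by left=> p; rewrite leNgt; apply/negP => pp; apply: np; exists p.
right=> q; rewrite leNgt; apply/negP => qp.
exact: (no_sign_change Hs Y0 HY HB HM pp qp).
Qed.

Lemma int2_rho_gt0 : 0 < int2 rho.
Proof.
apply: (@int2_gt0 _ _ 0 0); rewrite ?lexx ?ltr01 ?(rsrho0 Hs)//.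
  exact: C0_continuous (rsrho Hs).
by move=> p; exact/ltW/(rsrho0 Hs).
Qed.

Lemma signed_curvature_eq0 (s : R) : s * s = 1 -> (forall p, 0 <= s * K p) -> forall p, K p = 0.
Proof.
move=> ss sK p; have s0 : s != 0 by apply: contra_eqN ss => /eqP ->; rewrite mul0r eq_sym oner_eq0.
have C : class_C setT 0 (fun p => s * (rho p * K p)) := class_CM openT (class_C_cst openT 0 s) CrK.
have := @int2_eq0 _ _ (C0_continuous C) _ _ _ p => /(_ _ _ _)/eqP.
rewrite !mulf_eq0 (negPf s0) (gt_eqF (rsrho0 Hs p)) /= => H; apply/eqP/H.
- by move=> q z zi; rewrite (rsKper Hs)// (rsrhoper Hs).
- by move=> q; rewrite mulrCA mulr_ge0// ltW// (rsrho0 Hs).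
- by rewrite (int2Z _ (C0_continuous CrK)) (int2_rhoK Hs) mulr0.
Qed.

Lemma constant_curvature_eq0 k : (forall p, K p = k) -> k = 0.
Proof.
move=> Kk; have := int2_rhoK Hs.
have -> : (fun p => rho p * K p) = (fun p => k * rho p).
  by apply/funext => p; rewrite Kk mulrC.
rewrite (int2Z _ (C0_continuous (rsrho Hs))) => /eqP.
by rewrite mulf_eq0 (gt_eqF int2_rho_gt0) orbF => /eqP.
Qed.

Lemma int2_sourceE : int2 (source a b K rho) = b * int2 rho.
Proof.
have -> : source a b K rho = (fun p => a * (rho p * K p) + b * rho p).
  by apply/funext => p; rewrite /source; ring.
have C1 : class_C setT 0 (fun p => a * (rho p * K p)) := class_CM openT (class_C_cst openT 0 a) CrK.
have C2 : class_C setT 0 (fun p => b * rho p) := class_CM openT (class_C_cst openT 0 b) (rsrho Hs).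
rewrite (int2D (C0_continuous C1) (C0_continuous C2)).
rewrite (int2Z _ (C0_continuous CrK)) (int2Z _ (C0_continuous (rsrho Hs))).
by rewrite (int2_rhoK Hs) mulr0 add0r.
Qed.

Lemma flux_ge0 d : 0 < d -> 0 <= flux a b c K rho d.
Proof.
move=> d0; rewrite (flux_gain Hs d0) -[leLHS](int2_cst 0); apply: le_int2 => [p||p].
- exact: cst_continuous.
- exact: C0_continuous (gain_integrable Hs d0).
rewrite mulr_ge0 ?(grad_sq_ge0 Hs)//; apply: le_trans (log_weight_gain d0 _).
by rewrite divr_ge0// ltW// sqrD_gt0.
Qed.

Lemma budget_exceeded (B0 F D S : R) : 4 * B0 <= S -> 0 < S ->
  F + S <= D + B0 -> 0 <= F -> D <= S / 2 -> False.
Proof. by move=> *; lra. Qed.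

(** The flux is nonnegative, so by [flux_deficit] the total source, which is b times
the area, is at most B times the deficit plus B/T, hence as small as desired. *)
Lemma b_le0 q : dev c K q != 0 -> b <= 0.
Proof.
move=> qn0; rewrite leNgt; apply/negP => b0.
have [Y [B [M [Y0 HY HB HM]]]] := ricci_bounds.
have B0 : 0 <= B by exact: le_trans (normr_ge0 _) (HB 0).
have s0 : 0 < b * int2 rho by rewrite mulr_gt0// int2_rho_gt0.
set s := b * int2 rho in s0 *.
have e0 : 0 < s / (2 * (B + 1)) by rewrite divr_gt0// mulr_gt0//; lra.
have [T1 T11 HT1] := small_deficit Hs Y0 HY HB HM qn0 e0.
pose T := T1 + 4 * B / s.
have w0 : 0 <= 4 * B / s by apply: divr_ge0 (ltW s0); apply: mulr_ge0.
have TT : T1 <= T by rewrite /T lerDl.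
have T0 : 0 < T by lra.
have hf := flux_deficit Hs Y0 HY HB T0.
have h1 := HT1 T TT; have h0 := flux_ge0 (log_offset_gt0 Y0 T0).
have TB : 4 * B <= T * s by rewrite -ler_pdivrMr// /T lerDr; lra.
have h2 : B * int2 (fun p => 1 - test c K Y T p) <= s / 2.
  apply: (@le_trans _ _ (B * (s / (2 * (B + 1))))); first exact: ler_wpM2l.
  rewrite mulrA ler_pdivrMr; last by lra.
  have -> : s / 2 * (2 * (B + 1)) = B * s + s by field.
  by rewrite lerDl ltW.
have h3 : T * (B * int2 (fun p => 1 - test c K Y T p)) <= T * (s / 2) by rewrite ler_pM2l.
rewrite int2_sourceE -/s in hf.
have Ts : 0 < T * s by rewrite mulr_gt0.
have h4 : T * (s / 2) = T * s / 2 by rewrite mulrA.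
move: hf h0 h3; rewrite h4.
exact: (budget_exceeded TB Ts).
Qed.

Lemma dev_nonzero : c != 0 -> exists q, dev c K q != 0.
Proof.
move=> c0; apply: contrapT => nq; move/eqP: c0; apply.
apply: constant_curvature_eq0 => p; apply/eqP; rewrite -subr_eq0; apply/negP => /negP h.
by apply: nq; exists p.
Qed.

Lemma curvature_le : 0 < c -> forall p, K p <= c.
Proof.
move=> c0 p; have [H|H] := one_sign; first by rewrite -subr_le0 H.
have K0 : forall p, K p = 0.
  by apply: (signed_curvature_eq0 (mulr1 1)) => q; rewrite mul1r; have := H q; rewrite /dev; lra.
by rewrite K0 ltW.
Qed.

(** Otherwise both terms of the energy identity with h = 1 are nonnegative: since
rho K has integral 0, the integral of rho K (K - c)^2 equals that of
rho K^2 (K - 2c), which is at most 0 as K <= c. *)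
Lemma a_gt0 : 0 < c -> b = 0 -> (exists p, K p != 0) -> 0 < a.
Proof.
move=> c0 b0 [p0 Kp0]; rewrite ltNge; apply/negP => a0.
have Kc := curvature_le c0.
have d1 (x : R) : is_derive x 1 (fun y : R => 1 * y) 1.
  have -> : (fun y : R => 1 * y) = id by apply/funext => y; rewrite mul1r.
  exact: is_derive_id.
have := energy_identity Hs d1 (fun x : R => @cst_continuous R R 1 x) (fun x : R => @cst_continuous R R 1 x).
have Cg := C0_grad_sq Hs.
have Cg2 : class_C setT 0 (fun p => (1 + 1) * grad_sq A K p) := class_CM openT (class_C_cst openT 0 _) Cg.
have CK2 : class_C setT 0 (fun p => K p * K p) := class_CM openT CK0 CK0.
have Cs : class_C setT 0 (fun p => a * (rho p * (K p * K p) * (K p - 2 * c))).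
  apply: (class_CM openT (class_C_cst openT 0 _)).
  exact: (class_CM openT (class_CM openT (rsrho Hs) CK2) (class_CB openT CK0 (class_C_cst openT 0 _))).
have Cr : class_C setT 0 (fun p => a * c ^+ 2 * (rho p * K p)) := class_CM openT (class_C_cst openT 0 _) CrK.
have -> : (fun p => source a b K rho p * (1 * dev c K p ^+ 2)) =
  (fun p => a * (rho p * (K p * K p) * (K p - 2 * c)) + a * c ^+ 2 * (rho p * K p)).
  by apply/funext => p; rewrite /source /dev b0; ring.
rewrite (int2D (C0_continuous Cs) (C0_continuous Cr)) (int2Z _ (C0_continuous CrK)).
rewrite (int2_rhoK Hs) mulr0 addr0 (int2Z _ (C0_continuous Cg)) => HE.
have hs : 0 <= int2 (fun p => a * (rho p * (K p * K p) * (K p - 2 * c))).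
  rewrite -[leLHS](int2_cst 0); apply: le_int2 => [p||p]; first exact: cst_continuous.
    exact: C0_continuous.
  rewrite mulr_le0// mulr_ge0_le0//; first by rewrite mulr_ge0 -?expr2 ?sqr_ge0// ltW// (rsrho0 Hs).
  by have := Kc p; lra.
have g0 : int2 (grad_sq A K) <= 0 by move: HE hs => /eqP; move: (int2 _) (int2 _) => x y /eqP *; lra.
have pg : biperiodic (grad_sq A K).
  move=> p z zi; rewrite /grad_sq; apply: eq_bigr => i _; apply: eq_bigr => j _.
  by rewrite (rsAper Hs)// !(periodic_partial _ (rsKper Hs)).
have G0 := int2_eq0 (C0_continuous Cg) pg (grad_sq_ge0 Hs) g0.
have dK i p : partial i K p = 0.
  have := grad_sq_lower Hs p; rewrite G0 mulr0 => h.
  have h0 := sqr_ge0 (partial 0 K p); have h1 := sqr_ge0 (partial 1 K p).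
  have e0 : partial 0 K p ^+ 2 = 0.
    by apply/eqP; rewrite eq_le h0 andbT; exact: le_trans (ler_wpDr h1 (lexx _)) h.
  have e1 : partial 1 K p ^+ 2 = 0.
    by apply/eqP; rewrite eq_le h1 andbT; exact: le_trans (ler_wpDl h0 (lexx _)) h.
  by case: (ord2P i) => ->; apply/eqP; rewrite -sqrf_eq0 ?e0 ?e1.
have K1 : class_C setT 1 K := class_C_pred (rsK Hs).
have dK0 i p : `|partial i K p| <= 0 by rewrite dK normr0.
have Kcst p : K p = K (pt 0 0).
  rewrite -(pt_eta p); have h1 := row_increment 0 (p 0 0) (p 0 1) K1 (dK0 0).
  have h2 := col_increment 0 0 (p 0 1) K1 (dK0 1).
  move: h1 h2; rewrite !mul0r !normr_le0 !subr_eq0 => /eqP -> /eqP -> //.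
by move: Kp0; rewrite Kcst (constant_curvature_eq0 Kcst) eqxx.
Qed.

(** A point where K = c is a maximum of K, so grad K vanishes there and [no_zero]
applies. *)
Lemma curvature_lt : 0 < c -> b = 0 -> forall p, K p < c.
Proof.
move=> c0 b0 p; rewrite lt_neqAle curvature_le// andbT; apply/negP => /eqP Kp.
have [q qn0] := dev_nonzero (lt0r_neq0 c0).
have [x [y [hx hy E]]] := reduce_mod1 p.
have d0 : dev c K (pt x y) = 0 by rewrite (E _ (biperiodic_dev Hs)) /dev Kp subrr.
apply: (no_zero Hs hx hy _ qn0 d0) => [|i].
  by rewrite int2_sourceE b0 mul0r.
apply: partial_max; first exact: class_C_pred (rsK Hs).
by move=> r; rewrite (E _ (rsKper Hs)) Kp curvature_le.
Qed.

End consequences.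

Section conclusion.
Variable R : realType.
Local Notation plane := 'rV[R]_2.
Variables (a b c : R) (K rho : plane -> R) (A : 'I_2 -> 'I_2 -> plane -> R).
Variable P : 'I_2 -> plane -> R.
Hypothesis Hs : ricci_system a b c K rho A P.

(** Reverses the sign of c, which reduces the case c < 0 to the case c > 0. *)
Lemma ricci_system_opp : ricci_system (- a) b (- c) (fun p => - K p) rho A (fun i p => - P i p).
Proof.
have dN (f : plane -> R) i p : class_C setT 1 f -> partial i (fun q => - f q) p = - partial i f p.
  move=> Cf; have -> : (fun q => - f q) = (fun q => (-1) * f q).
    by apply/funext => q; rewrite mulN1r.
  by rewrite (partialME p i (class_C_cst openT 1 (-1)) Cf) partial_cst mulr0 addr0 mulN1r.
have CK1 : class_C setT 1 K := class_C_pred (rsK Hs).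
have dK i : partial i (fun q => - K q) = (fun q => - partial i K q).
  by apply/funext => p; exact: dN.
have CV i : class_C setT 1 (fun q => \sum_(j < 2) A i j q * partial j K q).
  apply: (class_C_sum openT) => j; apply: (class_CM openT); first exact: (rsA Hs).
  by apply: class_C_partial; exact: (rsK Hs).
have dg p : div_grad A (fun q => - K q) p = - div_grad A K p.
  rewrite /div_grad -sumrN; apply: eq_bigr => i _; rewrite -dN//; congr partial.
  by apply/funext => q; rewrite -sumrN; apply: eq_bigr => j _; rewrite dK mulrN.
have gs p : grad_sq A (fun q => - K q) p = grad_sq A K p.
  by apply: eq_bigr => i _; apply: eq_bigr => j _; rewrite !dN// !mulrN mulNr opprK.
split; first [by exact: (rsA Hs)|by exact: (rsrho Hs)|idtac].
- exact: (class_CN openT (rsK Hs)).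
- by move=> p z zi; rewrite (rsKper Hs).
- exact: (rsrhoper Hs).
- exact: (rsrho0 Hs).
- exact: (rsAper Hs).
- exact: (rsAsym Hs).
- exact: (rsAdet Hs).
- exact: (rsA00 Hs).
- by move=> i; exact: (class_CN openT (rsP Hs i)).
- by move=> i p z zi; rewrite (rsPper Hs).
- move=> p; have := rsGB Hs p; rewrite !dN; [|exact: (rsP Hs)..].
  by rewrite mulrN => ->; rewrite opprD.
- move=> p; rewrite dg gs; have := rseq Hs p.
  move: (div_grad A K p) (grad_sq A K p) (rho p) (K p) => x y r k <-; ring.
Qed.

End conclusion.

Theorem ricci_core (R : realType) (a b c : R) (K rho : 'rV[R]_2 -> R)
    (A : 'I_2 -> 'I_2 -> 'rV[R]_2 -> R) (P : 'I_2 -> 'rV[R]_2 -> R) :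
  ricci_system a b c K rho A P ->
  [/\ c = 0 -> forall p, K p = 0,
      0 < c -> [/\ b <= 0, forall p, K p <= c &
        b = 0 -> (exists p, K p != 0) -> 0 < a /\ forall p, K p < c] &
      c < 0 -> [/\ b <= 0, forall p, c <= K p &
        b = 0 -> (exists p, K p != 0) -> a < 0 /\ forall p, c < K p]].
Proof.
move=> Hs; split=> [c0|c0|c0].
- have [H|H] := one_sign Hs; move: H; rewrite /dev c0 => H.
    have m1 : (-1) * (-1) = 1 :> R by rewrite mulrNN mulr1.
    by apply: (signed_curvature_eq0 Hs m1) => p; rewrite mulN1r oppr_ge0 -[K p]subr0.
  by apply: (signed_curvature_eq0 Hs (mulr1 1)) => p; rewrite mul1r -[K p]subr0.
- have [q qn0] := dev_nonzero Hs (lt0r_neq0 c0).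
  split; [exact: b_le0 Hs q qn0|exact: curvature_le Hs c0|].
  by move=> b0 ex; split; [exact: a_gt0 Hs c0 b0 ex|exact: curvature_lt Hs c0 b0].
- have Hf := ricci_system_opp Hs; have c1 : 0 < - c by rewrite oppr_gt0.
  have [q qn0] := dev_nonzero Hf (lt0r_neq0 c1).
  split; first exact: b_le0 Hf q qn0.
    by move=> p; rewrite -lerN2; exact: curvature_le Hf c1 p.
  move=> b0 [p Kp]; split.
    rewrite -oppr_gt0; apply: (a_gt0 Hf c1 b0); exists p; by rewrite oppr_eq0.
  by move=> r; rewrite -ltrN2; exact: curvature_lt Hf c1 b0 r.
Qed.

(** * Riemannian metrics on a plane domain *)

(** Replaces the geometric quantities of the goal by variables before a polynomial
identity is checked; comparing them syntactically keeps [ring] and [field] from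
unfolding them. *)
Ltac gen_atoms := repeat match goal with
  | |- context [@partial ?R ?i ?f ?p] => generalize (@partial R i f p)
  | |- context [@christoffel ?R ?g ?i ?j ?k ?p] => generalize (@christoffel R g i j k p)
  | |- context [@fun_of_matrix ?R ?m ?n ?A ?i ?j] => generalize (@fun_of_matrix R m n A i j)
  end.
Ltac atoms := gen_atoms; intros.

(** Outermost sums first; the syntactic search avoids unification under binders. *)
Ltac expand_sums := repeat match goal with
  | |- context [@bigop.body ?T ?I ?z ?r ?B] =>
    lazymatch B with (fun i => BigBody i _ _ (@?F i)) =>
      let E := constr:(sum2 F) in
      pattern (@bigop.body T I z r B); refine (eq_ind_r _ _ E); cbv beta
    end
  end.

Section metric.
Variable R : realType.
Local Notation plane := 'rV[R]_2.

Record metric_on (U : set plane) (g : plane -> 'M[R]_2) : Prop := MetricOn {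
  mo_open : open U;
  mo_smooth : forall i j, smooth_on U (fun q => g q i j);
  mo_sym : forall q, U q -> forall i j, g q i j = g q j i;
  mo_det : forall q, U q -> 0 < \det (g q);
  mo_g00 : forall q, U q -> 0 < g q 0 0 }.

Variables (U : set plane) (g : plane -> 'M[R]_2).
Hypothesis Hg : metric_on U g.

Let oU := mo_open Hg.
Let Cg := mo_smooth Hg.
Local Notation Gam := (christoffel g).

Lemma mo_det_neq0 q : U q -> \det (g q) != 0.
Proof. by move=> Uq; rewrite gt_eqF// (mo_det Hg). Qed.

Lemma smooth_det : smooth_on U (fun q => \det (g q)).
Proof.
move=> k; apply: (@class_C_ext _ _ oU k (fun q => g q 0 0 * g q 1 1 - g q 0 1 * g q 1 0)).
  by move=> q _; rewrite det2.
exact: (class_CB oU (class_CM oU (Cg 0 0 k) (Cg 1 1 k)) (class_CM oU (Cg 0 1 k) (Cg 1 0 k))).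
Qed.

Lemma smooth_inv i j : smooth_on U (fun q => invmx (g q) i j).
Proof.
move=> k; have CdV : class_C U k (fun q => (\det (g q))^-1).
  apply: (class_CV oU _ (smooth_det k)); exact: mo_det_neq0.
apply: (@class_C_ext _ _ oU k (fun q => (\det (g q))^-1 *
    (if i == 0 then if j == 0 then g q 1 1 else - g q 0 1
     else if j == 0 then - g q 1 0 else g q 0 0))).
  by move=> q; rewrite inE => Uq; rewrite inv2 ?mo_det_neq0// mxE.
apply: (class_CM oU CdV); case: (i == 0); case: (j == 0) => //;
  by [exact: Cg|exact: (class_CN oU (Cg _ _ k))].
Qed.

Lemma smooth_partial i f : smooth_on U f -> smooth_on U (partial i f).
Proof. by move=> Cf k; apply: class_C_partial; exact: Cf. Qed.

Lemma smooth_christoffel k i j : smooth_on U (Gam k i j).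
Proof.
move=> n; apply: (class_CM oU (class_C_cst oU n _)); apply: (class_C_sum oU) => l.
apply: (class_CM oU (smooth_inv k l n)).
by apply: (class_CB oU); first apply: (class_CD oU); exact: smooth_partial.
Qed.

Lemma partial_g_sym k i j p : U p ->
  partial k (fun q => g q i j) p = partial k (fun q => g q j i) p.
Proof.
by move=> Up; apply: (partial_ext oU k Up) => q; rewrite inE => Uq; exact: (mo_sym Hg).
Qed.

Lemma christoffel_sym k i j p : U p -> Gam k i j p = Gam k j i p.
Proof.
move=> Up; rewrite /christoffel; congr (_ * _); apply: eq_bigr => l _; congr (_ * _).
by rewrite (partial_g_sym l i j Up) [X in X - _ = _]addrC.
Qed.

Lemma mul_g_inv l m p : U p -> \sum_(k < 2) g p l k * invmx (g p) k m = (l == m)%:R.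
Proof.
move=> Up; have uM : g p \in unitmx by rewrite unitmxE unitfE mo_det_neq0.
by have := congr1 (fun M : 'M[R]_2 => M l m) (mulmxV uM); rewrite !mxE.
Qed.

(** Multiplying by g cancels the inverse matrix in the definition. *)
Lemma christoffel_lower i j l p : U p -> \sum_(k < 2) Gam k i j p * g p k l =
  2^-1 * (partial i (fun q => g q j l) p + partial j (fun q => g q i l) p
     - partial l (fun q => g q i j) p).
Proof.
move=> Up; have H0 := mul_g_inv l 0 Up; have H1 := mul_g_inv l 1 Up.
move: H0 H1; rewrite /christoffel !sum2 (mo_sym Hg Up 0 l) (mo_sym Hg Up 1 l).
set c := fun m => partial i (fun q => g q j m) p + partial j (fun q => g q i m) p
     - partial m (fun q => g q i j) p.
rewrite -/(c 0) -/(c 1) -/(c l).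
move: (invmx (g p)) => N H0 H1.
have -> : c l = (l == 0)%:R * c 0 + (l == 1)%:R * c 1.
  by case: (ord2P l) => -> /=; rewrite !mul1r !mul0r ?addr0 ?add0r.
by rewrite -H0 -H1; generalize (c 0) (c 1); atoms; ring.
Qed.

(** The Levi-Civita connection preserves the metric; together with symmetry this
characterizes it, and every computation below goes through it. *)
Lemma metric_compat k i j p : U p -> partial k (fun q => g q i j) p =
  \sum_(m < 2) (Gam m k i p * g p m j + Gam m k j p * g p m i).
Proof.
move=> Up; rewrite big_split /= !christoffel_lower//.
rewrite (partial_g_sym k j i Up).
by atoms; field.
Qed.

Opaque christoffel.

Definition lowered k m p : R := \sum_(l < 2) riemann g l 0 1 k p * g p l m.

Let hG k i j l p (Up : U p) := class_C_has_partial l (smooth_christoffel k i j 1) Up.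
Let hg i j l p (Up : U p) := class_C_has_partial l (Cg i j 1) Up.

Lemma partial2_g k m l i p : U p ->
  partial l (partial i (fun q => g q k m)) p =
  \sum_(n < 2) (partial l (Gam n i k) p * g p n m + Gam n i k p * partial l (fun q => g q n m) p
    + (partial l (Gam n i m) p * g p n k + Gam n i m p * partial l (fun q => g q n k) p)).
Proof.
move=> Up; transitivity (partial l (fun q =>
    \sum_(n < 2) (Gam n i k q * g q n m + Gam n i m q * g q n k)) p).
  by apply: (partial_ext oU _ Up) => q; rewrite inE => Uq; exact: metric_compat.
apply: has_partialE; apply: has_partial_sum => n.
exact: (has_partialD (has_partialM (hG n i k l Up) (hg n m l Up))
  (has_partialM (hG n i m l Up) (hg n k l Up))).
Qed.

(** The two mixed second derivatives of <d_k, d_m> agree; expanding both with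
[metric_compat] leaves <R(d_0, d_1) d_k, d_m> + <d_k, R(d_0, d_1) d_m>. *)
Lemma lowered_anti k m p : U p -> lowered k m p = - lowered m k p.
Proof.
move=> Up; have := @partialC R U (fun q => g q k m) p 0 1 oU Up (Cg k m 2).
have key (x y u v : R) : x = y -> u + v = x - y -> u = - v.
  by move=> -> /eqP; rewrite subrr addr_eq0 => /eqP.
move/key; apply.
have M n i j := metric_compat n i j Up.
move: (partial2_g k m 0 1 Up) (partial2_g k m 1 0 Up) (mo_sym Hg Up 1 0).
move: (M 0 0 m) (M 0 1 m) (M 0 0 k) (M 0 1 k) (M 1 0 m) (M 1 1 m) (M 1 0 k) (M 1 1 k).
by rewrite /lowered /riemann; expand_sums; gen_atoms; intros; subst; ring.
Qed.

(** The trace of the connection is the logarithmic derivative of the area density. *)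
Lemma partial_det i p : U p -> partial i (fun q => \det (g q)) p =
  2 * \det (g p) * (Gam 0 i 0 p + Gam 1 i 1 p).
Proof.
move=> Up; transitivity (partial i (fun q => g q 0 0 * g q 1 1 - g q 0 1 * g q 0 1) p).
  apply: (partial_ext oU _ Up) => q; rewrite inE => Uq.
  by rewrite det2 (mo_sym Hg Uq 1 0).
rewrite (has_partialE (has_partialD (has_partialM (hg 0 0 i Up) (hg 1 1 i Up))
  (has_partialN (has_partialM (hg 0 1 i Up) (hg 0 1 i Up))))).
rewrite (metric_compat i 0 0 Up) (metric_compat i 1 1 Up) (metric_compat i 0 1 Up) !sum2.
by rewrite det2 (mo_sym Hg Up 1 0); atoms; ring.
Qed.

Definition area_density q : R := Num.sqrt (\det (g q)).

Lemma area_gt0 p : U p -> 0 < area_density p.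
Proof. by move=> Up; rewrite sqrtr_gt0 (mo_det Hg). Qed.

Lemma area_sq p : U p -> area_density p * area_density p = \det (g p).
Proof. by move=> Up; rewrite -expr2 sqr_sqrtr// ltW// (mo_det Hg). Qed.

Lemma smooth_area : smooth_on U area_density.
Proof. by move=> k; apply: (class_C_sqrt oU (mo_det Hg)); exact: smooth_det. Qed.

Lemma area_has_partial i p : U p ->
  has_partial i area_density p (area_density p * (Gam 0 i 0 p + Gam 1 i 1 p)).
Proof.
move=> Up; have h := class_C_has_partial i (smooth_area 1) Up.
split; first by case: h.
have a0 : area_density p != 0 by rewrite gt_eqF// area_gt0.
have : partial i (fun q => area_density q * area_density q) p =
    2 * \det (g p) * (Gam 0 i 0 p + Gam 1 i 1 p).
  rewrite -(partial_det i Up); apply: (partial_ext oU _ Up) => q; rewrite inE.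
  exact: area_sq.
rewrite (has_partialE (has_partialM h h)) -(area_sq Up).
move: (partial i area_density p) (area_density p) (Gam 0 i 0 p + Gam 1 i 1 p) a0.
move=> x r t r0 E; apply: (mulIf r0); apply: (mulfI (_ : 2 != 0)) => //.
by have -> : 2 * (x * r) = x * r + r * x; [ring|rewrite E; ring].
Qed.

(** In dimension two this matrix field has determinant one and depends only on the
conformal class of g. *)
Definition conductivity i j q : R := area_density q * invmx (g q) i j.

Lemma smooth_conductivity i j : smooth_on U (conductivity i j).
Proof. by move=> k; apply: (class_CM oU); [exact: smooth_area|exact: smooth_inv]. Qed.

Lemma conductivityE q : U q -> [/\ conductivity 0 0 q = g q 1 1 * (area_density q)^-1,
  conductivity 0 1 q = - g q 0 1 * (area_density q)^-1, conductivity 1 0 q = - g q 0 1 * (area_density q)^-1 &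
  conductivity 1 1 q = g q 0 0 * (area_density q)^-1].
Proof.
move=> Uq; have a0 : area_density q != 0 by rewrite gt_eqF// area_gt0.
rewrite /conductivity inv2 ?mo_det_neq0// -(area_sq Uq) !mxE /= (mo_sym Hg Uq 1 0).
by move: (area_density q) a0 => r r0; atoms; split; field.
Qed.

Lemma conductivity_sym q : U q -> conductivity 1 0 q = conductivity 0 1 q.
Proof. by move=> /conductivityE [_ -> -> _]. Qed.

Lemma conductivity_det q : U q -> conductivity 0 0 q * conductivity 1 1 q - conductivity 0 1 q ^+ 2 = 1.
Proof.
move=> Uq; have a0 : area_density q != 0 by rewrite gt_eqF// area_gt0.
have [-> -> _ ->] := conductivityE Uq; have := area_sq Uq; rewrite det2 (mo_sym Hg Uq 1 0) => E.
have -> : g q 1 1 / area_density q * (g q 0 0 / area_density q) -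
  (- g q 0 1 / area_density q) ^+ 2 = (g q 0 0 * g q 1 1 - g q 0 1 * g q 0 1) /
  (area_density q * area_density q).
  by move: (area_density q) a0 => r r0; atoms; field.
by rewrite -E divff// mulf_neq0.
Qed.

Lemma conductivity_gt0 q : U q -> 0 < conductivity 0 0 q.
Proof.
move=> Uq; have [-> _ _ _] := conductivityE Uq; rewrite divr_gt0 ?area_gt0//.
rewrite -(pmulr_rgt0 _ (mo_g00 Hg Uq)); have := mo_det Hg Uq; rewrite det2 (mo_sym Hg Uq 1 0).
rewrite subr_gt0; apply: le_lt_trans; rewrite -expr2; exact: sqr_ge0.
Qed.

Lemma trace_by_parts (dC C f2 : 'I_2 -> 'I_2 -> R) (f1 : 'I_2 -> R) (G : 'I_2 -> 'I_2 -> 'I_2 -> R) :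
  (forall j, \sum_(i < 2) dC i j = - (\sum_(a < 2) \sum_(b < 2) C a b * G j a b)) ->
  \sum_(i < 2) \sum_(j < 2) (dC i j * f1 j + C i j * f2 i j) =
  \sum_(i < 2) \sum_(j < 2) C i j * (f2 i j - \sum_(k < 2) G k i j * f1 k).
Proof.
move=> H; transitivity (\sum_(j < 2) (\sum_(i < 2) dC i j) * f1 j +
    \sum_(i < 2) \sum_(j < 2) C i j * f2 i j).
  under eq_bigr do rewrite big_split; rewrite big_split /=; congr (_ + _).
  by rewrite exchange_big; apply: eq_bigr => j _; rewrite mulr_suml.
under [X in X + _]eq_bigr do rewrite H mulNr.
under [RHS]eq_bigr do under eq_bigr do rewrite mulrBr.
under [RHS]eq_bigr do rewrite sumrB.
rewrite sumrB addrC; congr (_ + _); rewrite sumrN; congr (- _).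
under eq_bigr do rewrite mulr_suml; rewrite exchange_big; apply: eq_bigr => a _.
under eq_bigr do rewrite mulr_suml; rewrite exchange_big; apply: eq_bigr => b _.
by rewrite mulr_sumr; apply: eq_bigr => j _; rewrite mulrA.
Qed.

(** The trace of the covariant Hessian; unlike the divergence form it behaves well
under a change of coordinates. *)
Definition hess_trace f p : R := \sum_(i < 2) \sum_(j < 2) invmx (g p) i j *
  (partial i (partial j f) p - \sum_(k < 2) Gam k i j p * partial k f p).

(** Up to the factor sqrt(det g), these are the first order coefficients of the
Laplacian written as a trace of the Hessian. *)
Lemma div_conductivity p : U p -> forall j,
  \sum_(i < 2) partial i (conductivity i j) p =
  - (\sum_(a < 2) \sum_(b < 2) conductivity a b p * Gam j a b p).
Proof.
move=> Up; have a0 : area_density p != 0 by rewrite gt_eqF// area_gt0.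
have hr i := has_partialV a0 (area_has_partial i Up).
have e00 i : partial i (conductivity 0 0) p = partial i (fun q => g q 1 1 * (area_density q)^-1) p.
  by apply: (partial_ext oU _ Up) => q; rewrite inE => /conductivityE [].
have e01 i : partial i (conductivity 0 1) p = partial i (fun q => - g q 0 1 * (area_density q)^-1) p.
  by apply: (partial_ext oU _ Up) => q; rewrite inE => /conductivityE [].
have e10 i : partial i (conductivity 1 0) p = partial i (fun q => - g q 0 1 * (area_density q)^-1) p.
  by apply: (partial_ext oU _ Up) => q; rewrite inE => /conductivityE [].
have e11 i : partial i (conductivity 1 1) p = partial i (fun q => g q 0 0 * (area_density q)^-1) p.
  by apply: (partial_ext oU _ Up) => q; rewrite inE => /conductivityE [].
move=> j; rewrite !sum2; have [-> -> -> ->] := conductivityE Up.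
have h1 i := has_partialE (has_partialM (hg 1 1 i Up) (hr i)).
have h0 i := has_partialE (has_partialM (hg 0 0 i Up) (hr i)).
have h01 i := has_partialE (has_partialM (has_partialN (hg 0 1 i Up)) (hr i)).
rewrite (christoffel_sym j 1 0 Up).
case: (ord2P j) => ->.
  rewrite e00 e10 h1 h01 (metric_compat 0 1 1 Up) (metric_compat 1 0 1 Up) !sum2.
  rewrite (christoffel_sym 0 1 0 Up) (christoffel_sym 1 1 0 Up) (mo_sym Hg Up 1 0).
  by move: (area_density p) a0 => r r0; atoms; field.
rewrite e01 e11 h0 h01 (metric_compat 1 0 0 Up) (metric_compat 0 0 1 Up) !sum2.
rewrite (christoffel_sym 0 1 0 Up) (christoffel_sym 1 1 0 Up) (mo_sym Hg Up 1 0).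
by move: (area_density p) a0 => r r0; atoms; field.
Qed.

Lemma chart_laplacianE f p : chart_laplacian g f p =
  (area_density p)^-1 * \sum_(i < 2) partial i (fun q => \sum_(j < 2) conductivity i j q * partial j f q) p.
Proof.
rewrite /chart_laplacian /chart_div; congr (_ * _); apply: eq_bigr => i _.
congr (partial i _ p); apply/funext => q; rewrite /chart_grad mulr_sumr.
by apply: eq_bigr => j _; rewrite /conductivity mulrA.
Qed.

Lemma laplacian_hess f p : class_C U 2 f -> U p -> chart_laplacian g f p = hess_trace f p.
Proof.
move=> Cf Up; rewrite chart_laplacianE.
have a0 : area_density p != 0 by rewrite gt_eqF// area_gt0.
have hf i j := class_C_has_partial i (class_C_partial j Cf) Up.
have hc i j k := class_C_has_partial k (smooth_conductivity i j 1) Up.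
have hd i := has_partialE (has_partial_sum (fun j => has_partialM (hc i j i) (hf i j))).
rewrite (eq_bigr _ (fun i _ => hd i)) (trace_by_parts _ _ (div_conductivity Up)).
rewrite /hess_trace mulr_sumr; apply: eq_bigr => i _; rewrite mulr_sumr.
by apply: eq_bigr => j _; rewrite mulrA /conductivity mulKf.
Qed.

Lemma chart_grad_norm2E f p : U p -> chart_grad_norm2 g f p =
  \sum_(i < 2) \sum_(j < 2) invmx (g p) i j * partial i f p * partial j f p.
Proof.
move=> Up; have d0 := mo_det_neq0 Up.
rewrite /chart_grad_norm2 /chart_grad !sum2 inv2// !mxE /=.
move: d0; rewrite det2 (mo_sym Hg Up 1 0) => d0.
by move: d0; atoms; field.
Qed.

(** The lowered component with equal indices vanishes by [lowered_anti], which
expresses R^0 through R^1. *)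
Lemma riemann10 p : U p -> lowered 1 0 p * g p 0 0 = - (riemann g 1 0 1 0 p * \det (g p)).
Proof.
move=> Up; rewrite (lowered_anti 1 0 Up).
have : lowered 0 0 p = 0.
  by have := lowered_anti 0 0 Up => /eqP; rewrite -addr_eq0 -mulr2n mulrn_eq0 => /eqP.
rewrite /lowered !sum2 det2 (mo_sym Hg Up 1 0).
generalize (riemann g 0 0 1 0 p) (riemann g 1 0 1 0 p); atoms.
rewrite mulNr; congr (- _).
move/eqP: H; rewrite addr_eq0 => /eqP H.
by rewrite mulrDl mulrAC H; ring.
Qed.

(** Up to orientation, the connection form of the orthonormal frame obtained from
(d_0, d_1) by the Gram-Schmidt process, written so that its exterior derivative is
a divergence. *)
Definition connection_form (i : 'I_2) (q : plane) : R :=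
  if i == 0 then - (area_density q * (g q 0 0)^-1 * Gam 1 0 1 q)
  else area_density q * (g q 0 0)^-1 * Gam 1 0 0 q.

Lemma smooth_connection_form i : smooth_on U (connection_form i).
Proof.
move=> k; have C j : class_C U k (fun q => area_density q * (g q 0 0)^-1 * Gam 1 0 j q).
  apply: (class_CM oU _ (smooth_christoffel 1 0 j k)).
  apply: (class_CM oU (smooth_area k)); apply: (class_CV oU _ (Cg 0 0 k)) => q Uq.
  by rewrite gt_eqF// (mo_g00 Hg).
rewrite /connection_form; case: (i == 0); [exact: (class_CN oU (C 1))|exact: C].
Qed.

(** Liouville's formula: up to sign, the curvature form is the exterior derivative
of the connection form. *)
Lemma liouville p : U p ->
  area_density p * chart_curvature g p = partial 0 (connection_form 0) p + partial 1 (connection_form 1) p.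
Proof.
move=> Up; have a0 : area_density p != 0 by rewrite gt_eqF// area_gt0.
have E0 : g p 0 0 != 0 by rewrite gt_eqF// (mo_g00 Hg).
have hQ i j := has_partialM (has_partialM (area_has_partial i Up) (has_partialV E0 (hg 0 0 i Up)))
  (hG 1 0 j i Up).
rewrite [connection_form 0]/connection_form [connection_form 1]/connection_form /=.
rewrite (has_partialE (has_partialN (hQ 0 1))) (has_partialE (hQ 1 0)).
rewrite (metric_compat 0 0 0 Up) (metric_compat 1 0 0 Up) !sum2.
have -> : chart_curvature g p = - (riemann g 1 0 1 0 p / g p 0 0).
  rewrite /chart_curvature -[X in X / _]/(lowered 1 0 p); apply: (mulIf E0).
  rewrite mulNr divfK// mulrAC riemann10// mulNr mulfK//; exact: mo_det_neq0.
rewrite /riemann !sum2 (mo_sym Hg Up 1 0).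
rewrite (christoffel_sym 0 1 0 Up) (christoffel_sym 1 1 0 Up).
have -> : partial 0 (Gam 1 1 0) p = partial 0 (Gam 1 0 1) p.
  by apply: (partial_ext oU _ Up) => q; rewrite inE => Uq; exact: christoffel_sym.
by move: E0; generalize (area_density p); atoms; field.
Qed.

Lemma smooth_curvature : smooth_on U (chart_curvature g).
Proof.
move=> k; rewrite /chart_curvature.
apply: (class_CM oU); last first.
  by apply: (class_CV oU _ (smooth_det k)); exact: mo_det_neq0.
apply: (class_C_sum oU) => l; apply: (class_CM oU _ (Cg l 0 k)).
have CG a b d : class_C U k (Gam a b d) := smooth_christoffel a b d k.
have CdG i a b d : class_C U k (partial i (Gam a b d)).
  exact: (class_C_partial i (smooth_christoffel a b d k.+1)).
apply: (class_CD oU (class_CB oU (CdG _ _ _ _) (CdG _ _ _ _))).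
apply: (class_C_sum oU) => m.
exact: (class_CB oU (class_CM oU (CG _ _ _) (CG _ _ _)) (class_CM oU (CG _ _ _) (CG _ _ _))).
Qed.

End metric.

(** * Naturality under a change of coordinates *)

Section naturality.
Variable R : realType.
Local Notation plane := 'rV[R]_2.

Lemma lin2 (a b c d x y : R) : a * d - b * c != 0 ->
  a * x + b * y = 0 -> c * x + d * y = 0 -> x = 0 /\ y = 0.
Proof.
move=> D0 e1 e2; split; apply: (mulfI D0); rewrite mulr0.
  have -> : (a * d - b * c) * x = d * (a * x + b * y) - b * (c * x + d * y) by ring.
  by rewrite e1 e2 !mulr0 subrr.
have -> : (a * d - b * c) * y = a * (c * x + d * y) - c * (a * x + b * y) by ring.
by rewrite e1 e2 !mulr0 subrr.
Qed.

Variables (U : set plane) (g : plane -> 'M[R]_2) (Hg : metric_on U g).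
Variables (V : set plane) (Th : plane -> plane) (gh : plane -> 'M[R]_2).
Hypothesis oV : open V.
Hypothesis VU : forall q, V q -> U (Th q).
Hypothesis CT : forall c, smooth_on V (fun q => Th q 0 c).
Hypothesis Jdet : forall q, V q -> \det (jacobian_mx Th q) != 0.
Hypothesis ghE : forall q, V q ->
  gh q = jacobian_mx Th q *m g (Th q) *m (jacobian_mx Th q)^T.

Let oU := mo_open Hg.

Definition slope c i q : R := partial i (fun r => Th r 0 c) q.
Local Notation t := slope.
Local Notation Gam := (christoffel g).
Local Notation Gamh := (christoffel gh).

Lemma jacobian_slope q i c : jacobian_mx Th q i c = t c i q.
Proof. by rewrite mxE. Qed.

Lemma slope_det q : V q -> t 0 0 q * t 1 1 q - t 0 1 q * t 1 0 q != 0.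
Proof.
by move=> /Jdet; rewrite det2 !jacobian_slope mulrC [X in _ - X]mulrC mulrC.
Qed.

Lemma pull_entry q j l : V q ->
  gh q j l = \sum_(a < 2) \sum_(b < 2) t a j q * t b l q * g (Th q) a b.
Proof.
move=> Vq; rewrite (ghE Vq) mxE.
rewrite exchange_big; apply: eq_bigr => b _; rewrite mxE mulr_suml; apply: eq_bigr => a _.
by rewrite !mxE mulrAC.
Qed.

Lemma smooth_slope c i : smooth_on V (t c i).
Proof. by move=> k; apply: class_C_partial; exact: CT. Qed.

Lemma smooth_comp f : smooth_on U f -> smooth_on V (fun q => f (Th q)).
Proof. by move=> Cf k; apply: (class_C_comp oV oU VU _ (Cf k)) => j; exact: CT. Qed.

Lemma pull_det q : V q -> \det (gh q) = \det (jacobian_mx Th q) ^+ 2 * \det (g (Th q)).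
Proof. by move=> Vq; rewrite ghE// !det_mulmx det_tr expr2; ring. Qed.

Lemma pull_metric : metric_on V gh.
Proof.
have gs q : V q -> forall i j, gh q i j = gh q j i.
  move=> Vq i j; rewrite (pull_entry i j Vq) (pull_entry j i Vq) exchange_big.
  apply: eq_bigr => a _; apply: eq_bigr => b _.
  by rewrite (mo_sym Hg (VU Vq) b a); congr (_ * _); exact: mulrC.
split=> // [i j k|q Vq|q Vq].
- apply: (@class_C_ext _ _ oV k
    (fun q => \sum_(a < 2) \sum_(b < 2) t a i q * t b j q * g (Th q) a b)).
    by move=> q; rewrite inE => Vq; rewrite pull_entry.
  apply: (class_C_sum oV) => a; apply: (class_C_sum oV) => b.
  apply: (class_CM oV); first exact: (class_CM oV (smooth_slope a i k) (smooth_slope b j k)).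
  exact: (smooth_comp (mo_smooth Hg a b)).
- rewrite (pull_det Vq); apply: mulr_gt0; last exact: mo_det Hg _ (VU Vq).
  by rewrite exprn_even_gt0//= (Jdet Vq).
rewrite pull_entry// !sum2 (mo_sym Hg (VU Vq) 1 0).
have := mo_det Hg (VU Vq); have := mo_g00 Hg (VU Vq); have := slope_det Vq.
rewrite det2 (mo_sym Hg (VU Vq) 1 0).
generalize (t 0 0 q) (t 0 1 q) (t 1 0 q) (t 1 1 q) (g (Th q) 0 0) (g (Th q) 0 1) (g (Th q) 1 1).
move=> x x' y y' e f h D e0 d0; rewrite -(pmulr_rgt0 _ e0).
have -> : e * (x * x * e + x * y * f + (y * x * f + y * y * h)) =
    (e * x + f * y) ^+ 2 + (e * h - f * f) * y ^+ 2 by ring.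
have [y0|y0] := eqVneq y 0; last first.
  by rewrite ltr_wpDl ?sqr_ge0// mulr_gt0// exprn_even_gt0.
rewrite y0 mulr0 addr0 expr0n /= mulr0 addr0 exprn_even_gt0//=.
apply: mulf_neq0; first by rewrite gt_eqF.
by apply: contra_neq D => ->; rewrite y0 mul0r mulr0 subrr.
Qed.

(** The covariant derivative along the map of its partial derivative j in the
direction i; it is symmetric in i and j. *)
Definition slope2 c i j q : R :=
  partial i (t c j) q + \sum_(a < 2) \sum_(b < 2) Gam c a b (Th q) * t a i q * t b j q.

Ltac slope_atoms := gen_atoms; repeat match goal with
  | |- context [slope2 ?c ?i ?j ?q] => generalize (slope2 c i j q)
  | |- context [slope ?c ?i ?q] => generalize (slope c i q)
  end; intros.

Let ht c i l p (Vp : V p) := class_C_has_partial l (smooth_slope c i 1) Vp.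

Lemma has_partial_pull f p i : smooth_on U f -> V p ->
  has_partial i (fun q => f (Th q)) p (\sum_(e < 2) t e i p * partial e f (Th p)).
Proof.
move=> Cf Vp; have dT j : derivable (fun q => Th q 0 j) p (delta_mx 0 i).
  exact: class_C_derivable (CT j 1) Vp.
by have [] := chain_rule oU (VU Vp) (Cf 1) dT.
Qed.

Lemma slope_sym c i j p : V p -> partial i (t c j) p = partial j (t c i) p.
Proof. by move=> Vp; exact: (partialC i j oV Vp (CT c 2)). Qed.

Lemma slope2_sym c i j p : V p -> slope2 c i j p = slope2 c j i p.
Proof.
move=> Vp; rewrite /slope2 (slope_sym c i j Vp); congr (_ + _); rewrite exchange_big.
apply: eq_bigr => a _; apply: eq_bigr => b _.
by rewrite (christoffel_sym Hg _ b a (VU Vp)) mulrAC.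
Qed.

(** The pulled back metric is <slope j, slope l>, and the connection of g preserves
the bracket. *)
Lemma partial_pull_metric i j l p : V p -> partial i (fun q => gh q j l) p =
  \sum_(a < 2) \sum_(b < 2) g (Th p) a b *
    (slope2 a i j p * t b l p + slope2 a i l p * t b j p).
Proof.
move=> Vp; transitivity (partial i (fun q =>
    \sum_(a < 2) \sum_(b < 2) t a j q * t b l q * g (Th q) a b) p).
  by apply: (partial_ext oV _ Vp) => q; rewrite inE => Vq; exact: pull_entry.
rewrite (has_partialE (has_partial_sum (fun a => has_partial_sum (fun b =>
  has_partialM (has_partialM (ht a j i Vp) (ht b l i Vp))
   (has_partial_pull i (mo_smooth Hg a b) Vp))))).
have gs := mo_sym Hg (VU Vp) 1 0.
have mc e a b := metric_compat Hg e a b (VU Vp).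
move: (mc 0 0 0) (mc 0 0 1) (mc 0 1 0) (mc 0 1 1) (mc 1 0 0) (mc 1 0 1) (mc 1 1 0) (mc 1 1 1).
move: gs; rewrite /slope2; expand_sums; slope_atoms; subst; ring.
Qed.

(** Transformation rule of the Christoffel symbols. By [partial_pull_metric] and the
symmetry of [slope2], the vectors slope2 i j have the same scalar products with the
slopes as the sums on the left; the slopes span the plane and g is definite. *)
Lemma christoffel_pull c i j p : V p -> \sum_(k < 2) Gamh k i j p * t c k p = slope2 c i j p.
Proof.
move=> Vp; have lower l := christoffel_lower pull_metric i j l Vp.
pose v a := (\sum_(k < 2) Gamh k i j p * t a k p) - slope2 a i j p.
have L l : \sum_(a < 2) \sum_(b < 2) g (Th p) a b * v a * t b l p = 0.
  have := lower l; rewrite !(partial_pull_metric _ _ _ Vp).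
  have key (x y u : R) : x = y -> u = x - y -> u = 0 by move=> -> ->; rewrite subrr.
  move/key; apply.
  move: (mo_sym Hg (VU Vp) 1 0) (slope2_sym 0 j i Vp) (slope2_sym 1 j i Vp) (slope2_sym 0 l i Vp).
  move: (slope2_sym 1 l i Vp) (slope2_sym 0 l j Vp) (slope2_sym 1 l j Vp).
  move: (pull_entry 0 l Vp) (pull_entry 1 l Vp).
  by rewrite /v; expand_sums; slope_atoms; subst; field.
suff v0 : v 0 = 0 /\ v 1 = 0.
  by apply/eqP; rewrite -subr_eq0; apply/eqP; case: (ord2P c) => ->; case: v0.
have dg := mo_det_neq0 Hg (VU Vp); rewrite det2 (mo_sym Hg (VU Vp) 1 0) in dg.
have L0 := L 0; have L1 := L 1; clearbody v; have gs := mo_sym Hg (VU Vp) 1 0.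
have D := slope_det Vp.
have [x0 x1] : g (Th p) 0 0 * v 0 + g (Th p) 0 1 * v 1 = 0 /\
    g (Th p) 0 1 * v 0 + g (Th p) 1 1 * v 1 = 0.
  apply: (@lin2 (t 0 0 p) (t 1 0 p) (t 0 1 p) (t 1 1 p)).
  - by move: D; rewrite [t 1 0 p * _]mulrC.
  - rewrite -[RHS]L0; clear L0 L1 L D dg; move: gs; expand_sums.
    by generalize (v 0) (v 1); slope_atoms; subst; ring.
  - rewrite -[RHS]L1; clear L0 L1 L D dg; move: gs; expand_sums.
    by generalize (v 0) (v 1); slope_atoms; subst; ring.
exact: (lin2 dg x0 x1).
Qed.

Lemma partial_slopeE c i j p : V p -> partial i (t c j) p =
  \sum_(k < 2) Gamh k i j p * t c k p
   - \sum_(a < 2) \sum_(b < 2) Gam c a b (Th p) * t a i p * t b j p.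
Proof. by move=> Vp; rewrite christoffel_pull// addrK. Qed.

Lemma partial_slope2 c i j l p : V p ->
  \sum_(k < 2) (partial l (Gamh k i j) p * t c k p + Gamh k i j p * partial l (t c k) p) =
  partial l (partial i (t c j)) p + \sum_(a < 2) \sum_(b < 2)
   (((\sum_(e < 2) t e l p * partial e (Gam c a b) (Th p)) * t a i p
     + Gam c a b (Th p) * partial l (t a i) p) * t b j p
    + Gam c a b (Th p) * t a i p * partial l (t b j) p).
Proof.
move=> Vp; have hG k := class_C_has_partial l (smooth_christoffel pull_metric k i j 1) Vp.
have hL := has_partial_sum (fun k => has_partialM (hG k) (ht c k l Vp)).
have hR : has_partial l (slope2 c i j) p (partial l (partial i (t c j)) p +
  \sum_(a < 2) \sum_(b < 2)
   (((\sum_(e < 2) t e l p * partial e (Gam c a b) (Th p)) * t a i p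
     + Gam c a b (Th p) * partial l (t a i) p) * t b j p
    + Gam c a b (Th p) * t a i p * partial l (t b j) p)).
  apply: has_partialD.
    exact: (class_C_has_partial l (class_C_partial i (smooth_slope c j 2)) Vp).
  apply: has_partial_sum => a; apply: has_partial_sum => b.
  apply: has_partialM (ht b j l Vp); apply: has_partialM (ht a i l Vp).
  exact: (has_partial_pull l (smooth_christoffel Hg c a b) Vp).
rewrite -(has_partialE hR); apply: etrans (esym (has_partialE hL)) _; apply: (partial_ext oV _ Vp) => q; rewrite inE => Vq.
exact: christoffel_pull.
Qed.

(** Differentiate [christoffel_pull] and antisymmetrize; the third derivatives of the
map cancel by Schwarz's theorem, and the second ones are eliminated with
[christoffel_pull] itself. *)
Lemma riemann_pull c p : V p -> \sum_(m < 2) riemann gh m 0 1 1 p * t c m p =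
  \sum_(d < 2) \sum_(a < 2) \sum_(b < 2) riemann g c d a b (Th p) * t d 0 p * t a 1 p * t b 1 p.
Proof.
move=> Vp; have E1 := partial_slope2 c 1 1 0 Vp; have E2 := partial_slope2 c 0 1 1 Vp.
have S3 : partial 0 (partial 1 (t c 1)) p = partial 1 (partial 0 (t c 1)) p.
  exact: (partialC 0 1 oV Vp (smooth_slope c 1 2)).
rewrite S3 in E1.
have key (x1 y1 x2 y2 u v : R) : x1 = y1 -> x2 = y2 ->
    u - v = (x1 - y1) - (x2 - y2) -> u = v.
  by move=> -> ->; rewrite !subrr => /eqP; rewrite subr_eq0 => /eqP.
apply: (key _ _ _ _ _ _ E1 E2).
have T a i j := partial_slopeE a i j Vp.
move: (T c 0 0) (T c 0 1) (T c 1 0) (T c 1 1) (T 0 0 0) (T 0 0 1) (T 0 1 0) (T 0 1 1).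
move: (T 1 0 0) (T 1 0 1) (T 1 1 0) (T 1 1 1).
move: (christoffel_sym pull_metric 0 1 0 Vp) (christoffel_sym pull_metric 1 1 0 Vp).
move: (christoffel_sym Hg 0 1 0 (VU Vp)) (christoffel_sym Hg 1 1 0 (VU Vp)) (christoffel_sym Hg c 1 0 (VU Vp)).
by clear; rewrite /riemann; expand_sums; slope_atoms; subst; ring.
Qed.

Lemma riemann_alt l i j k p : riemann g l i j k p = - riemann g l j i k p.
Proof.
rewrite /riemann opprD opprB -sumrN; congr (_ + _); apply: eq_bigr => m _.
by rewrite opprB.
Qed.

Lemma riemann_diag l i k p : riemann g l i i k p = 0.
Proof. by rewrite /riemann subrr add0r big1// => m _; rewrite subrr. Qed.

(** Contracting [riemann_pull] with the metric, the antisymmetry of the curvature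
tensor in each pair of indices produces the square of the Jacobian determinant,
which cancels against that of the determinant of the metric. *)
Theorem curvature_pull p : V p -> chart_curvature gh p = chart_curvature g (Th p).
Proof.
move=> Vp; rewrite /chart_curvature (pull_det Vp) det2 !jacobian_slope.
have D := slope_det Vp; have dg := mo_det_neq0 Hg (VU Vp).
set Dt := t 0 0 p * t 1 1 p - t 0 1 p * t 1 0 p in D.
have -> : t 0 0 p * t 1 1 p - t 1 0 p * t 0 1 p = Dt by rewrite /Dt [t 1 0 p * _]mulrC.
rewrite -[X in _ = X / _]/(lowered g 1 0 (Th p)).
suff -> : \sum_(l < 2) riemann gh l 0 1 1 p * gh p l 0 = Dt ^+ 2 * lowered g 1 0 (Th p).
  by rewrite invfM mulrACA divff ?mul1r// sqrf_eq0.
have z k : lowered g k k (Th p) = 0.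
  by have := lowered_anti Hg k k (VU Vp) => /eqP; rewrite -addr_eq0 -mulr2n mulrn_eq0 => /eqP.
have E : \sum_(l < 2) riemann gh l 0 1 1 p * gh p l 0 =
  Dt * (t 0 0 p * t 0 1 p * lowered g 0 0 (Th p) + t 0 0 p * t 1 1 p * lowered g 1 0 (Th p) +
        t 1 0 p * t 0 1 p * lowered g 0 1 (Th p) + t 1 0 p * t 1 1 p * lowered g 1 1 (Th p)).
  transitivity (\sum_(a < 2) (\sum_(m < 2) riemann gh m 0 1 1 p * t a m p) *
      \sum_(b < 2) t b 0 p * g (Th p) a b).
    move: (pull_entry 0 0 Vp) (pull_entry 1 0 Vp); expand_sums.
    generalize (riemann gh 0 0 1 1 p) (riemann gh 1 0 1 1 p).
    by slope_atoms; subst; ring.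
  under eq_bigr do rewrite (riemann_pull _ Vp).
  have alt c k := riemann_alt c 1 0 k (Th p).
  have diag c a k := riemann_diag c a k (Th p).
  move: (alt 0 0) (alt 0 1) (alt 1 0) (alt 1 1) (diag 0 0 0) (diag 0 0 1) (diag 0 1 0) (diag 0 1 1).
  move: (diag 1 0 0) (diag 1 0 1) (diag 1 1 0) (diag 1 1 1).
  rewrite /lowered /Dt; expand_sums.
  repeat match goal with |- context [riemann g ?a ?b ?c ?d ?e] => generalize (riemann g a b c d e) end.
  by move: (mo_sym Hg (VU Vp) 1 0); slope_atoms; subst; ring.
rewrite E !z (lowered_anti Hg 0 1 (VU Vp)) /Dt.
by generalize (lowered g 1 0 (Th p)); slope_atoms; ring.
Qed.

(** The inverse metric is contravariant. *)
Lemma inv_pull p a b : V p ->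
  \sum_(i < 2) \sum_(j < 2) invmx (gh p) i j * t a i p * t b j p = invmx (g (Th p)) a b.
Proof.
move=> Vp; have uJ : jacobian_mx Th p \in unitmx by rewrite unitmxE unitfE Jdet.
have ug : g (Th p) \in unitmx by rewrite unitmxE unitfE (mo_det_neq0 Hg (VU Vp)).
have -> : invmx (g (Th p)) = (jacobian_mx Th p)^T *m invmx (gh p) *m jacobian_mx Th p.
  rewrite (ghE Vp).
  have E : (jacobian_mx Th p)^T *m invmx (jacobian_mx Th p *m g (Th p) *m (jacobian_mx Th p)^T)
     *m jacobian_mx Th p *m g (Th p) = 1%:M.
    apply: (can_inj (mulmxK (_ : (jacobian_mx Th p)^T \in unitmx))); first by rewrite unitmx_tr.
    rewrite -!mulmxA [X in _ *m X = _]mulVmx ?mul1mx ?mulmx1//.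
    by rewrite !unitmx_mul uJ ug unitmx_tr.
  by rewrite -[LHS]mul1mx -E mulmxK.
rewrite mxE exchange_big; apply: eq_bigr => k _; rewrite mxE mulr_suml; apply: eq_bigr => l _.
by rewrite [in RHS]mxE !jacobian_slope; congr (_ * _); exact: mulrC.
Qed.

Lemma trace_pull (h : 'I_2 -> 'I_2 -> R) p : V p ->
  \sum_(i < 2) \sum_(j < 2) invmx (gh p) i j *
    (\sum_(a < 2) \sum_(b < 2) t a i p * t b j p * h a b) =
  \sum_(a < 2) \sum_(b < 2) invmx (g (Th p)) a b * h a b.
Proof.
move=> Vp; move: (fun a b => inv_pull a b Vp) => I.
move: (esym (I 0 0)) (esym (I 0 1)) (esym (I 1 0)) (esym (I 1 1)).
expand_sums; generalize (h 0 0) (h 0 1) (h 1 0) (h 1 1).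
by slope_atoms; subst; ring.
Qed.

Lemma partial_pull f i p : class_C U 1 f -> V p ->
  partial i (fun q => f (Th q)) p = \sum_(a < 2) t a i p * partial a f (Th p).
Proof.
move=> Cf Vp; have dT j : derivable (fun q => Th q 0 j) p (delta_mx 0 i).
  exact: class_C_derivable (CT j 1) Vp.
by have [] := chain_rule oU (VU Vp) Cf dT.
Qed.

Theorem grad_norm2_pull f p : class_C U 1 f -> V p ->
  chart_grad_norm2 gh (fun q => f (Th q)) p = chart_grad_norm2 g f (Th p).
Proof.
move=> Cf Vp; rewrite (chart_grad_norm2E pull_metric _ Vp) (chart_grad_norm2E Hg _ (VU Vp)).
move: (fun i => partial_pull i Cf Vp) (fun a b => inv_pull a b Vp) => E I.
move: (E 0) (E 1) (esym (I 0 0)) (esym (I 0 1)) (esym (I 1 0)) (esym (I 1 1)).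
by expand_sums; slope_atoms; subst; ring.
Qed.

(** The second derivatives of the map that appear in those of f o Th are exactly
compensated by the Christoffel symbols, so the Hessian is a tensor. *)
Theorem laplacian_pull f p : class_C U 2 f -> V p ->
  chart_laplacian gh (fun q => f (Th q)) p = chart_laplacian g f (Th p).
Proof.
move=> Cf Vp; have Cf1 := class_C_pred Cf.
have Cfh : class_C V 2 (fun q => f (Th q)).
  by apply: (class_C_comp oV oU VU _ Cf) => j; exact: CT.
rewrite (laplacian_hess pull_metric Cfh Vp) (laplacian_hess Hg Cf (VU Vp)).
have E2 i j : partial i (partial j (fun q => f (Th q))) p =
  \sum_(a < 2) (partial i (t a j) p * partial a f (Th p) +
     t a j p * \sum_(b < 2) t b i p * partial b (partial a f) (Th p)).
  transitivity (partial i (fun q => \sum_(a < 2) t a j q * partial a f (Th q)) p).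
    by apply: (partial_ext oV _ Vp) => q; rewrite inE => Vq; exact: partial_pull.
  apply: has_partialE; apply: has_partial_sum => a; apply: has_partialM (ht a j i Vp) _.
  have dT l : derivable (fun q => Th q 0 l) p (delta_mx 0 i).
    exact: class_C_derivable (CT l 1) Vp.
  by have [] := chain_rule oU (VU Vp) (class_C_partial a Cf) dT.
have H i j : partial i (partial j (fun q => f (Th q))) p -
    \sum_(k < 2) Gamh k i j p * partial k (fun q => f (Th q)) p =
  \sum_(a < 2) \sum_(b < 2) t a i p * t b j p *
   (partial a (partial b f) (Th p) - \sum_(k < 2) Gam k a b (Th p) * partial k f (Th p)).
  rewrite E2.
  move: (partial_pull 0 Cf1 Vp) (partial_pull 1 Cf1 Vp) (partial_slopeE 0 i j Vp) (partial_slopeE 1 i j Vp).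
  by expand_sums; slope_atoms; subst; ring.
rewrite /hess_trace.
under eq_bigr do under eq_bigr do rewrite H.
exact: (trace_pull (fun a b => partial a (partial b f) (Th p) -
  \sum_(k < 2) Gam k a b (Th p) * partial k f (Th p)) Vp).
Qed.

End naturality.

(** * The covering of the torus by the plane *)

Section torus_projection.
Variable R : realType.
Local Notation plane := 'rV[R]_2.

Lemma torus_projP (p q : plane) : torus_proj p = torus_proj q <-> p - q \is a mxOver Num.int.
Proof. by split=> [/eqmodP|H]; [|apply/eqmodP]. Qed.

Lemma torus_proj_shift (p z : plane) : z \is a mxOver Num.int ->
  torus_proj (p + z) = torus_proj p.
Proof. by move=> zi; apply/torus_projP; rewrite addrAC subrr add0r. Qed.

Lemma torus_proj_surj (x : torus R) : exists p : plane, torus_proj p = x.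
Proof. by exists (repr x); exact: reprK. Qed.

Lemma torus_proj_continuous : continuous (@torus_proj R).
Proof. exact: pi_continuous. Qed.

(** The preimage of the image of A is the union of its integer translates. *)
Lemma torus_proj_open (A : set plane) : open A -> open (@torus_proj R @` A).
Proof.
move=> oA; rewrite /open /= /quotient_open.
rewrite [X in open X](_ : _ = \bigcup_(z in [set z : plane | z \is a mxOver Num.int])
   ((fun p => p + z) @^-1` A)).
  apply: bigcup_open => z zi; apply: open_comp => // p _.
  by apply: (@continuousD _ _ _ id (cst z)); [exact: cvg_id|exact: cst_continuous].
apply/seteqP; split=> [p [q Aq qp]|p [z zi Az]].
  exists (q - p); last by rewrite /= addrC subrK.
  by apply/torus_projP.
by exists (p + z) => //; exact: torus_proj_shift.
Qed.

Lemma int_small (p : plane) : p \is a mxOver Num.int -> `|p| < 1 -> p = 0.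
Proof.
move=> /mxOverP pi; rewrite norm2 gt_max => /andP[p0 p1]; apply: row2P; rewrite mxE.
  apply/eqP; apply: contraTT p0; rewrite -leNgt; exact: norm_intr_ge1.
apply/eqP; apply: contraTT p1; rewrite -leNgt; exact: norm_intr_ge1.
Qed.

(** Two points of an open ball of radius 1/2 are at distance less than 1, so they
cannot differ by a nonzero integer vector. *)
Lemma torus_proj_inj (p q r : plane) : ball p 2^-1 q -> ball p 2^-1 r ->
  torus_proj q = torus_proj r -> q = r.
Proof.
rewrite -ball_normE /= => pq pr /torus_projP qr.
apply/eqP; rewrite -subr_eq0; apply/eqP; apply: int_small => //.
have -> : q - r = (p - r) - (p - q) by rewrite opprB [RHS]addrC addrA subrK.
apply: le_lt_trans (ler_normB _ _) _.
by apply: lt_le_trans (ltrD pr pq) _; rewrite le_eqVlt; apply/orP; left; apply/eqP; field.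
Qed.

Lemma torus_chart_funE (p q : plane) : ball p 2^-1 q ->
  chart_fun (torus_chart p) (torus_proj q) = q.
Proof.
move=> pq /=; case: xgetP => [r _ [pr rq]|/(_ q)]; first exact: torus_proj_inj pr pq rq.
by case; split.
Qed.

Lemma torus_atlas (p : plane) : atlas (torus R) (torus_chart p).
Proof. by exists p. Qed.

End torus_projection.

(** * Charts of the surface *)

Section charts.
Variables (R : realType) (S : charted_space R).
Local Notation plane := 'rV[R]_2.

(** Unlike the definition, this asks for a value that all charts share, and so for the
independence of the chart. *)
Lemma from_chartsE (Q : chart R S -> plane -> R) x v :
  (exists2 phi, atlas S phi & chart_dom phi x) ->
  (forall phi, atlas S phi -> chart_dom phi x -> Q phi (chart_fun phi x) = v) ->
  from_charts Q x = v.
Proof.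
move=> [phi aphi px] Qv; rewrite /from_charts; case: xgetP => [y _ [psi [apsi xpsi] <-]|H].
  exact: Qv.
by case: (H v); exists phi => //; exact: Qv.
Qed.

Hypothesis surf : smooth_surface S.

Lemma surf_chart phi : atlas S phi -> is_chart phi.
Proof. by case: surf => _ _ _ [H _ _]; exact: H. Qed.

Lemma surf_cover x : exists2 phi, atlas S phi & chart_dom phi x.
Proof. by case: surf => _ _ _ [_ H _]; exact: H. Qed.

Lemma surf_transition phi psi : atlas S phi -> atlas S psi ->
  smooth_map_on (overlap phi psi) (transition phi psi).
Proof. by case: surf => _ _ _ [_ _ H]; exact: H. Qed.

Lemma chart_img_preimage (T : topologicalType) (f : S -> T) (B : set T) (phi : chart R S) : is_chart phi ->
  continuous f -> open B -> open (chart_img phi `&` (f \o chart_inv phi) @^-1` B).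
Proof.
move=> [[_ oi] _ _ _ ci] cf oB; rewrite openE => p [ip Bp].
have cp : {for p, continuous (f \o chart_inv phi)}.
  by apply: continuous_comp; [exact: ci|exact: cf].
apply: filterI; first exact: open_nbhs_nbhs.
by apply: cp; exact: open_nbhs_nbhs.
Qed.

Lemma open_overlap phi psi : atlas S phi -> atlas S psi -> open (overlap phi psi).
Proof.
move=> aphi apsi; apply: (chart_img_preimage (f := id) (surf_chart aphi) (fun x => cvg_id)).
by case: (surf_chart apsi) => [[]].
Qed.

Variable g : metric_tensor S.
Hypothesis Hg : riemannian_metric g.

Lemma chart_metric phi : atlas S phi -> metric_on (chart_img phi) (g phi).
Proof.
move=> aphi; have [[_ oi] _ _ _ _] := surf_chart aphi.
have [sm sy pd] := Hg.1 phi aphi.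
have sym q : chart_img phi q -> forall i j, g phi q i j = g phi q j i.
  by move=> Uq i j; rewrite -[in LHS](sy q Uq) mxE.
have quad q (x y : R) : chart_img phi q ->
    (pt x y *m g phi q *m (pt x y)^T) 0 0 =
    x * x * g phi q 0 0 + x * y * g phi q 0 1 + (x * y * g phi q 0 1 + y * y * g phi q 1 1).
  move=> Uq; rewrite !mxE sum2 !mxE !sum2 !mxE /= (sym q Uq 1 0).
  by atoms; ring.
have g00 q : chart_img phi q -> 0 < g phi q 0 0.
  move=> Uq; have := pd q Uq (pt 1 0); rewrite quad// !mul0r !mulr0 !mul0r !mul1r !addr0.
  apply; apply/eqP => /rowP /(_ 0); rewrite !mxE /= => /eqP; rewrite oner_eq0.
  by [].
split=> // q Uq; rewrite det2 (sym q Uq 1 0).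
(* On this vector the quadratic form takes the value g_00 times the determinant. *)
have := pd q Uq (pt (- g phi q 0 1) (g phi q 0 0)); rewrite quad//.
set e := g phi q 0 0; set f := g phi q 0 1; set h := g phi q 1 1.
have -> : - f * - f * e + - f * e * f + (- f * e * f + e * e * h) = e * (e * h - f * f) by ring.
rewrite (pmulr_rgt0 _ (g00 q Uq)); apply; apply/eqP => /rowP /(_ 1); rewrite !mxE /=.
by move/eqP; rewrite gt_eqF// g00.
Qed.

End charts.

Section locality.
Variables (R : realType) (U : set 'rV[R]_2) (g : 'rV[R]_2 -> 'M[R]_2).
Hypothesis Hg : metric_on U g.

Lemma chart_laplacian_ext f1 f2 p : class_C U 2 f1 -> {in U, f1 =1 f2} -> U p ->
  chart_laplacian g f1 p = chart_laplacian g f2 p.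
Proof.
move=> C1 E Up; have oU := mo_open Hg; have C2 := class_C_ext oU E C1.
rewrite (laplacian_hess Hg C1 Up) (laplacian_hess Hg C2 Up) /hess_trace.
have E1 i q : U q -> partial i f1 q = partial i f2 q by move=> Uq; exact: (partial_ext oU i Uq E).
have E2 i j : partial i (partial j f1) p = partial i (partial j f2) p.
  by apply: (partial_ext oU i Up) => q; rewrite inE; exact: E1.
apply: eq_bigr => i _; apply: eq_bigr => j _; rewrite E2.
have -> : \sum_(k < 2) christoffel g k i j p * partial k f1 p =
    \sum_(k < 2) christoffel g k i j p * partial k f2 p.
  by apply: eq_bigr => k _; rewrite (E1 k p Up).
by [].
Qed.

Lemma chart_grad_norm2_ext f1 f2 p : {in U, f1 =1 f2} -> U p ->
  chart_grad_norm2 g f1 p = chart_grad_norm2 g f2 p.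
Proof.
move=> E Up; rewrite !(chart_grad_norm2E Hg _ Up).
have E1 i : partial i f1 p = partial i f2 p by exact: (partial_ext (mo_open Hg) i Up E).
by apply: eq_bigr => i _; apply: eq_bigr => j _; rewrite !E1.
Qed.

End locality.

Transparent christoffel.

(** * The metric lifted to the plane, and the conclusion *)

Section cover.
Variables (R : realType) (S : charted_space R) (g : metric_tensor S).
Local Notation plane := 'rV[R]_2.
Hypothesis surf : smooth_surface S.
Hypothesis Hg : riemannian_metric g.
Variables (f : S -> torus R) (h : torus R -> S).
Hypotheses (fh : cancel f h) (hf : cancel h f).
Hypotheses (sf : smooth_map f) (sh : smooth_map h).

Definition cover (p : plane) : S := h (torus_proj p).
Definition patch (phi : chart R S) : set plane := [set p | chart_dom phi (cover p)].
(** The covering read in a chart of the surface: a local diffeomorphism from an open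
part of the plane to the chart. *)
Definition local_map (phi : chart R S) (p : plane) : plane := chart_fun phi (cover p).

Lemma cover_shift p z : z \is a mxOver Num.int -> cover (p + z) = cover p.
Proof. by move=> zi; rewrite /cover torus_proj_shift. Qed.

Lemma cover_surj x : exists p, cover p = x.
Proof. by have [p px] := torus_proj_surj (f x); exists p; rewrite /cover px. Qed.

Lemma cover_continuous : continuous cover.
Proof.
move=> p; apply: (@continuous_comp _ _ _ (@torus_proj R) h).
  exact: torus_proj_continuous.
exact: sh.1.
Qed.

Lemma open_patch phi : atlas S phi -> open (patch phi).
Proof.
move=> aphi; apply: (open_comp (f := cover)) => [p _|]; first exact: cover_continuous.
by case: (surf_chart surf aphi) => [[]].
Qed.

Lemma local_map_img phi p : atlas S phi -> patch phi p -> chart_img phi (local_map phi p).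
Proof. by move=> aphi Vp; case: (surf_chart surf aphi) => _ H _ _ _; case: (H _ Vp). Qed.

Lemma chart_invK phi p : atlas S phi -> patch phi p -> chart_inv phi (local_map phi p) = cover p.
Proof. by move=> aphi Vp; case: (surf_chart surf aphi) => _ H _ _ _; case: (H _ Vp). Qed.

Lemma smooth_local_map phi c : atlas S phi -> smooth_on (patch phi) (fun q => local_map phi q 0 c).
Proof.
move=> aphi k; apply: class_C_local => p Vp.
have H := sh.2 (torus_chart p) phi (torus_atlas p) aphi c k.
exists (ball p 2^-1 `&` (h \o @torus_proj R) @^-1` chart_dom phi); last exact: H.
by split => //; exact: ballxx.
Qed.

Lemma derivable_local_map phi p c v : atlas S phi -> patch phi p ->
  derivable (fun q => local_map phi q 0 c) p (delta_mx 0 v).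
Proof. by move=> aphi Vp; exact: class_C_derivable (smooth_local_map c aphi 1) Vp. Qed.

(** The inverse diffeomorphism, read in the torus chart centred at p, is a smooth local
left inverse of [local_map]; the chain rule makes the Jacobian matrix invertible. *)
Lemma jacobian_neq0 phi p : atlas S phi -> patch phi p -> \det (jacobian_mx (local_map phi) p) != 0.
Proof.
move=> aphi Vp; pose psi := torus_chart p.
pose G := chart_fun psi \o f \o chart_inv phi.
pose W := chart_img phi `&` (f \o chart_inv phi) @^-1` chart_dom psi.
have oW : open W.
  apply: (chart_img_preimage (surf_chart surf aphi) sf.1).
  by apply: torus_proj_open; exact: ball_open.
have CG j : class_C W 1 (fun q => G q 0 j) := sf.2 phi psi aphi (torus_atlas p) j 1%N.
pose N := ball p (2^-1 : R) `&` patch phi.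
have oN : open N by apply: openI; [exact: ball_open|exact: open_patch].
have Np : N p by split => //; exact: ballxx.
have GE q : N q -> G (local_map phi q) = q.
  by move=> [bq Vq]; rewrite /G /= chart_invK// /cover hf; exact: torus_chart_funE.
have Wp : W (local_map phi p).
  split; first exact: local_map_img.
  by rewrite /= chart_invK// /cover hf; exists p => //; exact: ballxx.
have JG : jacobian_mx (local_map phi) p *m jacobian_mx G (local_map phi p) = 1%:M.
  apply/matrixP => i j; rewrite !mxE.
  have /(_ i) := partial_comp (T := local_map phi) oW Wp (CG j)
    (fun c => derivable_local_map aphi Vp).
  have -> : partial i ((fun q => G q 0 j) \o local_map phi) p = (j == i)%:R.
    rewrite -(coord_derive p i j).2; apply: (partial_ext oN _ Np) => q.
    by rewrite inE => Nq; rewrite /= GE.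
  by rewrite eq_sym => ->; apply: eq_bigr => a _; rewrite !mxE.
by apply: contra_eq_neq (congr1 determinant JG) => D0; rewrite det_mulmx D0 mul0r det1 eq_sym oner_eq0.
Qed.

Lemma jacobian_change phi psi p : atlas S phi -> atlas S psi -> patch phi p -> patch psi p ->
  jacobian_mx (local_map psi) p =
  jacobian_mx (local_map phi) p *m jacobian_mx (transition phi psi) (local_map phi p).
Proof.
move=> aphi apsi Vp Wp; have oO := open_overlap surf aphi apsi.
have oN : open (patch phi `&` patch psi) by apply: openI; exact: open_patch.
have Op : overlap phi psi (local_map phi p).
  by split; [exact: local_map_img|rewrite /= chart_invK].
apply/matrixP => i j; rewrite !mxE.
transitivity (partial i ((fun q => transition phi psi q 0 j) \o local_map phi) p).
  apply: (partial_ext oN _ (conj Vp Wp)) => q; rewrite inE => -[Vq Wq].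
  by rewrite /transition /= chart_invK.
rewrite (partial_comp oO Op (surf_transition surf aphi apsi j 1%N)
    (fun c => derivable_local_map aphi Vp)).
by apply: eq_bigr => a _; rewrite !mxE.
Qed.

Definition pullback phi p (u : plane) : 'M[R]_2 :=
  jacobian_mx (local_map phi) p *m g phi u *m (jacobian_mx (local_map phi) p)^T.

(** All charts give the same matrix ([cover_metricE]), by the cocycle condition on the
metric tensor. *)
Definition cover_metric p : 'M[R]_2 :=
  \matrix_(i, j) from_charts (fun phi u => pullback phi p u i j) (cover p).

Lemma cover_metricE phi p : atlas S phi -> patch phi p -> cover_metric p = pullback phi p (local_map phi p).
Proof.
move=> aphi Vp; apply/matrixP => i j; rewrite mxE; apply: from_chartsE => [|psi apsi Wp].
  exact: surf_cover.
have Op : overlap psi phi (local_map psi p).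
  by split; [exact: local_map_img|rewrite /= chart_invK].
rewrite -[chart_fun psi (cover p)]/(local_map psi p) /pullback.
rewrite (jacobian_change apsi aphi Wp Vp) (Hg.2 psi phi apsi aphi _ Op).
have -> : transition psi phi (local_map psi p) = local_map phi p.
  by rewrite /transition /= chart_invK.
by rewrite trmx_mul !mulmxA.
Qed.

Lemma cover_metric_patch phi : atlas S phi -> metric_on (patch phi) cover_metric.
Proof.
move=> aphi; apply: (pull_metric (chart_metric surf Hg aphi) (Th := local_map phi)).
- exact: open_patch.
- by move=> q; exact: local_map_img.
- by move=> c; exact: smooth_local_map.
- by move=> q; exact: jacobian_neq0.
- by move=> q; exact: cover_metricE.
Qed.

Lemma cover_metric_on : metric_on setT cover_metric.
Proof.
have H p : exists2 phi, atlas S phi & patch phi p by exact: (surf_cover surf (cover p)).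
split=> [|i j k|q _|q _|q _]; first exact: openT.
- apply: class_C_local => p _; have [phi aphi Vp] := H p.
  by exists (patch phi) => //; exact: mo_smooth (cover_metric_patch aphi) i j k.
- by have [phi aphi Vp] := H q; exact: mo_sym (cover_metric_patch aphi) _ Vp.
- by have [phi aphi Vp] := H q; exact: mo_det (cover_metric_patch aphi) _ Vp.
- by have [phi aphi Vp] := H q; exact: mo_g00 (cover_metric_patch aphi) _ Vp.
Qed.

Lemma cover_metric_shift p z : z \is a mxOver Num.int -> cover_metric (p + z) = cover_metric p.
Proof.
move=> zi; have C := cover_shift p zi.
have J phi : jacobian_mx (local_map phi) (p + z) = jacobian_mx (local_map phi) p.
  apply/matrixP => k l; rewrite !mxE; apply: periodic_partial => // q w wi.
  by rewrite /local_map cover_shift.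
move: (p + z) C J => q C J; apply/matrixP => i j; rewrite [LHS]mxE [RHS]mxE C.
apply: (congr1 (fun Q => from_charts Q (cover p))).
by apply/funext => phi; apply/funext => u; rewrite /pullback J.
Qed.

Local Notation K := (gaussian_curvature g).
Local Notation Kh := (chart_curvature cover_metric).

Lemma curvature_local phi p : atlas S phi -> patch phi p ->
  Kh p = chart_curvature (g phi) (local_map phi p).
Proof.
move=> aphi Vp; apply: (curvature_pull (chart_metric surf Hg aphi) (open_patch aphi)) => //.
- by move=> q; exact: local_map_img.
- by move=> c; exact: smooth_local_map.
- by move=> q; exact: jacobian_neq0.
- by move=> q; exact: cover_metricE.
Qed.

Lemma curvature_cover p : K (cover p) = Kh p.
Proof.
apply: from_chartsE => [|phi aphi Vp]; first exact: surf_cover.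
by rewrite (curvature_local aphi Vp).
Qed.

(** The values of K off the chosen point enter the Laplacian, so it must be known that
K read in a chart is the curvature computed in that chart at all points. *)
Lemma curvature_chart phi : atlas S phi ->
  {in chart_img phi, chart_curvature (g phi) =1 K \o chart_inv phi}.
Proof.
move=> aphi u; rewrite inE => Uu; have [p pu] := cover_surj (chart_inv phi u).
have [_ _ H _ _] := surf_chart surf aphi; have [Du E] := H u Uu.
have Vp : patch phi p by rewrite /patch /= pu.
by rewrite /= -pu curvature_cover (curvature_local aphi Vp) /local_map pu E.
Qed.

Lemma laplacian_cover p : laplacian g K (cover p) = chart_laplacian cover_metric Kh p.
Proof.
apply: from_chartsE => [|phi aphi Vp]; first exact: surf_cover.
have Hphi := chart_metric surf Hg aphi; have Cphi := smooth_curvature Hphi 2.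
rewrite -[chart_fun phi (cover p)]/(local_map phi p).
rewrite -(chart_laplacian_ext Hphi Cphi (curvature_chart aphi) (local_map_img aphi Vp)).
rewrite -(laplacian_pull Hphi (open_patch aphi) (fun q => local_map_img aphi)
  (fun c => smooth_local_map c aphi) (fun q => jacobian_neq0 aphi) (fun q => cover_metricE aphi) Cphi Vp).
apply: esym; apply: (chart_laplacian_ext (cover_metric_patch aphi)) => //.
  exact: smooth_curvature (cover_metric_patch aphi) 2.
by move=> q; rewrite inE; exact: curvature_local.
Qed.

Lemma grad_norm2_cover p : grad_norm2 g K (cover p) = chart_grad_norm2 cover_metric Kh p.
Proof.
apply: from_chartsE => [|phi aphi Vp]; first exact: surf_cover.
have Hphi := chart_metric surf Hg aphi; have Cphi := smooth_curvature Hphi 1.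
rewrite -[chart_fun phi (cover p)]/(local_map phi p).
rewrite -(chart_grad_norm2_ext Hphi (curvature_chart aphi) (local_map_img aphi Vp)).
rewrite -(grad_norm2_pull Hphi (open_patch aphi) (fun q => local_map_img aphi)
  (fun c => smooth_local_map c aphi) (fun q => jacobian_neq0 aphi) (fun q => cover_metricE aphi) Cphi Vp).
apply: esym; apply: (chart_grad_norm2_ext (cover_metric_patch aphi)) => //.
by move=> q; rewrite inE; exact: curvature_local.
Qed.

Variables (a b c : R).
Hypothesis eqn : forall x, (c - K x) * laplacian g K x + grad_norm2 g K x
                + (a * K x + b) * (K x - c) ^+ 2 = 0.

Lemma cover_ricci_system :
  ricci_system a b c Kh (area_density cover_metric) (conductivity cover_metric) (connection_form cover_metric).
Proof.
have Hm := cover_metric_on; have per (F : 'M[R]_2 -> R) : biperiodic (fun p => F (cover_metric p)).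
  by move=> p z zi; rewrite cover_metric_shift.
have perC k i j : biperiodic (christoffel cover_metric k i j).
  move=> p z zi; pose D e m l r := partial e (fun q => cover_metric q m l) r.
  have E r : christoffel cover_metric k i j r = 2^-1 * \sum_(l < 2) invmx (cover_metric r) k l *
    (D i j l r + D j i l r - D l i j r) by [].
  have Dz e m l : D e m l (p + z) = D e m l p.
    exact: (periodic_partial e (per (fun M => M m l)) p zi).
  rewrite (E p) (E (p + z)) (cover_metric_shift p zi); clearbody D.
  apply: (congr1 (fun x => 2^-1 * x)); apply: eq_bigr => l _.
  by rewrite (Dz i j l) (Dz j i l) (Dz l i j).
split.
- exact: smooth_curvature Hm 2.
- by move=> p z zi; rewrite -!curvature_cover cover_shift.
- exact: smooth_area Hm 0.
- exact: (per (fun M => Num.sqrt (\det M))).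
- by move=> p; exact: area_gt0 Hm p I.
- by move=> i j; exact: smooth_conductivity Hm i j 1.
- by move=> i j; exact: (per (fun M => Num.sqrt (\det M) * invmx M i j)).
- by move=> p; exact: conductivity_sym Hm p I.
- by move=> p; exact: conductivity_det Hm p I.
- by move=> p; exact: conductivity_gt0 Hm p I.
- by move=> i; exact: smooth_connection_form Hm i 1.
- move=> i p z zi; rewrite /connection_form /area_density (cover_metric_shift p zi).
  by rewrite (perC 1 0 1 p z zi) (perC 1 0 0 p z zi).
- by move=> p; exact: liouville Hm p I.
move=> p; have := eqn (cover p); rewrite laplacian_cover grad_norm2_cover curvature_cover.
have CK := smooth_curvature Hm 2.
have r0 : area_density cover_metric p != 0 by rewrite gt_eqF// (area_gt0 Hm).
have -> : div_grad (conductivity cover_metric) Kh p = area_density cover_metric p * chart_laplacian cover_metric Kh p.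
  by rewrite chart_laplacianE mulrA divff// mul1r.
have -> : grad_sq (conductivity cover_metric) Kh p = area_density cover_metric p * chart_grad_norm2 cover_metric Kh p.
  rewrite (chart_grad_norm2E Hm _ I) /grad_sq mulr_sumr; apply: eq_bigr => i _.
  by rewrite mulr_sumr; apply: eq_bigr => j _; rewrite /conductivity !mulrA.
move: (area_density cover_metric p) (chart_laplacian cover_metric Kh p) (chart_grad_norm2 cover_metric Kh p) (Kh p).
by move=> r l n k E; rewrite -[RHS](mulr0 r) -E; ring.
Qed.

End cover.

Theorem proposition5p11 (R : realType) (a b c : R) (S : charted_space R)
    (g : metric_tensor S)
    (hRicci : generalized_Ricci_surface g a b c)
    (htorus : diffeomorphic S (torus R)) :
  let K := gaussian_curvature g in
  [/\ c = 0 -> flat g,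
      0 < c ->
        [/\ b <= 0, (forall x : S, K x <= c) &
            b = 0 -> ~ flat g -> 0 < a /\ (forall x : S, K x < c)] &
      c < 0 ->
        [/\ b <= 0, (forall x : S, c <= K x) &
            b = 0 -> ~ flat g -> a < 0 /\ (forall x : S, c < K x)]].
Proof.
move=> K; have [surf Hg eqn] := hRicci; have [f [h [fh hf sf sh]]] := htorus.
have KE p : K (cover h p) = chart_curvature (cover_metric g h) p.
  exact: (curvature_cover surf Hg hf sf sh).
have all_of (Q : R -> Prop) : (forall p, Q (chart_curvature (cover_metric g h) p)) -> forall x, Q (K x).
  by move=> H x; have [p <-] := cover_surj fh x; rewrite KE.
have nonflat : ~ flat g -> exists p, chart_curvature (cover_metric g h) p != 0.
  move=> nf; apply: contrapT => H; apply: nf; apply: (all_of (fun k => k = 0)) => p.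
  by apply/eqP; apply/negP => /negP n0; apply: H; exists p.
have [c0 cpos cneg] := ricci_core (cover_ricci_system surf Hg fh hf sf sh eqn).
split=> [/c0 H|/cpos [b0 Kc H]|/cneg [b0 Kc H]].
- exact: (all_of (fun k => k = 0)).
- split=> //; first exact: (all_of (fun k => k <= c)).
  by move=> bz /nonflat /(H bz) [a0 K1]; split => //; exact: (all_of (fun k => k < c)).
- split=> //; first exact: (all_of (fun k => c <= k)).
  by move=> bz /nonflat /(H bz) [a0 K1]; split => //; exact: (all_of (fun k => c < k)).
Qed.
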